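(* Assume that $n\ge1$. Then $$[\Delta_n(\lambda):L_n(\mu)]=[M_n(\lambda):L_n(\mu)]$$ for all $\lambda,\mu\in\Lambda_n$, where $[\,\cdot:L_n(\mu)]$ denotes the multiplicity of $L_n(\mu)$ as a composition factor.
   Context: Setting: $k$ is an algebraically closed field, $q\in k^\times$ with $q^4\neq 1$, $m$ is an integer, $\lambda_1=\frac{q^m}{q-q^{-1}}$, $\lambda_2=\frac{q^{-m}}{q-q^{-1}}$, and it is assumed that $\lambda_1\ne\lambda_2$ and $\lambda_1\neq q^2\lambda_2$. Write $[r]=\frac{q^r-q^{-r}}{q-q^{-1}}$ (so $[2]\neq0$). The blob algebra $b_n=b_n(q,m)$ ($n\ge1$) is the unital $k$-algebra on generators $U_0,U_1,\dots,U_{n-1}$ with relations $U_iU_jU_i=U_i$ for $i,j\ge 1$, $|i-j|=1$; $U_i^2=-[2]U_i$ for $i\ge1$; $U_0^2=-[m]U_0$; $U_1U_0U_1=[m-1]U_1$; and $U_iU_j=U_jU_i$ for $|i-j|\ge 2$. Tensor space: let $V$ be a $k$-vector space with basis $v_1,v_2$. Define $R\in \operatorname{End}_k(V\otimes V)$ by $R(v_i\otimes v_i)=q\,v_i\otimes v_i$ ($i=1,2$), $R(v_2\otimes v_1)=v_1\otimes v_2$, $R(v_1\otimes v_2)=v_2\otimes v_1+(q-q^{-1})v_1\otimes v_2$. On $V^{\otimes n}$ let $T_{i+1}=\mathrm{Id}^{\otimes (i-1)}\otimes R\otimes \mathrm{Id}^{\otimes (n-i-1)}$ for $1\le i\le n-1$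 (invertible). For $2\le j\le n$ let $S_j$ be the linear map which on a basis vector $v=v_{i_1}\otimes\cdots\otimes v_{i_n}$ is $S_j(v)=qv$ if $i_{j-1}=i_j$, and which interchanges the tensor factors in positions $j-1$ and $j$ if $i_{j-1}\ne i_j$. Let $\varpi(v_{i_1}\otimes\cdots\otimes v_{i_n})=\lambda_{i_1}\,v_{i_1}\otimes\cdots\otimes v_{i_n}$, $\theta=S_nS_{n-1}\cdots S_2$, $T_1=T_2^{-1}\cdots T_n^{-1}\theta\varpi$. Then $V^{\otimes n}$ is a $b_n$-module with $U_i$ ($i\ge1$) acting as $T_{i+1}-q$ and $U_0$ acting as $T_1-\lambda_1$. Let $\Lambda_n=\{n,n-2,\dots,-n+2,-n\}$. For $\lambda\in\Lambda_n$, $M_n(\lambda)$ is the $b_n$-submodule of $V^{\otimes n}$ spanned by the $v_{i_1}\otimes\cdots\otimes v_{i_n}$ with $\#\{j: i_j=1\}-\#\{j:i_j=2\}=\lambda$. Standard modules: for $n\ge 3$, $e=-\frac1{[2]}U_{n-1}$ is an idempotent of $b_n$, $b_{n-2}\cong e b_n e$ via $U_i\mapsto eU_ie$ ($0\le i\le n-3$), and $G:b_{n-2}\text{-mod}\to b_n\text{-mod}$ is $N\mapsto b_ne\otimes_{eb_ne}N$. The algebra $b_n$ is quasi-hereditary with labelling poset $(\Lambda_n,\prec)$, $\lambda\prec\mu\Leftrightarrow|\lambda|>|\mu|$. Its standard modules $\Delta_n(\lambda)$, $\lambda\in\Lambda_n$, are described up to isomorphism as follows: $\Delta_n(n)$ is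 the one-dimensional module on which all of $U_0,U_1,\dots,U_{n-1}$ act as $0$; $\Delta_n(-n)$ is the one-dimensional module on which $U_1,\dots,U_{n-1}$ act as $0$ and $U_0$ acts as $-[m]$; $\Delta_2(0)=b_2U_1$, the left ideal with basis $\{U_1,U_0U_1\}$; and $\Delta_n(\lambda)=G\,\Delta_{n-2}(\lambda)$ for $n\ge3$ and $\lambda\in\Lambda_n\setminus\{\pm n\}$. Each $\Delta_n(\lambda)$ has a unique simple quotient $L_n(\lambda)$, and $\{L_n(\lambda)\}_{\lambda\in\Lambda_n}$ is a complete set of pairwise non-isomorphic simple $b_n$-modules. *)

(* Defs.v *)
From HB Require Import structures.
From mathcomp Require Import all_boot all_order all_algebra.
From mathcomp Require Import boolp.
From mathcomp Require Import ring.

Set Implicit Arguments.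
Unset Strict Implicit.
Unset Printing Implicit Defensive.

Import Order.TTheory GRing.Theory Num.Theory.
Local Open Scope ring_scope.
Local Open Scope quotient_scope.

(** The unital [k]-algebra with generators [X] and defining relations
    [s = t] for [rel s t] is the type of formal expressions in the generators,
    modulo the smallest congruence that contains [rel] and the axioms of unital
    associative [k]-algebras. [TConst a] denotes the scalar multiple [a] of the
    unit, so modules over this ring are [k]-vector spaces through [TConst]. *)

Inductive term (k X : Type) : Type :=
| TConst of k
| TGen of X
| TAdd of term k X & term k X
| TMul of term k X & term k X.
Arguments TConst {k X}.
Arguments TGen {k X}.

HB.instance Definition _ (k X : Type) := gen_eqMixin (term k X).
HB.instance Definition _ (k X : Type) := gen_choiceMixin (term k X).

Section Presented.
Variables (k : fieldType) (X : Type) (rel : term k X -> term k X -> Prop).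

Inductive pcong : term k X -> term k X -> Prop :=
| pc_rel s t : rel s t -> pcong s t
| pc_refl t : pcong t t
| pc_sym s t : pcong s t -> pcong t s
| pc_trans s t u : pcong s t -> pcong t u -> pcong s u
| pc_add s s' t t' : pcong s s' -> pcong t t' -> pcong (TAdd s t) (TAdd s' t')
| pc_mul s s' t t' : pcong s s' -> pcong t t' -> pcong (TMul s t) (TMul s' t')
| pc_addA s t u : pcong (TAdd s (TAdd t u)) (TAdd (TAdd s t) u)
| pc_addC s t : pcong (TAdd s t) (TAdd t s)
| pc_add0 t : pcong (TAdd (TConst 0) t) t
| pc_mul0 t : pcong (TMul (TConst 0) t) (TConst 0)
| pc_mulA s t u : pcong (TMul s (TMul t u)) (TMul (TMul s t) u)
| pc_mul1 t : pcong (TMul (TConst 1) t) t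
| pc_mulDl s t u : pcong (TMul (TAdd s t) u) (TAdd (TMul s u) (TMul t u))
| pc_mulDr s t u : pcong (TMul s (TAdd t u)) (TAdd (TMul s t) (TMul s u))
| pc_constD a b : pcong (TConst (a + b)) (TAdd (TConst a) (TConst b))
| pc_constM a b : pcong (TConst (a * b)) (TMul (TConst a) (TConst b))
| pc_constC a t : pcong (TMul (TConst a) t) (TMul t (TConst a)).

Definition pcongb (s t : term k X) : bool := `[< pcong s t >].

Lemma pcongb_refl : reflexive pcongb.
Proof. by move=> t; apply/asboolP; exact: pc_refl. Qed.

Lemma pcongb_sym : symmetric pcongb.
Proof.
by move=> s t; apply/asboolP/asboolP; exact: pc_sym.
Qed.

Lemma pcongb_trans : transitive pcongb.
Proof.
by move=> t s u /asboolP h1 /asboolP h2; apply/asboolP; exact: pc_trans h2.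
Qed.

Canonical pcong_equiv := EquivRel pcongb pcongb_refl pcongb_sym pcongb_trans.

Definition presented : Type := {eq_quot pcong_equiv}.

HB.instance Definition _ := Choice.on presented.

Definition pclass (t : term k X) : presented := \pi_({eq_quot pcong_equiv}) t.
Definition prepr (x : presented) : term k X := repr (x : {eq_quot pcong_equiv}).

Lemma preprK x : pclass (prepr x) = x.
Proof. exact: reprK. Qed.

Lemma pclassP s t : pclass s = pclass t <-> pcong s t.
Proof.
split => [/(eqmodP pcong_equiv) h|h]; first exact/asboolP.
by apply/(eqmodP pcong_equiv)/asboolP.
Qed.

Lemma prepr_class t : pcong (prepr (pclass t)) t.
Proof. by apply/pclassP; rewrite preprK. Qed.

Definition padd x y := pclass (TAdd (prepr x) (prepr y)).
Definition pmul x y := pclass (TMul (prepr x) (prepr y)).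
Definition popp x := pmul (pclass (TConst (-1))) x.

Lemma pclass_add s t : pclass (TAdd s t) = padd (pclass s) (pclass t).
Proof. by apply/pclassP/pc_add; apply/pc_sym/prepr_class. Qed.

Lemma pclass_mul s t : pclass (TMul s t) = pmul (pclass s) (pclass t).
Proof. by apply/pclassP/pc_mul; apply/pc_sym/prepr_class. Qed.

Lemma pclass_ind (P : presented -> Prop) :
  (forall t, P (pclass t)) -> forall x, P x.
Proof. by move=> h x; rewrite -(preprK x). Qed.

Lemma paddA : associative padd.
Proof.
elim/pclass_ind => s; elim/pclass_ind => t; elim/pclass_ind => u.
by rewrite -!pclass_add; apply/pclassP; exact: pc_addA.
Qed.

Lemma paddC : commutative padd.
Proof.
elim/pclass_ind => s; elim/pclass_ind => t.
by rewrite -!pclass_add; apply/pclassP; exact: pc_addC.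
Qed.

Lemma padd0 : left_id (pclass (TConst 0)) padd.
Proof.
by elim/pclass_ind => t; rewrite -!pclass_add; apply/pclassP; exact: pc_add0.
Qed.

Lemma pmulA : associative pmul.
Proof.
elim/pclass_ind => s; elim/pclass_ind => t; elim/pclass_ind => u.
by rewrite -!pclass_mul; apply/pclassP; exact: pc_mulA.
Qed.

Lemma pmul1 : left_id (pclass (TConst 1)) pmul.
Proof.
by elim/pclass_ind => t; rewrite -!pclass_mul; apply/pclassP; exact: pc_mul1.
Qed.

Lemma pconstC a x : pmul (pclass (TConst a)) x = pmul x (pclass (TConst a)).
Proof.
by elim/pclass_ind: x => t; rewrite -!pclass_mul; apply/pclassP; exact: pc_constC.
Qed.

Lemma pmulDl : left_distributive pmul padd.
Proof.
elim/pclass_ind => s; elim/pclass_ind => t; elim/pclass_ind => u.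
by rewrite -!(pclass_add, pclass_mul); apply/pclassP; exact: pc_mulDl.
Qed.

Lemma pmulDr : right_distributive pmul padd.
Proof.
elim/pclass_ind => s; elim/pclass_ind => t; elim/pclass_ind => u.
by rewrite -!(pclass_add, pclass_mul); apply/pclassP; exact: pc_mulDr.
Qed.

Lemma pconstD a b :
  pclass (TConst (a + b)) = padd (pclass (TConst a)) (pclass (TConst b)).
Proof. by rewrite -pclass_add; apply/pclassP; exact: pc_constD. Qed.

Lemma pconstM a b :
  pclass (TConst (a * b)) = pmul (pclass (TConst a)) (pclass (TConst b)).
Proof. by rewrite -pclass_mul; apply/pclassP; exact: pc_constM. Qed.

Lemma pmulx1 : right_id (pclass (TConst 1)) pmul.
Proof. by move=> x; rewrite -pconstC pmul1. Qed.

Lemma paddNx : left_inverse (pclass (TConst 0)) popp padd.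
Proof.
move=> x; rewrite /popp -{2}[x]pmul1 -pmulDl -pconstD addNr.
by elim/pclass_ind: x => t; rewrite -pclass_mul; apply/pclassP; exact: pc_mul0.
Qed.

HB.instance Definition _ := GRing.isPzRing.Build presented
  paddA paddC padd0 paddNx pmulA pmul1 pmulx1 pmulDl pmulDr.

Definition pconst (a : k) : presented := pclass (TConst a).
Definition pgen (x : X) : presented := pclass (TGen x).

Lemma pclassD s t : pclass (TAdd s t) = pclass s + pclass t.
Proof. exact: pclass_add. Qed.

Lemma pclassM s t : pclass (TMul s t) = pclass s * pclass t.
Proof. exact: pclass_mul. Qed.

End Presented.

(** Operators on a vector space that satisfy the defining relations make it a
    module over the presented algebra. *)

Section Representations.
Variables (k : fieldType) (X : Type) (rel : term k X -> term k X -> Prop).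

Fixpoint teval (W : lmodType k) (u : X -> {linear W -> W}) (t : term k X)
    (w : W) : W :=
  match t with
  | TConst a => a *: w
  | TGen x => u x w
  | TAdd s t => teval u s w + teval u t w
  | TMul s t => teval u s (teval u t w)
  end.

Record representation := Representation {
  rep_space : lmodType k;
  rep_op : X -> {linear rep_space -> rep_space};
  rep_rel : forall s t, rel s t ->
    forall w, teval rep_op s w = teval rep_op t w }.

Variable r : representation.
Local Notation ev := (teval (rep_op r)).

Lemma tevalD t : {morph ev t : v w / v + w}.
Proof.
elim: t => [a|x|s IHs t IHt|s IHs t IHt] v w /=; rewrite ?scalerDr ?linearD //.
  by rewrite IHs IHt addrACA.
by rewrite IHt IHs.
Qed.

Lemma tevalZ t a w : ev t (a *: w) = a *: ev t w.
Proof.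
elim: t w => [b|x|s IHs t IHt|s IHs t IHt] w /=.
- by rewrite !scalerA mulrC.
- by rewrite linearZ.
- by rewrite IHs IHt scalerDr.
- by rewrite IHt IHs.
Qed.

Lemma teval_cong s t : pcong rel s t -> forall w, ev s w = ev t w.
Proof.
elim => {s t} /=.
- exact: rep_rel.
- by [].
- by move=> s t _ IH w; rewrite IH.
- by move=> s t u _ IH1 _ IH2 w; rewrite IH1 IH2.
- by move=> s s' t t' _ IH1 _ IH2 w; rewrite IH1 IH2.
- by move=> s s' t t' _ IH1 _ IH2 w; rewrite IH2 IH1.
- by move=> s t u w; rewrite addrA.
- by move=> s t w; rewrite addrC.
- by move=> t w; rewrite scale0r add0r.
- by move=> t w; rewrite !scale0r.
- by [].
- by move=> t w; rewrite scale1r.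
- by [].
- by move=> s t u w; rewrite tevalD.
- by move=> a b w; rewrite scalerDl.
- by move=> a b w; rewrite scalerA.
- by move=> a t w; rewrite tevalZ.
Qed.

Definition repmod : Type := rep_space r.

HB.instance Definition _ := GRing.Zmodule.on repmod.

Definition repmod_scale (x : presented rel) (w : repmod) : repmod :=
  ev (prepr x) w.

Lemma repmod_scaleE t w : repmod_scale (pclass rel t) w = ev t w.
Proof. exact/teval_cong/prepr_class. Qed.

Fact repmod_scaleA x y w :
  repmod_scale x (repmod_scale y w) = repmod_scale (x * y) w.
Proof.
elim/pclass_ind: x => s; elim/pclass_ind: y => t.
by rewrite -pclassM !repmod_scaleE.
Qed.

Fact repmod_scale1 : left_id 1 repmod_scale.
Proof. by move=> w; rewrite repmod_scaleE /= scale1r. Qed.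

Fact repmod_scaleDr : right_distributive repmod_scale +%R.
Proof. by move=> x v w; rewrite /repmod_scale tevalD. Qed.

Fact repmod_scaleDl w : {morph repmod_scale^~ w : x y / x + y}.
Proof.
elim/pclass_ind => s; elim/pclass_ind => t.
by rewrite -pclassD !repmod_scaleE.
Qed.

HB.instance Definition _ := GRing.Zmodule_isLmodule.Build (presented rel)
  repmod repmod_scaleA repmod_scale1 repmod_scaleDr repmod_scaleDl.

End Representations.

Section LeftIdeal.
Variables (A : pzRingType) (a : A).

Definition lideal : {pred A^o} := fun x => `[< exists b : A, x = b * a >].

Lemma lidealP (x : A^o) : reflect (exists b : A, x = b * a) (x \in lideal).
Proof. exact: asboolP. Qed.

Fact lideal_submod_closed : submod_closed lideal.
Proof.
split=> [|c x y /lidealP[b ->] /lidealP[b' ->]]; apply/lidealP.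
  by exists 0; rewrite mul0r.
by exists (c * b + b'); rewrite mulrDl -mulrA.
Qed.

HB.instance Definition _ :=
  GRing.isSubmodClosed.Build A A^o lideal lideal_submod_closed.

Record lideal_mod := LIdeal { lideal_val : A^o; _ : lideal_val \in lideal }.

HB.instance Definition _ := [isSub for lideal_val].
HB.instance Definition _ := [Choice of lideal_mod by <:].
HB.instance Definition _ := [SubChoice_isSubLmodule of lideal_mod by <:].

End LeftIdeal.

(** The left [B]-module generated by the symbols [p (x) y], additive in
    [p : P] and in [y : N], subject to [p' (x) y' = p (x) y] whenever
    [bal (p', y') (p, y)]. Elements are represented by finite sums of symbols,
    i.e. sequences of pairs; [B] acts on [P]. If [P] is a [(B, A)]-bimodule and
    [bal] relates [(p a, y)] and [(p, a y)], this is [P (x)_A N]. *)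

Section Tensor.
Variables (B : pzRingType) (P : lmodType B) (N : zmodType).
Variable bal : P * N -> P * N -> Prop.
Hypothesis bal_scale : forall (b : B) u v,
  bal u v -> bal (b *: u.1, u.2) (b *: v.1, v.2).

Inductive tcong : seq (P * N) -> seq (P * N) -> Prop :=
| tc_bal u v : bal u v -> tcong [:: u] [:: v]
| tc_addl p p' y : tcong [:: (p + p', y)] [:: (p, y); (p', y)]
| tc_addr p y y' : tcong [:: (p, y + y')] [:: (p, y); (p, y')]
| tc_0l y : tcong [:: (0, y)] [::]
| tc_catC s t : tcong (s ++ t) (t ++ s)
| tc_cat s s' t t' : tcong s s' -> tcong t t' -> tcong (s ++ t) (s' ++ t')
| tc_refl s : tcong s s
| tc_sym s t : tcong s t -> tcong t s
| tc_trans s t u : tcong s t -> tcong t u -> tcong s u.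

Definition tcongb (s t : seq (P * N)) : bool := `[< tcong s t >].

Lemma tcongb_refl : reflexive tcongb.
Proof. by move=> t; apply/asboolP; exact: tc_refl. Qed.

Lemma tcongb_sym : symmetric tcongb.
Proof. by move=> s t; apply/asboolP/asboolP; exact: tc_sym. Qed.

Lemma tcongb_trans : transitive tcongb.
Proof.
by move=> t s u /asboolP h1 /asboolP h2; apply/asboolP; exact: tc_trans h2.
Qed.

Canonical tcong_equiv := EquivRel tcongb tcongb_refl tcongb_sym tcongb_trans.

Definition tensor of (forall (b : B) u v,
    bal u v -> bal (b *: u.1, u.2) (b *: v.1, v.2)) : Type :=
  {eq_quot tcong_equiv}.

Local Notation T := (tensor bal_scale).

HB.instance Definition _ := Choice.on T.

Definition tclass (s : seq (P * N)) : T := \pi_({eq_quot tcong_equiv}) s.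
Definition trepr (x : T) : seq (P * N) := repr (x : {eq_quot tcong_equiv}).

Lemma treprK x : tclass (trepr x) = x.
Proof. exact: reprK. Qed.

Lemma tclassP s t : tclass s = tclass t <-> tcong s t.
Proof.
split => [/(eqmodP tcong_equiv) h|h]; first exact/asboolP.
by apply/(eqmodP tcong_equiv)/asboolP.
Qed.

Lemma trepr_class s : tcong (trepr (tclass s)) s.
Proof. by apply/tclassP; rewrite treprK. Qed.

Lemma tclass_ind (Q : T -> Prop) : (forall s, Q (tclass s)) -> forall x, Q x.
Proof. by move=> h x; rewrite -(treprK x). Qed.

Definition tmap (b : B) (s : seq (P * N)) := [seq (b *: u.1, u.2) | u <- s].

Lemma tmap_cong b s t : tcong s t -> tcong (tmap b s) (tmap b t).
Proof.
elim=> {s t} /=.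
- by move=> u v h; apply: tc_bal; exact: bal_scale.
- by move=> p p' y; rewrite scalerDr; exact: tc_addl.
- by move=> p y y'; exact: tc_addr.
- by move=> y; rewrite scaler0; exact: tc_0l.
- by move=> s t; rewrite /tmap !map_cat; exact: tc_catC.
- by move=> s s' t t' _ h1 _ h2; rewrite /tmap !map_cat; exact: tc_cat.
- by move=> s; exact: tc_refl.
- by move=> s t _; exact: tc_sym.
- by move=> s t u _ h1 _ h2; exact: tc_trans h2.
Qed.

Definition tadd (x y : T) : T := tclass (trepr x ++ trepr y).
Definition tscale (b : B) (x : T) : T := tclass (tmap b (trepr x)).

Lemma tclass_cat s t : tclass (s ++ t) = tadd (tclass s) (tclass t).
Proof. by apply/tclassP/tc_cat; apply/tc_sym/trepr_class. Qed.

Lemma tclass_map b s : tclass (tmap b s) = tscale b (tclass s).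
Proof. by apply/tclassP/tmap_cong/tc_sym/trepr_class. Qed.

Fact taddA : associative tadd.
Proof.
elim/tclass_ind => s; elim/tclass_ind => t; elim/tclass_ind => u.
by rewrite -!tclass_cat catA.
Qed.

Fact taddC : commutative tadd.
Proof.
elim/tclass_ind => s; elim/tclass_ind => t.
by rewrite -!tclass_cat; apply/tclassP; exact: tc_catC.
Qed.

Fact tadd0 : left_id (tclass [::]) tadd.
Proof. by elim/tclass_ind => s; rewrite -tclass_cat. Qed.

Fact tscaleDl x : {morph tscale^~ x : b c / b + c >-> tadd b c}.
Proof.
move=> b c; elim/tclass_ind: x => s; rewrite -!tclass_map -tclass_cat.
apply/tclassP; elim: s => [|[p y] s IHs] /=; first exact: tc_refl.
apply: (@tc_trans _ ([:: (b *: p, y); (c *: p, y)] ++ (tmap b s ++ tmap c s))).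
  rewrite -cat1s; apply: tc_cat => //=; rewrite scalerDl; exact: tc_addl.
rewrite [X in tcong _ X](_ : _ =
  [:: (b *: p, y)] ++ ((tmap b s ++ [:: (c *: p, y)]) ++ tmap c s)); last first.
  by rewrite -!catA.
rewrite [X in tcong X _](_ : _ =
  [:: (b *: p, y)] ++ (([:: (c *: p, y)] ++ tmap b s) ++ tmap c s)); last first.
  by rewrite -!catA.
apply: tc_cat; first exact: tc_refl.
apply: tc_cat; last exact: tc_refl.
exact: tc_catC.
Qed.

Fact tscale0 x : tscale 0 x = tclass [::].
Proof.
elim/tclass_ind: x => s; rewrite -tclass_map; apply/tclassP.
elim: s => [|[p y] s IHs] /=; first exact: tc_refl.
rewrite scale0r -cat1s -[X in tcong _ X]cat0s; apply: tc_cat => //; exact: tc_0l.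
Qed.

Fact tscale1 x : tscale 1 x = x.
Proof.
elim/tclass_ind: x => s; rewrite -tclass_map; congr tclass.
by elim: s => [|[p y] s /= ->] //=; rewrite scale1r.
Qed.

Fact taddN : left_inverse (tclass [::]) (tscale (-1)) tadd.
Proof. by move=> x; rewrite -{2}[x]tscale1 -tscaleDl addNr tscale0. Qed.

HB.instance Definition _ := GRing.isZmodule.Build T taddA taddC tadd0 taddN.

Fact tscaleA b c x : tscale b (tscale c x) = tscale (b * c) x.
Proof.
elim/tclass_ind: x => s; rewrite -!tclass_map; congr tclass.
by rewrite /tmap -map_comp; apply: eq_map => u /=; rewrite scalerA.
Qed.

Fact tscaleDr : right_distributive tscale +%R.
Proof.
move=> b; elim/tclass_ind => s; elim/tclass_ind => t.
by rewrite -[_ + _]tclass_cat -!tclass_map /tmap map_cat tclass_cat.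
Qed.

HB.instance Definition _ := GRing.Zmodule_isLmodule.Build B T
  tscaleA tscale1 tscaleDr tscaleDl.

End Tensor.

Section Multiplicity.
Variable A : pzRingType.

Definition submodule (M : lmodType A) (S : M -> Prop) : Prop :=
  [/\ S 0, (forall x y, S x -> S y -> S (x + y)) &
      (forall (a : A) x, S x -> S (a *: x))].

Definition simple_module (L : lmodType A) : Prop :=
  (exists x : L, x != 0) /\
  forall S : L -> Prop, submodule S ->
    (forall x, S x -> x = 0) \/ (forall x, S x).

Definition quotient_of (M L : lmodType A) : Prop :=
  exists f : {linear M -> L}, forall y, exists x, f x = y.

(* S is a maximal submodule of T, i.e. T / S is simple *)
Definition maximal_in (M : lmodType A) (S T : M -> Prop) : Prop :=
  [/\ (forall x, S x -> T x), (exists2 x, T x & ~ S x) &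
      forall S' : M -> Prop, submodule S' ->
        (forall x, S x -> S' x) -> (forall x, S' x -> T x) ->
        (forall x, S' x -> S x) \/ (forall x, T x -> S' x)].

(* T / S is isomorphic to L: a surjective homomorphism T -> L with kernel S *)
Definition subquotient_iso (M : lmodType A) (S T : M -> Prop)
    (L : lmodType A) : Prop :=
  exists f : M -> L,
    [/\ (forall x y, T x -> T y -> f (x + y) = f x + f y),
        (forall (a : A) x, T x -> f (a *: x) = a *: f x),
        (forall y, exists2 x, T x & f x = y) &
        (forall x, T x -> (f x = 0 <-> S x))].

Definition composition_series (M : lmodType A) (r : nat)
    (F : nat -> M -> Prop) : Prop :=
  [/\ (forall i, (i <= r)%N -> submodule (F i)),
      (forall x, F 0%N x <-> x = 0),
      (forall x, F r x) &
      (forall i, (i < r)%N -> maximal_in (F i) (F i.+1))].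

Definition factor_count (M : lmodType A) (r : nat) (F : nat -> M -> Prop)
    (L : lmodType A) : nat :=
  #|[pred i : 'I_r | `[< subquotient_iso (F i) (F i.+1) L >]]|.

(* [M : L] = c, as counted in some composition series of M; by Jordan-Hoelder
   the count does not depend on the series. *)
Definition has_multiplicity (M L : lmodType A) (c : nat) : Prop :=
  exists (r : nat) (F : nat -> M -> Prop),
    composition_series r F /\ factor_count r F L = c.

End Multiplicity.

Section Blob.
Variables (k : fieldType) (q : k) (m : int).

Definition qint (r : int) : k := (q ^ r - q ^ (- r)) / (q - q^-1).

Inductive blob_rel (n : nat) : term k 'I_n -> term k 'I_n -> Prop :=
| br_adj (i j : 'I_n) :
    (0 < i)%N -> (0 < j)%N -> (j == i.+1 :> nat) || (i == j.+1 :> nat) ->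
    blob_rel (TMul (TMul (TGen i) (TGen j)) (TGen i)) (TGen i)
| br_sqr (i : 'I_n) : (0 < i)%N ->
    blob_rel (TMul (TGen i) (TGen i)) (TMul (TConst (- qint 2)) (TGen i))
| br_sqr0 (i : 'I_n) : i = 0%N :> nat ->
    blob_rel (TMul (TGen i) (TGen i)) (TMul (TConst (- qint m)) (TGen i))
| br_101 (i j : 'I_n) : i = 0%N :> nat -> j = 1%N :> nat ->
    blob_rel (TMul (TMul (TGen j) (TGen i)) (TGen j))
             (TMul (TConst (qint (m - 1))) (TGen j))
| br_comm (i j : 'I_n) : (i.+2 <= j)%N || (j.+2 <= i)%N ->
    blob_rel (TMul (TGen i) (TGen j)) (TMul (TGen j) (TGen i)).

Definition blob (n : nat) : Type := presented (@blob_rel n).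

HB.instance Definition _ (n : nat) := GRing.PzRing.on (blob n).

Definition bconst (n : nat) (a : k) : blob n := pconst (@blob_rel n) a.
Definition bgen (n : nat) (i : 'I_n) : blob n := pgen (@blob_rel n) i.

(* the one-dimensional module on which U_0 acts as c and the other U_i as 0 *)
Section OneDim.
Variables (n : nat) (c : k).
Hypothesis hc : c * c = - qint m * c.

Definition onedim_op (i : 'I_n) : {linear k^o -> k^o} :=
  *:%R (if i == 0%N :> nat then c else 0).

Fact onedim_rel s t : blob_rel s t ->
  forall w, teval onedim_op s w = teval onedim_op t w.
Proof.
case=> {s t} /= [i j i0 j0 _|i i0|i i0|i j i0 j1|i j ij] w; rewrite !scalerA.
- by rewrite gtn_eqF // !mul0r.
- by rewrite gtn_eqF // !(mul0r, mulr0).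
- by rewrite i0 /= hc.
- by rewrite j1 /= !(mul0r, mulr0).
- by rewrite mulrC.
Qed.

Definition onedim_rep : representation (@blob_rel n) :=
  Representation onedim_rel.

End OneDim.

Fact hc_zero : 0 * 0 = - qint m * 0.
Proof. by rewrite !mulr0. Qed.

Fact hc_m : (- qint m) * (- qint m) = - qint m * (- qint m).
Proof. by []. Qed.

(* the idempotent e = - U_{n-1} / [2] of b_n, for n = p + 2 *)
Definition idem (p : nat) : blob p.+2 :=
  bconst p.+2 (- (qint 2)^-1) * bgen (@ord_max p.+1).

(* The isomorphism b_p -> e b_{p+2} e, U_i |-> e U_i e, evaluated on expressions;
   scalars go to multiples of e, the unit of the corner algebra. *)
Fixpoint corner (p : nat) (t : term k 'I_p) : blob p.+2 :=
  match t with
  | TConst a => bconst p.+2 a * idem p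
  | TGen i => idem p * bgen (widen_ord (leq_addl 2 p) i) * idem p
  | TAdd s t => corner s + corner t
  | TMul s t => corner s * corner t
  end.

Section G.
Variables (p : nat) (N : lmodType (blob p)).
Local Notation P := (lideal_mod (idem p)).

(* (x a) (x) y = x (x) (a y) for all a in b_p, acting on the right of b_{p+2} e
   through e b_{p+2} e *)
Definition corner_bal (u v : P * N) : Prop :=
  exists t : term k 'I_p,
    lideal_val u.1 = (lideal_val v.1 : blob p.+2) * corner t /\
    v.2 = (pclass (@blob_rel p) t : blob p) *: u.2.

Fact corner_bal_scale (b : blob p.+2) u v :
  corner_bal u v -> corner_bal (b *: u.1, u.2) (b *: v.1, v.2).
Proof.
move=> [t [e1 e2]]; exists t; split=> //=.
change (b * (lideal_val u.1 : blob p.+2) =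
        b * (lideal_val v.1 : blob p.+2) * corner t).
by rewrite e1 mulrA.
Qed.

(* b_{p+2} e (x)_{e b_{p+2} e} N *)
Definition Gfun : lmodType (blob p.+2) := tensor corner_bal_scale.

End G.

Definition onedim_plus (n : nat) : lmodType (blob n) :=
  repmod (onedim_rep n hc_zero).

Definition onedim_minus (n : nat) : lmodType (blob n) :=
  repmod (onedim_rep n hc_m).

Definition Delta2_0 : lmodType (blob 2) :=
  lideal_mod (bgen (Ordinal (isT : (1 < 2)%N))).

Definition Delta_step (p : nat) :
    lmodType (blob p) -> lmodType (blob p.+2) :=
  match p with
  | 0 => fun _ => Delta2_0
  | p'.+1 => fun N => Gfun N
  end.

(* The values for lam outside Lambda_n, and for n = 0, are irrelevant. *)
Fixpoint Delta (n : nat) (lam : int) {struct n} : lmodType (blob n) :=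
  if lam == n%:Z then onedim_plus n
  else if lam == - n%:Z then onedim_minus n
  else match n return lmodType (blob n) with
       | 0 => onedim_plus 0
       | 1 => onedim_plus 1
       | p.+2 => Delta_step (Delta p lam)
       end.

End Blob.

(** The basis of the n-th tensor power of V is indexed by [n.-tuple bool], where
    [false] stands for v_1 and [true] for v_2. Tensor factors are numbered from
    0: [Rop i] and [Sop i] act on the factors [i] and [i.+1], i.e. they are
    T_{i+2} and S_{i+2} in the numbering of factors from 1. *)

Fixpoint swap (i : nat) (s : seq bool) : seq bool :=
  match i, s with
  | 0%N, a :: b :: s' => b :: a :: s'
  | j.+1, a :: s' => a :: swap j s'
  | _, _ => s
  end.

Lemma size_swap i s : size (swap i s) = size s.
Proof. by elim: i s => [|i IH] [|a [|b s]] //=; rewrite IH. Qed.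

Lemma swapK i : involutive (swap i).
Proof. by elim: i => [|i IH] [|a [|b s]] //=; rewrite ?IH //; case: i IH. Qed.

Lemma nth_swapl i s : (i.+1 < size s)%N -> nth false (swap i s) i = nth false s i.+1.
Proof. by elim: i s => [|i IH] [|a [|b s]] //= h; rewrite IH. Qed.

Lemma nth_swapr i s : (i.+1 < size s)%N -> nth false (swap i s) i.+1 = nth false s i.
Proof. by elim: i s => [|i IH] [|a [|b s]] //= h; rewrite IH. Qed.

Lemma count_swap a i s : count a (swap i s) = count a s.
Proof.
elim: i s => [|i IH] [|x [|y s]] //=; first by rewrite !addnA [(a y + _)%N]addnC.
all: by rewrite IH.
Qed.

Fact tswap_subproof n i (s : n.-tuple bool) : size (swap i s) == n.
Proof. by rewrite size_swap size_tuple. Qed.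
Definition tswap n i (s : n.-tuple bool) : n.-tuple bool :=
  Tuple (tswap_subproof i s).

Section TensorSpace.
Variables (k : fieldType) (q : k) (m : int).

Definition lambda1 : k := q ^ m / (q - q^-1).
Definition lambda2 : k := q ^ (- m) / (q - q^-1).

Definition tens (n : nat) := {ffun n.-tuple bool -> k^o}.

Section Operators.
Variable n : nat.
Local Notation V := (tens n).

Definition bvec (s : n.-tuple bool) : V := [ffun t => (t == s)%:R].

Definition basis_map (f : n.-tuple bool -> V) : 'End(V) :=
  linfun (fun x : V => \sum_s (x s : k) *: f s).

Definition Rop (i : nat) : 'End(V) := basis_map (fun s =>
  match nth false s i, nth false s i.+1 with
  | true, false => bvec (tswap i s)
  | false, true => bvec (tswap i s) + (q - q^-1) *: bvec s
  | _, _ => q *: bvec s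
  end).

Definition Sop (i : nat) : 'End(V) := basis_map (fun s =>
  if nth false s i == nth false s i.+1 then q *: bvec s
  else bvec (tswap i s)).

Definition varpi : 'End(V) := basis_map (fun s =>
  (if nth false s 0 then lambda2 else lambda1) *: bvec s).

Definition theta : 'End(V) :=
  \big[@comp_lfun _ V V V / \1%VF]_(i <- rev (iota 0 n.-1)) Sop i.

Definition T1 : 'End(V) :=
  ((\big[@comp_lfun _ V V V / \1%VF]_(i <- iota 0 n.-1) (Rop i)^-1) \o theta \o varpi)%VF.

(* U_i = T_{i+1} - q acts on the factors i-1 and i. *)
Definition Uop (i : 'I_n) : 'End(V) :=
  if i == 0%N :> nat then T1 - lambda1 *: \1%VF
  else Rop i.-1 - q *: \1%VF.

End Operators.
End TensorSpace.

(** The functions below are the operators in coordinates, with coefficient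
    families extended by 0 to bit strings of any length; they serve to check the
    blob relations on tensor space. *)

Section Coef.
Variables (k : fieldType) (q : k) (m : int).
Hypotheses (q0 : q != 0) (qq : q - q^-1 != 0).
Local Notation a := (q - q^-1).
Implicit Types g h : seq bool -> k.

Definition rf (i : nat) g (s : seq bool) : k :=
  match nth false s i, nth false s i.+1 with
  | true, false => g (swap i s)
  | false, true => g (swap i s) + a * g s
  | _, _ => q * g s
  end.

Definition sf (i : nat) g (s : seq bool) : k :=
  if nth false s i == nth false s i.+1 then q * g s else g (swap i s).

Definition rfi i g s := rf i g s - a * g s.

Definition uf i g s := rf i g s - q * g s.

Lemma rf_lin i c d g h s :
  rf i (fun l => c * g l + d * h l) s = c * rf i g s + d * rf i h s.
Proof. by rewrite /rf; case: nth; case: nth; ring. Qed.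

Lemma uf_lin i c d g h s :
  uf i (fun l => c * g l + d * h l) s = c * uf i g s + d * uf i h s.
Proof. by rewrite /uf rf_lin; ring. Qed.

Lemma rf_rfi i g s : (i.+1 < size s)%N -> rf i (rfi i g) s = g s.
Proof.
move=> hs; rewrite /rfi /rf swapK nth_swapl // nth_swapr //.
by case: nth; case: nth; field.
Qed.

Lemma rfi_rf i g s : (i.+1 < size s)%N -> rfi i (rf i g) s = g s.
Proof.
move=> hs; rewrite /rfi /rf swapK nth_swapl // nth_swapr //.
by case: nth; case: nth; field.
Qed.

Fixpoint yf h (s : seq bool) : k :=
  match s with
  | [::] => 0
  | b :: s' => (if b then 0 else h (true :: s')) +
               (if b then q^-1 else q) * yf (fun l => h (b :: l)) s'
  end.

Lemma yf_lin c d g h s :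
  yf (fun l => c * g l + d * h l) s = c * yf g s + d * yf h s.
Proof.
elim: s g h => [|b s IH] g h /=; first by ring.
by rewrite IH; case: b; ring.
Qed.

Lemma yfZ c g s : yf (fun l => c * g l) s = c * yf g s.
Proof.
rewrite -[RHS]addr0 -(mul0r (yf g s)) -yf_lin; congr yf.
by apply/funext => l; rewrite mul0r addr0.
Qed.

Lemma yfD g h s : yf (fun l => g l + h l) s = yf g s + yf h s.
Proof.
rewrite -[yf g s]mul1r -[yf h s]mul1r -yf_lin; congr yf.
by apply/funext => l; rewrite !mul1r.
Qed.

Lemma yfNZ c g s : yf (fun l => - (c * g l)) s = - (c * yf g s).
Proof. by rewrite -mulNr -yfZ; congr yf; apply/funext => l; rewrite mulNr. Qed.

Lemma yf_rf i h s : (i.+1 < size s)%N -> yf (rf i h) s = rf i (yf h) s.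
Proof.
elim: i s h => [|i IH] [|x [|y s]] //= h hs; last first.
  rewrite /rf /= -/(rf i _ _).
  have := IH (y :: s) (fun l => h (x :: l)) hs.
  rewrite /rf /=.
  case: x; case: (nth false (y :: s) i); case: (nth false s i) => /= ->; ring.
rewrite /rf /=; case: x; case: y => /=; rewrite ?yfZ ?yfD ?yfZ; field; done.
Qed.

Lemma yf_uf i h s : (i.+1 < size s)%N -> yf (uf i h) s = uf i (yf h) s.
Proof.
move=> hs; rewrite /uf -yf_rf // -[X in _ - X]yfZ -[- yf _ _]mulN1r -yfZ -yfD.
by congr yf; apply/funext => l; ring.
Qed.

(* R_j^-1 ... R_{j+l-1}^-1 S_{j+l-1} ... S_j *)
Fixpoint xf j l g : seq bool -> k :=
  if l is l'.+1 then rfi j (xf j.+1 l' (sf j g)) else g.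

Lemma xfS j l g b s : xf j.+1 l g (b :: s) = xf j l (fun t => g (b :: t)) s.
Proof.
elim: l j g b s => [|l IH] j g b s //=.
by rewrite /rfi /rf /= !IH.
Qed.

Lemma xf0 l g b s : (l <= size s)%N -> l = size s ->
  xf 0 l g (b :: s) =
  if b then g (true :: s) - a * yf (fun t => g (false :: t)) s
  else g (false :: s).
Proof.
move=> _ ->; elim: s g b => [|c s IH] g b /=.
  by case: b; rewrite ?mulr0 ?subr0.
rewrite /rfi /rf /= !xfS !IH /sf /=.
case: b; case: c => /=; rewrite ?yfZ; try (field; done).
Qed.

Local Notation l1 := (lambda1 q m).
Local Notation l2 := (lambda2 q m).

Definition vf g s := (if nth false s 0 then l2 else l1) * g s.

Definition u0f g (s : seq bool) : k :=
  match s with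
  | true :: s' => (l2 - l1) * g s - q ^ m * yf (fun t => g (false :: t)) s'
  | _ => 0
  end.

Lemma u0fE l g s : (0 < size s)%N -> l = (size s).-1 ->
  xf 0 l (vf g) s - l1 * g s = u0f g s.
Proof.
case: s => //= b s _ ->; rewrite xf0 // /vf /=.
case: b; last by rewrite subrr.
have E : a * l1 = q ^ m by rewrite mulrC divfK.
by rewrite yfZ mulrA E; ring.
Qed.

Lemma uf_sq i g s : (i.+1 < size s)%N ->
  uf i (uf i g) s = - qint q 2 * uf i g s.
Proof.
move=> hs; have -> : qint q 2 = q + q^-1.
  apply: (mulIf qq); rewrite /qint divfK //.
  rewrite (_ : 2%R = 2%:Z) // -invr_expz -exprnP expr2; field; exact: q0.
rewrite /uf /rf swapK nth_swapl // nth_swapr //.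
by case: nth; case: nth; field.
Qed.

Lemma uf_adj i g s : (i.+2 < size s)%N ->
  uf i (uf i.+1 (uf i g)) s = uf i g s.
Proof.
elim: i g s => [|i IH] g [|x [|y [|z s]]] //= hs; last first.
  exact: (IH (fun t => g (x :: t)) (y :: z :: s)).
by rewrite /uf /rf /=; case: x; case: y; case: z => /=; field.
Qed.

Lemma uf_adj' i g s : (i.+2 < size s)%N ->
  uf i.+1 (uf i (uf i.+1 g)) s = uf i.+1 g s.
Proof.
elim: i g s => [|i IH] g [|x [|y [|z s]]] //= hs; last first.
  exact: (IH (fun t => g (x :: t)) (y :: z :: s)).
by rewrite /uf /rf /=; case: x; case: y; case: z => /=; field.
Qed.

Lemma uf_comm i j g s : (i.+1 < j)%N -> (j.+1 < size s)%N ->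
  uf i (uf j g) s = uf j (uf i g) s.
Proof.
elim: i j g s => [|i IH] [|[|j]] g [|x [|y s]] //= ij hs; last first.
  exact: (IH j.+1 (fun t => g (x :: t)) (y :: s)).
rewrite /uf /rf /=.
by case: x; case: y => /=; case: nth; case: nth; ring.
Qed.

Lemma u0f_sq g s : u0f (u0f g) s = - qint q m * u0f g s.
Proof.
have -> : - qint q m = l2 - l1 by rewrite /qint /lambda1 /lambda2; ring.
case: s => [|[] s] /=; rewrite ?mulr0 //.
have -> : yf (fun=> 0) s = 0.
  by rewrite -[RHS](mul0r (yf (fun=> 0) s)) -yfZ; congr yf; apply/funext => l; rewrite mul0r.
by ring.
Qed.

Lemma u0f_uf i g s : (i.+2 < size s)%N -> u0f (uf i.+1 g) s = uf i.+1 (u0f g) s.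
Proof.
case: s => [|b s] //= hs.
have E h : uf i.+1 h (b :: s) = uf i (fun t => h (b :: t)) s by [].
rewrite !E; case: b E => E /=.
  have -> : (fun t => uf i.+1 g (false :: t)) = uf i (fun t => g (false :: t)) by [].
  rewrite yf_uf //.
  have -> : (fun t => (l2 - l1) * g (true :: t) -
      q ^ m * yf (fun t0 => g (false :: t0)) t) =
    (fun t => (l2 - l1) * g (true :: t) +
      (- q ^ m) * yf (fun t0 => g (false :: t0)) t).
    by apply/funext => t; rewrite mulNr.
  by rewrite uf_lin mulNr.
by rewrite /uf /rf; case: nth; case: nth; ring.
Qed.

Lemma uf_u0f g s : (1 < size s)%N ->
  uf 0 (u0f (uf 0 g)) s = qint q (m - 1) * uf 0 g s.
Proof.
have -> : qint q (m - 1) = l1 * q^-1 - l2 * q.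
  by rewrite /qint opprB [1 - m]addrC !expfzDr // expr1z exprN1 /lambda1 /lambda2; ring.
have E : q ^ m = l1 * a by rewrite divfK.
case: s => [|x [|y s]] // _.
rewrite /uf /rf /= {}E; move: l1 l2 => L1 L2.
case: x; case: y => /=; rewrite ?yfZ ?yfD ?yfZ ?yfNZ; by field.
Qed.
End Coef.

Section Bridge.
Variables (k : fieldType) (q : k) (m : int) (n : nat).
Hypotheses (q0 : q != 0) (qq : q - q^-1 != 0).
Local Notation V := (tens k n).
Implicit Types x : V.

Definition hat (x : V) (s : seq bool) : k :=
  if insub s is Some t then x (t : n.-tuple bool) else 0.

Lemma hatE x (s : n.-tuple bool) : hat x s = x s.
Proof. by rewrite /hat valK. Qed.

Lemma hat_out x (s : seq bool) : size s != n -> hat x s = 0.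
Proof. by move=> h; rewrite /hat insubN. Qed.

Lemma hat_ind (g h : seq bool -> k) :
  (forall s : n.-tuple bool, g s = h s) ->
  (forall s, size s != n -> g s = h s) -> g = h.
Proof.
move=> h1 h2; apply/funext => s; have [e|] := boolP (size s == n); last exact: h2.
exact: (h1 (Tuple e)).
Qed.

Lemma hat_inj x y : hat x = hat y -> x = y.
Proof. by move=> e; apply/ffunP => s; rewrite -!hatE e. Qed.

Fact basis_fun_linear (f : n.-tuple bool -> V) :
  linear (fun x : V => \sum_s (x s : k) *: f s).
Proof.
move=> a x y; rewrite scaler_sumr -big_split; apply: eq_bigr => s _ /=.
by rewrite !ffunE scalerDl scalerA.
Qed.

Lemma basis_mapE f x : basis_map f x = \sum_s (x s : k) *: f s.
Proof.
pose L := GRing.isLinear.Build _ _ _ _ _ (basis_fun_linear f).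
pose F : {linear V -> V} := HB.pack (fun x : V => \sum_s (x s : k) *: f s) L.
exact: (lfunE F x).
Qed.

Lemma sum_delta (F : n.-tuple bool -> k) t :
  \sum_s F s * (t == s)%:R = F t.
Proof.
rewrite (bigD1 t) //= eqxx mulr1 big1 ?addr0 // => s.
by rewrite eq_sym => /negbTE ->; rewrite mulr0.
Qed.

Lemma sum_delta_swap i (F : n.-tuple bool -> k) t :
  \sum_s F s * (t == tswap i s)%:R = F (tswap i t).
Proof.
rewrite -(sum_delta F); apply: eq_bigr => s _; congr (_ * _%:R).
have K : involutive (@tswap n i) by move=> u; apply: val_inj; exact: swapK.
by rewrite -(inj_eq (can_inj K)) K.
Qed.

Lemma hat_tswap x i (s : n.-tuple bool) : hat x (swap i s) = x (tswap i s).
Proof. by rewrite -hatE. Qed.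

Lemma basis_map_swapE i (c1 c2 : bool -> bool -> k) (f : n.-tuple bool -> V) x s :
  (i.+1 < n)%N ->
  (forall t, f t = c1 (nth false t i) (nth false t i.+1) *: bvec k t +
                   c2 (nth false t i) (nth false t i.+1) *: bvec k (tswap i t)) ->
  basis_map f x s =
    c1 (nth false s i) (nth false s i.+1) * x s +
    c2 (nth false s i.+1) (nth false s i) * x (tswap i s).
Proof.
move=> hi hf; rewrite basis_mapE sum_ffunE.
pose d1 (t : n.-tuple bool) := c1 (nth false t i) (nth false t i.+1).
pose d2 (t : n.-tuple bool) := c2 (nth false t i) (nth false t i.+1).
transitivity (\sum_t ((x t * d1 t) * (s == t)%:R +
                      (x t * d2 t) * (s == tswap i t)%:R)).
  by apply: eq_bigr => t _; rewrite hf !ffunE /GRing.scale /= mulrDr !mulrA.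
rewrite big_split /= (sum_delta (fun t => x t * d1 t)).
rewrite (sum_delta_swap i (fun t => x t * d2 t)) /d1 /d2 /=.
by rewrite nth_swapl ?nth_swapr ?size_tuple // ![x _ * _]mulrC.
Qed.

Lemma hat_R i x : (i.+1 < n)%N -> hat (Rop q n i x) = rf q i (hat x).
Proof.
move=> hi; apply: hat_ind => s; last first.
  by move=> hs; rewrite /rf !hat_out ?size_swap // !mulr0 addr0; case: nth; case: nth.
rewrite hatE (@basis_map_swapE i
  (fun b c => if b == c then q else if b then 0 else q - q^-1)
  (fun b c => if b == c then 0 else 1)) // => [|t].
  rewrite /rf hat_tswap hatE; case: nth; case: nth => /=; ring.
by case: nth; case: nth; rewrite /= ?scale0r ?scale1r ?addr0 ?add0r // addrC.
Qed.

Lemma hat_S i x : (i.+1 < n)%N -> hat (Sop q n i x) = sf q i (hat x).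
Proof.
move=> hi; apply: hat_ind => s; last first.
  by move=> hs; rewrite /sf !hat_out ?size_swap // !mulr0; case: eqP.
rewrite hatE (@basis_map_swapE i
  (fun b c => if b == c then q else 0)
  (fun b c => if b == c then 0 else 1)) // => [|t].
  rewrite /sf hat_tswap hatE; case: nth; case: nth => /=; ring.
by case: eqP => _; rewrite /= ?scale0r ?scale1r ?addr0 ?add0r.
Qed.

Lemma hat_varpi x : hat (varpi q m n x) = vf q m (hat x).
Proof.
apply: hat_ind => s; last by move=> hs; rewrite /vf !hat_out // mulr0.
rewrite /vf !hatE basis_mapE sum_ffunE.
rewrite -(sum_delta (fun s => (if nth false s 0 then lambda2 q m else lambda1 q m) * x s)).
apply: eq_bigr => t _; rewrite !ffunE /GRing.scale /= mulrCA mulrA; congr (_ * _).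
Qed.

Lemma hatD x y : hat (x + y) = fun s => hat x s + hat y s.
Proof.
apply: hat_ind => s; last by move=> hs; rewrite !hat_out // addr0.
by rewrite !hatE ffunE.
Qed.

Lemma hatN x : hat (- x) = fun s => - hat x s.
Proof.
apply: hat_ind => s; last by move=> hs; rewrite !hat_out // oppr0.
by rewrite !hatE ffunE.
Qed.

Lemma hatZ c x : hat (c *: x) = fun s => c * hat x s.
Proof.
apply: hat_ind => s; last by move=> hs; rewrite !hat_out // mulr0.
by rewrite !hatE ffunE.
Qed.

Lemma Rop_inv i : (i.+1 < n)%N ->
  ((Rop q n i)^-1)%VF = Rop q n i - (q - q^-1) *: \1%VF.
Proof.
move=> hi; set B := RHS.
have hB x : hat (B x) = rfi q i (hat x).
  rewrite /B add_lfunE opp_lfunE scale_lfunE id_lfunE hatD hatN hatZ hat_R //.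
have AB : (B \o Rop q n i)%VF = \1%VF.
  apply/lfunP => x; rewrite comp_lfunE id_lfunE; apply: hat_inj.
  rewrite hB hat_R //; apply: hat_ind => s; first by rewrite rfi_rf ?size_tuple.
  by move=> hs; rewrite -hat_R // -hB !hat_out.
have BA : (Rop q n i \o B)%VF = \1%VF.
  apply/lfunP => x; rewrite comp_lfunE id_lfunE; apply: hat_inj.
  rewrite hat_R // hB; apply: hat_ind => s; first by rewrite rf_rfi ?size_tuple.
  by move=> hs; rewrite -hB -hat_R // !hat_out.
have k0 : lker (Rop q n i) == 0%VS.
  apply/lker0P => x y e.
  by rewrite -[x]id_lfunE -[y]id_lfunE -AB !comp_lfunE e.
by rewrite -[LHS]comp_lfun1r -BA comp_lfunA (lker0_compVf k0) comp_lfun1l.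
Qed.

Lemma hat_Rinv i x : (i.+1 < n)%N ->
  hat ((Rop q n i)^-1%VF x) = rfi q i (hat x).
Proof.
move=> hi; rewrite Rop_inv // add_lfunE opp_lfunE scale_lfunE id_lfunE.
by rewrite hatD hatN hatZ hat_R.
Qed.

HB.instance Definition _ := Monoid.isLaw.Build 'End(V) \1%VF
  (@comp_lfun k V V V) (@comp_lfunA _ _ _ _ _) (@comp_lfun1l _ _ _)
  (@comp_lfun1r _ _ _).

Lemma hat_X j l x : (j + l < n)%N || (l == 0%N) ->
  hat (((\big[@comp_lfun _ V V V / \1%VF]_(i <- iota j l) (Rop q n i)^-1) \o
   \big[@comp_lfun _ V V V / \1%VF]_(i <- rev (iota j l)) Sop q n i)%VF x) =
  xf q j l (hat x).
Proof.
elim: l j x => [|l IH] j x /=.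
  by rewrite !big_nil comp_lfun1l id_lfunE.
rewrite orbF => h.
have hj : (j.+1 < n)%N by apply: leq_ltn_trans h; rewrite addnS ltnS leq_addr.
rewrite rev_cons -cats1 big_cat big_seq1 /= big_cons -!comp_lfunA.
rewrite comp_lfunE hat_Rinv // [in LHS]comp_lfunA comp_lfunE IH ?hat_S //.
by case: l IH h => [|l] _ h; rewrite ?orbT // addSnnS h.
Qed.

Lemma hat_U0 x : (0 < n)%N ->
  hat ((T1 q m n - lambda1 q m *: \1%VF) x) = u0f q m (hat x).
Proof.
move=> n0; rewrite add_lfunE opp_lfunE scale_lfunE id_lfunE hatD hatN hatZ.
rewrite /T1 comp_lfunE hat_X; last by rewrite add0n ltn_predL n0.
rewrite hat_varpi.
apply: hat_ind => s.
  by rewrite u0fE // size_tuple.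
move=> hs.
have -> : u0f q m (hat x) s = 0.
  case: s hs => [|[] s] //= hs.
  rewrite hat_out // mulr0 sub0r.
  have -> : yf q (fun t => hat x (false :: t)) s = 0; last by rewrite mulr0 oppr0.
  have : forall g : seq bool -> k, (forall t, size t = size s -> g t = 0) -> yf q g s = 0.
    elim: s {hs} => [|c s IH] g hg //=.
    rewrite IH ?mulr0 ?addr0; last by move=> t ht; rewrite hg //= ht.
    by case: c hg => hg //; rewrite hg.
  by apply=> t ht; rewrite hat_out //= ht.
by rewrite -hat_varpi -hat_X ?hat_out ?mulr0 ?subr0 //; rewrite add0n ltn_predL n0.
Qed.

Lemma hat_Ui i x : (i.+1 < n)%N ->
  hat ((Rop q n i - q *: \1%VF) x) = uf q i (hat x).
Proof.
move=> hi; rewrite add_lfunE opp_lfunE scale_lfunE id_lfunE hatD hatN hatZ.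
by rewrite hat_R.
Qed.

Lemma hat_U (i : 'I_n) x :
  hat (Uop q m i x) =
  if i == 0%N :> nat then u0f q m (hat x) else uf q i.-1 (hat x).
Proof.
rewrite /Uop; case: ifP => i0; first by rewrite hat_U0 // (leq_ltn_trans _ (ltn_ord i)).
by rewrite hat_Ui // prednK // lt0n i0.
Qed.

Fact tensor_rel s t : @blob_rel k q m n s t -> forall w : V,
  teval (fun i => Uop q m i) s w = teval (fun i => Uop q m i) t w.
Proof.
have hatP (x y : V) : (forall s : n.-tuple bool, hat x s = hat y s) -> x = y.
  by move=> e; apply: hat_inj; apply: hat_ind => // u hu; rewrite !hat_out.
case=> {s t} /= [i j i0 j0 ij|i i0|i i0|i j i0 j1|i j ij] w; apply: hatP => s;
  rewrite ?hatZ !hat_U.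
- rewrite !gtn_eqF //.
  have hi := ltn_ord i; have hj := ltn_ord j.
  case: i i0 hi ij => [[|i] ?] // _ /= hi; case: j j0 hj => [[|j] ?] //= _ hj.
  rewrite !eqSS => /orP[/eqP e|/eqP e]; subst.
    by rewrite uf_adj ?size_tuple.
  by rewrite uf_adj' ?size_tuple.
- rewrite !gtn_eqF // uf_sq ?size_tuple // prednK //; exact: ltn_ord.
- by rewrite i0 /= u0f_sq.
- rewrite i0 j1 /= uf_u0f // size_tuple; have := ltn_ord j; by rewrite j1.
- have hi := ltn_ord i; have hj := ltn_ord j.
  wlog {ij} ij : i j hi hj / (i.+2 <= j)%N => [hw|].
    by case/orP: ij => h; [exact: hw | rewrite [RHS]hw].
  rewrite [j == _ :> nat]gtn_eqF ?(leq_trans _ ij) //.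
  case: j ij hj => [[|[|j]] ?] //= ij hj.
  case: i ij hi => [[|i] ?] //= ij hi.
    by rewrite u0f_uf ?size_tuple.
  by rewrite uf_comm ?size_tuple.
Qed.


End Bridge.

Section WeightModules.
Variables (k : fieldType) (q : k) (m : int).
Hypotheses (q0 : q != 0) (q4 : q ^+ 4 != 1).

Fact q_neq_inv : q - q^-1 != 0.
Proof.
apply: contra q4; rewrite subr_eq0 => /eqP e.
have q2 : q ^+ 2 = 1 by rewrite expr2 {2}e mulfV.
by rewrite (exprM q 2 2) q2 expr1n.
Qed.

Variable n : nat.
Local Notation V := (tens k n).

Definition tensor_rep : representation (@blob_rel k q m n) :=
  Representation (tensor_rel q0 q_neq_inv).

Definition weight (s : n.-tuple bool) : int :=
  (count_mem false s)%:Z - (count_mem true s)%:Z.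

Variable lam : int.

Definition wspace : {vspace V} :=
  <<[seq bvec k s | s <- enum [pred s : n.-tuple bool | weight s == lam]]>>%VS.

Lemma wspaceP (x : V) :
  reflect (forall s, weight s != lam -> x s = 0) (x \in wspace).
Proof.
apply: (iffP idP) => [|h].
  move/(@coord_span _ _ _ (in_tuple _)) => -> s hs.
  rewrite sum_ffunE big1 // => i _; rewrite ffunE.
  have : (in_tuple [seq bvec k s | s <- enum [pred s : n.-tuple bool | weight s == lam]])`_i
     \in [seq bvec k s | s <- enum [pred s : n.-tuple bool | weight s == lam]].
    exact: mem_nth.
  case/mapP => t; rewrite mem_enum inE => ht ->.
  rewrite ffunE; case: eqP => [e|_]; last by rewrite scaler0.
  by rewrite e ht in hs.
have -> : x = \sum_s (x s : k) *: bvec k s.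
  apply/ffunP => t; rewrite sum_ffunE -[LHS](sum_delta x t).
  by apply: eq_bigr => s _; rewrite !ffunE.
apply: memv_suml => s _; have [e|hs] := boolP (weight s == lam); last first.
  by rewrite h // scale0r mem0v.
apply/memvZ/memv_span/mapP; exists s => //.
by rewrite mem_enum inE e.
Qed.

Definition wstable (A : 'End(V)) := forall x, x \in wspace -> A x \in wspace.

Lemma wstable_comp A B : wstable A -> wstable B -> wstable (A \o B)%VF.
Proof. by move=> hA hB x hx; rewrite comp_lfunE; exact/hA/hB. Qed.

Lemma wstable_big (I : eqType) (r : seq I) (F : I -> 'End(V)) :
  (forall i, i \in r -> wstable (F i)) ->
  wstable (\big[@comp_lfun _ V V V / \1%VF]_(i <- r) F i).
Proof.
elim: r => [|i r IH] h; first by rewrite big_nil => x; rewrite id_lfunE.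
rewrite big_cons; apply: wstable_comp; first exact/h/mem_head.
by apply: IH => j hj; apply: h; rewrite in_cons hj orbT.
Qed.

Lemma wstable_sub A c : wstable A -> wstable (A - c *: \1%VF).
Proof.
move=> hA x hx; rewrite add_lfunE opp_lfunE scale_lfunE id_lfunE.
by apply: memvB; [exact: hA | exact: memvZ].
Qed.

Lemma weight_tswap i (s : n.-tuple bool) : weight (tswap i s) = weight s.
Proof. by rewrite /weight /= !count_swap. Qed.

Lemma wstable_swap i (A : 'End(V)) :
  (forall (x : V) (s : n.-tuple bool), exists c d : k,
     A x s = c * x s + d * x (tswap i s)) -> wstable A.
Proof.
move=> h x /wspaceP hx; apply/wspaceP => s hs.
have [c [d ->]] := h x s.
by rewrite !hx ?weight_tswap // !mulr0 addr0.
Qed.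

Lemma wstable_R i : (i.+1 < n)%N -> wstable (Rop q n i).
Proof.
move=> hi; apply: (@wstable_swap i) => x s.
rewrite -[Rop q n i x s]hatE hat_R // /rf hat_tswap hatE; case: nth; case: nth.
- by exists q, 0; rewrite mul0r addr0.
- by exists 0, 1; rewrite mul0r mul1r add0r.
- by exists (q - q^-1), 1; rewrite mul1r addrC.
- by exists q, 0; rewrite mul0r addr0.
Qed.

Lemma wstable_S i : (i.+1 < n)%N -> wstable (Sop q n i).
Proof.
move=> hi; apply: (@wstable_swap i) => x s.
rewrite -[Sop q n i x s]hatE hat_S // /sf hat_tswap hatE; case: eqP => _.
- by exists q, 0; rewrite mul0r addr0.
- by exists 0, 1; rewrite mul0r mul1r add0r.
Qed.

Lemma wstable_varpi : wstable (varpi q m n).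
Proof.
apply: (@wstable_swap 0) => x s; rewrite -[varpi q m n x s]hatE hat_varpi /vf hatE.
by eexists; exists 0; rewrite mul0r addr0.
Qed.

Lemma wstable_T1 : (0 < n)%N -> wstable (T1 q m n).
Proof.
move=> n0.
have ltn_iota i : i \in iota 0 n.-1 -> (i.+1 < n)%N.
  by rewrite mem_iota add0n /= => h; rewrite -(prednK n0) ltnS.
apply: wstable_comp; last exact: wstable_varpi.
apply: wstable_comp; apply: wstable_big => i; rewrite ?mem_rev => /ltn_iota hi.
  by rewrite Rop_inv ?q_neq_inv //; apply/wstable_sub/wstable_R.
exact: wstable_S.
Qed.

Lemma wstable_U (i : 'I_n) : wstable (Uop q m i).
Proof.
rewrite /Uop; case: ifP => i0; apply: wstable_sub.
  exact/wstable_T1/(leq_ltn_trans _ (ltn_ord i)).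
by apply: wstable_R; rewrite prednK // lt0n i0.
Qed.

Definition wpred : {pred repmod tensor_rep} := fun x => (x : V) \in wspace.

Fact wpred_submod_closed : submod_closed wpred.
Proof.
split=> [|a x y hx hy]; first exact: mem0v.
apply: (@memvD _ _ wspace) => //.
have : forall (t : term k 'I_n) (w : V), w \in wspace ->
    teval (rep_op tensor_rep) t w \in wspace.
  elim=> [c|i|s IHs t IHt|s IHs t IHt] w hw /=.
  - exact: memvZ.
  - exact: wstable_U.
  - by apply: memvD; [exact: IHs | exact: IHt].
  - exact/IHs/IHt.
by apply; exact: hx.
Qed.

HB.instance Definition _ := GRing.isSubmodClosed.Build
  (presented (@blob_rel k q m n)) (repmod tensor_rep) wpred wpred_submod_closed.

Record weight_mod :=
  WeightMod { weight_val : repmod tensor_rep; _ : weight_val \in wpred }.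

HB.instance Definition _ := [isSub for weight_val].
HB.instance Definition _ := [Choice of weight_mod by <:].
HB.instance Definition _ := [SubChoice_isSubLmodule of weight_mod by <:].

Definition Mmod : lmodType (blob q m n) := weight_mod.

End WeightModules.

Definition Lambda (n : nat) : seq int :=
  [seq n%:Z - (2 * j)%:Z | j <- iota 0 n.+1].

(* L is L_n(mu), the unique simple quotient of Delta_n(mu) *)
Definition is_Lmod (k : fieldType) (q : k) (m : int) (n : nat) (mu : int)
    (L : lmodType (blob q m n)) : Prop :=
  simple_module L /\ quotient_of (Delta q m n mu) L.

(* Main.v *)
Require Import Defs.
From HB Require Import structures.
From mathcomp Require Import all_boot all_order all_algebra.
From mathcomp Require Import boolp ring zify.

Set Implicit Arguments.
Unset Strict Implicit.
Unset Printing Implicit Defensive.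

Import Order.TTheory GRing.Theory Num.Theory.
Local Open Scope ring_scope.

(** Why the multiplicities agree.  Write [n = 2 j + l] with [l = |lam|].

    The first ingredient is a deformation.  On the weight space of the tensor
    space with coefficients in [k['X]], the coefficient [q^m] in the formula for
    [U_0] may be replaced by [q^m - 'X]: all blob relations survive, except that
    [U_1 U_0 U_1] becomes [([m-1] + 'X) U_1] ([deformed_tower]).  Modulo ['X]
    this lattice [E] is [M_n(lam)] ([evM_reduction]).

    The second ingredient is the half-diagrams.  A module of type [Delta_n(lam)]
    is spanned by vectors obtained from one vector by successively inserting
    cups, decorated or not; these vectors are indexed by the same bit strings as
    the standard basis of the tensor space.  This is proved for any tower of
    modules linked by cup insertions ([cup_diag_vec], [U_diag_span]) and applies
    both to the standard modules ([std_span]) and to [E], where a cup is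
    [v_1 (x) v_2 - q v_2 (x) v_1].  Thus the [k['X]]-span [F] of the half-diagrams
    in [E] is stable under the generators, and it contains a nonzero multiple of
    every basis vector of [E] ([sat_unitv]): modulo the images of the cups, [E] is
    spanned by a single basis vector, and applying [U_0] to a suitable image of
    cups gives a multiple of that vector by a polynomial in ['X].  Its value at [0]
    is a quantum integer [[m-r]], possibly zero, but the polynomial is nonzero
    because [[m] <> 0] ([sat_sorted]).  So [F] is free on the half-diagrams, and
    [F / 'X F] is a module with the half-diagrams as basis ([half_diagram_tower]).

    The functor [G] has a universal property: a homomorphism out of [G N] is a
    map out of [N] that behaves like the insertion of a cup ([Gfun_universal]).
    This yields a homomorphism [Delta_n(lam) -> F / 'X F] which sends the spanning
    half-diagrams to a basis, hence an isomorphism ([std_half_diagram]).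

    Finally [E] and [F] are commensurable lattices with compatible operators, and
    as in the theorem of Brauer and Nesbitt their reductions modulo ['X] have the
    same composition factors ([reduction_multiplicity]): the two reductions carry
    filtrations whose layers are identified by multiplication by powers of ['X].
    Refining corresponding layers in the same way ([pull_chain]) gives composition
    series of [M_n(lam)] and [Delta_n(lam)] with the same factors, without
    recourse to the theorem of Jordan and Hoelder. *)
(** * Composition chains *)

Section Chains.
Variables (A : pzRingType) (L : lmodType A).

(** A composition series of the subquotient [T / S], as a list of steps from
    [S] up to [T], with the number of factors isomorphic to [L]. *)
Inductive chain (M : lmodType A) : (M -> Prop) -> (M -> Prop) -> nat -> Prop :=
| chain_nil S : submodule S -> chain S S 0
| chain_cons S S' T c : submodule S -> maximal_in S S' -> chain S' T c ->
    chain S T (`[< subquotient_iso S S' L >] + c)%N.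

Lemma chain_cat (M : lmodType A) (S T V : M -> Prop) c d :
  chain S T c -> chain T V d -> chain S V (c + d)%N.
Proof.
elim=> {S T c} // S S' T c subS maxS _ IH /IH h.
by rewrite -addnA; exact: chain_cons.
Qed.

Lemma factor_countE (M : lmodType A) r (F : nat -> M -> Prop) :
  factor_count r F L = (\sum_(i < r) `[< subquotient_iso (F i) (F i.+1) L >])%N.
Proof.
rewrite /factor_count -sum1_card big_mkcond; apply: eq_bigr => i _.
by rewrite inE /=; case: asboolP.
Qed.

Lemma chain_has_multiplicity (M : lmodType A) c :
  chain (fun x : M => x = 0) (fun=> True) c -> has_multiplicity M L c.
Proof.
move=> ch.
suff [r [F [[subF F0 Fr maxF] cF]]] : exists r (F : nat -> M -> Prop),
    [/\ forall i, (i <= r)%N -> submodule (F i), F 0%N = (fun x => x = 0),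
        F r = (fun=> True) & forall i, (i < r)%N -> maximal_in (F i) (F i.+1)]
    /\ factor_count r F L = c.
  by exists r, F; split=> //; split=> // [x|x]; rewrite ?F0 ?Fr.
elim: ch => {c} [S subS|S S' T c subS maxS _ [r [F [[subF F0 Fr maxF] cF]]]].
  by exists 0%N, (fun=> S); split; [|rewrite /factor_count eq_card0 // => -[]].
exists r.+1, (fun i => if i is i'.+1 then F i' else S); split.
  by split=> // [[|i] //|[|i]]; [exact: subF | rewrite F0 | exact: maxF].
by rewrite -cF !factor_countE big_ord_recl F0.
Qed.

(** A vector of [T1] is related to some vector of [T2], which is unique up to [S2];
    choosing one gives a map that is linear modulo [S2]. *)
Lemma subquotient_iso_along (X Y : lmodType A) (rho : X -> Y -> Prop)
    (S1 T1 : X -> Prop) (S2 T2 : Y -> Prop) :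
  rho 0 0 ->
  (forall x x' y y', rho x y -> rho x' y' -> rho (x + x') (y + y')) ->
  (forall a x y, rho x y -> rho (a *: x) (a *: y)) ->
  submodule S1 -> submodule T1 -> submodule T2 ->
  (forall x, T1 x -> exists2 y, T2 y & rho x y) ->
  (forall y, T2 y -> exists2 x, T1 x & rho x y) ->
  (forall x y, rho x y -> T1 x -> T2 y -> (S1 x <-> S2 y)) ->
  subquotient_iso S2 T2 L -> subquotient_iso S1 T1 L.
Proof.
move=> r0 rD rZ [S10 _ _] [T10 T1D T1Z] [T20 T2D T2Z] T12 T21 S12 [f [fD fZ fs fk]].
have [g gP] : exists g : X -> Y, forall x, T1 x -> T2 (g x) /\ rho x (g x).
  have [|g gP] := choice (P := fun x y => T1 x -> T2 y /\ rho x y); last by exists g.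
  move=> x; have [T1x|nT] := pselect (T1 x); last by exists 0.
  by have [y] := T12 _ T1x; exists y.
have T2N y : T2 y -> T2 (- y) by rewrite -scaleN1r; exact: T2Z.
have fN y : T2 y -> f (- y) = - f y by move=> Ty; rewrite -!scaleN1r fZ.
have gE x y : T1 x -> T2 y -> rho x y -> f (g x) = f y.
  move=> T1x T2y xy; have [T2g xg] := gP _ T1x.
  have Td : T2 (g x - y) by apply: T2D => //; exact: T2N.
  apply/eqP; rewrite -subr_eq0 -fN // -fD //; last exact: T2N.
  apply/eqP/(fk _ Td); apply: (iffLR (S12 0 _ _ T10 Td)) => //.
  rewrite -(subrr x); apply: rD => //.
  by rewrite -(scaleN1r x) -(scaleN1r y); exact: rZ.
exists (f \o g); split=> /= [x x' Tx Tx'|a x Tx|l|x Tx].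
- have [[? ?] [? ?]] := (gP _ Tx, gP _ Tx').
  by rewrite -fD //; apply: gE; [exact: T1D | exact: T2D | exact: rD].
- by have [? ?] := gP _ Tx; rewrite -fZ //; apply: gE; [exact: T1Z | exact: T2Z | exact: rZ].
- have [y Ty <-] := fs l; have [x Tx xy] := T21 _ Ty.
  by exists x => //; exact: gE.
- have [Tg xg] := gP _ Tx; rewrite fk //.
  by split=> h; [exact/(S12 _ _ xg) | exact/(S12 _ _ xg)].
Qed.

Section Transport.
Variables (X Y : lmodType A) (rho : X -> Y -> Prop).
Hypothesis rho0 : rho 0 0.
Hypothesis rhoD : forall x x' y y', rho x y -> rho x' y' -> rho (x + x') (y + y').
Hypothesis rhoZ : forall a x y, rho x y -> rho (a *: x) (a *: y).

Let rhoB x x' y y' : rho x y -> rho x' y' -> rho (x - x') (y - y').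
Proof. by move=> h h'; apply: rhoD => //; rewrite -!scaleN1r; exact: rhoZ. Qed.

Definition pull (S : Y -> Prop) (x : X) : Prop := exists2 y, S y & rho x y.

Lemma pull_submodule S : submodule S -> submodule (pull S).
Proof.
move=> [S0 SD SZ]; split=> [|x x' [y Sy xy] [y' Sy' xy']|a x [y Sy xy]].
- by exists 0.
- by exists (y + y'); [exact: SD | exact: rhoD].
- by exists (a *: y); [exact: SZ | exact: rhoZ].
Qed.

Variables (B' B : Y -> Prop).
Hypothesis rho_sur : forall y, B y -> exists x, rho x y.
Hypothesis rho_ker : forall y, rho 0 y -> B' y.

Lemma pullE S x y : submodule S -> (forall z, B' z -> S z) ->
  rho x y -> (pull S x <-> S y).
Proof.
move=> [_ SD _] B'S xy; split=> [[y' Sy' xy']|Sy]; last by exists y.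
rewrite -(subrK y' y); apply: SD => //; apply/B'S/rho_ker.
by rewrite -(subrr x); exact: rhoB.
Qed.

Definition push (P : X -> Prop) (y : Y) : Prop := exists2 x, P x & rho x y.

Lemma push_submodule P : submodule P -> submodule (push P).
Proof.
move=> [S0 SD SZ]; split=> [|x x' [y Sy xy] [y' Sy' xy']|a x [y Sy xy]].
- by exists 0.
- by exists (y + y'); [exact: SD | exact: rhoD].
- by exists (a *: y); [exact: SZ | exact: rhoZ].
Qed.

Lemma pull_maximal S T : submodule S -> submodule T ->
  (forall z, B' z -> S z) -> (forall z, T z -> B z) ->
  maximal_in S T -> maximal_in (pull S) (pull T).
Proof.
move=> subS subT B'S TB [ST [y Ty nSy] maxS]; split.
- by move=> x [z Sz xz]; exists z => //; exact: ST.
- have [x xy] := rho_sur (TB _ Ty); exists x; first by exists y.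
  by move/(pullE subS B'S xy).
move=> P subP SP PT.
have [|z Sz|z [x Px xz]|h|h] := maxS (push P).
- exact: push_submodule.
- have [x xz] := rho_sur (TB _ (ST _ Sz)).
  by exists x => //; apply: SP; exists z.
- by apply/(pullE subT _ xz)/PT => // w /B'S/ST.
- left=> x Px; have [z Tz xz] := PT _ Px; exists z => //; apply: h.
  by exists x.
- right=> x [z /h[x' Px' x'z] xz].
  have [_ PD _] := subP; rewrite -(subrK x' x); apply: PD => //; apply: SP.
  exists 0; first by case: subS.
  by rewrite -(subrr z); exact: rhoB.
Qed.

Lemma pull_iso S T : submodule S -> submodule T ->
  (forall z, B' z -> S z) -> (forall z, T z -> B z) -> (forall z, S z -> T z) ->
  subquotient_iso S T L <-> subquotient_iso (pull S) (pull T) L.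
Proof.
move=> subS subT B'S TB ST; have B'T z : B' z -> T z by move/B'S/ST.
have subPS := pull_submodule subS; have subPT := pull_submodule subT.
have sur y : T y -> exists2 x, pull T x & rho x y.
  by move=> Ty; have [x xy] := rho_sur (TB _ Ty); exists x => //; exists y.
have memS x y : rho x y -> pull S x <-> S y by exact: pullE.
split.
  by apply: (subquotient_iso_along (rho := rho)) => // x y xy _ _; exact: memS.
apply: (subquotient_iso_along (rho := fun y x => rho x y)) => //.
- by move=> y y' x x'; exact: rhoD.
- by move=> a y x; exact: rhoZ.
- by move=> y x xy _ _; apply: iff_sym; exact: memS.
Qed.

(** The relation matches the submodules between [B'] and [B] with submodules of [X],
    and it preserves maximality and the isomorphism types of the factors. *)
Lemma pull_chain S T c : (forall z, B' z -> S z) -> (forall z, T z -> B z) ->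
  submodule T -> chain S T c -> chain (pull S) (pull T) c.
Proof.
move=> B'S TB subT ch; elim: ch B'S TB subT => {S T c}
  [S subS|S S' T c subS maxS ch IH] B'S TB subT.
  exact/chain_nil/pull_submodule.
have [SS' _ _] := maxS.
have [subS' S'T] : submodule S' /\ forall z, S' z -> T z.
  elim: ch => [? ?|? ? ? ? ? [h _ _] _ [_ h']]; split=> // z /h; exact: h'.
have S'B z : S' z -> B z by move/S'T/TB.
rewrite (asbool_equiv_eq (pull_iso subS subS' B'S S'B SS')).
apply: chain_cons; [exact: pull_submodule | exact: pull_maximal |].
by apply: IH => // z /B'S/SS'.
Qed.
End Transport.
End Chains.

(** A submodule of a representation on a finite-dimensional space is a subspace,
    so refining it terminates. *)
Section FiniteDim.
Variables (k : fieldType) (X : Type) (rel : term k X -> term k X -> Prop).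
Variables (V : vectType k) (op : X -> {linear V -> V}).
Hypothesis op_rel : forall s t, rel s t -> forall w, teval op s w = teval op t w.
Let M : lmodType (presented rel) := repmod (Representation op_rel).

Lemma submodule_vspace (S : M -> Prop) : submodule S ->
  exists U : {vspace V}, forall v : V, S v <-> v \in U.
Proof.
move=> [S0 SD SZ].
have SZk (a : k) (v : V) : S v -> S (a *: v).
  by move=> /(SZ (pconst rel a)); rewrite /GRing.scale /= repmod_scaleE.
pose P d := `[< exists2 U : {vspace V}, \dim U = d & forall v : V, v \in U -> S v >].
have exP : exists d, P d.
  exists 0%N; apply/asboolP; exists 0%VS; first exact: dimv0.
  by move=> v; rewrite memv0 => /eqP ->.
have leP d : P d -> (d <= \dim {:V})%N.
  by move=> /asboolP[U <- _]; apply: dimvS; exact: subvf.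
have [d /asboolP[U tens_U US] maxd] := ex_maxnP exP leP.
exists U => v; split=> [Sv|]; last exact: US.
apply/idPn => nUv; suff: (d.+1 <= d)%N by rewrite ltnn.
apply: maxd; apply/asboolP; exists (U + <[v]>)%VS.
  have v0 : v != 0 by apply: contraNneq nUv => ->; rewrite mem0v.
  rewrite dimv_disjoint_sum ?tens_U ?dim_vline ?v0 ?addn1 //.
  apply/eqP; rewrite -subv0; apply/subvP => w /memv_capP[half_U /vlineP[a aw]].
  rewrite memv0 aw; have [->|a0] := eqVneq a 0; first by rewrite scale0r.
  by case/negP: nUv; rewrite -[v](scalerK a0) memvZ // -aw.
move=> w /memv_addP[u uU [_ /vlineP[a ->] ->]].
by apply: SD; [exact: US | exact: SZk].
Qed.

Lemma chain_exists (L : lmodType (presented rel)) (S T : M -> Prop) :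
  submodule S -> submodule T -> (forall x, S x -> T x) -> exists c, chain L S T c.
Proof.
move=> subS subT ST.
have [U SU] := submodule_vspace subS; have [W TW] := submodule_vspace subT.
have [d] := ubnP (\dim W - \dim U)%N.
elim: d S U subS ST SU => // d IH S U subS ST SU ltd.
have UW : (U <= W)%VS by apply/subvP => v /SU/ST/TW.
have [TS|/existsNP[x /not_implyP[Tx nSx]]] := pselect (forall x, T x -> S x).
  suff -> : S = T by exists 0%N; exact: chain_nil.
  by apply/funext => x; apply/propext; split; [exact: ST | exact: TS].
pose P e := `[< exists (S' : M -> Prop) (U' : {vspace V}),
  [/\ submodule S' /\ (forall x, S x -> S' x), (exists2 x, S' x & ~ S x),
     forall x, S' x -> T x, (forall v : V, S' v <-> v \in U') & \dim U' = e] >].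
have exP : exists e, P e.
  by exists (\dim W); apply/asboolP; exists T, W; split=> //; exists x.
have [e /asboolP[S' [U' [[subS' SS'] neS' S'T SU' dU']]] mind] := ex_minnP exP.
have U'W : (U' <= W)%VS by apply/subvP => v /SU'/S'T/TW.
have UU' : (U <= U')%VS by apply/subvP => v /SU/SS'/SU'.
have ltU : (\dim U < \dim U')%N.
  rewrite ltn_neqAle (dimv_leqif_eq UU') dimvS // andbT.
  by apply/eqP => eU; have [y /SU' + []] := neS'; rewrite -eU => /SU.
have [c ch] : exists c, chain L S' T c.
  apply: (IH S' U') => //; rewrite -ltnS; apply: leq_trans ltd.
  by rewrite ltnS; apply: ltn_sub2l => //; apply: leq_trans ltU _; exact: dimvS.
exists (`[< subquotient_iso S S' L >] + c)%N; apply: chain_cons => //.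
split=> // S1 subS1 SS1 S1S'; have [|/existsNP[y /not_implyP[S1y nSy]]] :=
  pselect (forall x, S1 x -> S x); [by left | right].
have [U1 SU1] := submodule_vspace subS1.
have le1 : (\dim U' <= \dim U1)%N.
  rewrite dU'; apply: mind; apply/asboolP; exists S1, U1.
  by split=> //; [exists y | move=> z /S1S'/S'T].
have U1U' : (U1 <= U')%VS by apply/subvP => v /SU1/S1S'/SU'.
move=> z /SU' zU'; apply/SU1; suff /eqP -> : U1 == U' by [].
by rewrite eqEdim U1U'.
Qed.
End FiniteDim.
(** * Reductions of commensurable lattices *)

Section TermClosure.
Variables (k : fieldType) (J : Type) (rel : term k J -> term k J -> Prop).
Implicit Types M : lmodType (presented rel).

(** Every element of the algebra is the class of an expression, so closure
    properties can be checked on scalars and generators. *)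
Lemma presented_scale_closed M (S : M -> Prop) :
  (forall x y, S x -> S y -> S (x + y)) ->
  (forall a x, S x -> S (pconst rel a *: x)) ->
  (forall i x, S x -> S (pgen rel i *: x)) ->
  forall a x, S x -> S (a *: x).
Proof.
move=> SD Sc Sg; elim/pclass_ind; elim=> [a|i|s IHs t IHt|s IHs t IHt] x Sx.
- exact: Sc.
- exact: Sg.
- by rewrite pclassD scalerDl; apply: SD; [exact: IHs | exact: IHt].
- by rewrite pclassM -scalerA; apply/IHs/IHt.
Qed.

Lemma presented_rel_scale M (N : lmodType (presented rel)) (rho : M -> N -> Prop) :
  (forall x x' y y', rho x y -> rho x' y' -> rho (x + x') (y + y')) ->
  (forall a x y, rho x y -> rho (pconst rel a *: x) (pconst rel a *: y)) ->
  (forall i x y, rho x y -> rho (pgen rel i *: x) (pgen rel i *: y)) ->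
  forall a x y, rho x y -> rho (a *: x) (a *: y).
Proof.
move=> rD rc rg; elim/pclass_ind; elim=> [a|i|s IHs t IHt|s IHs t IHt] x y xy.
- exact: rc.
- exact: rg.
- by rewrite pclassD !scalerDl; apply: rD; [exact: IHs | exact: IHt].
- by rewrite pclassM -!scalerA; apply/IHs/IHt.
Qed.

End TermClosure.

Lemma Xn_scale_inj (k : fieldType) (E : lmodType {poly k}) n :
  (forall x : E, 'X *: x = 0 -> x = 0) ->
  forall w w' : E, 'X^n *: w = 'X^n *: w' -> w = w'.
Proof.
move=> tors w w'; elim: n => [|n IH]; first by rewrite !scale1r.
rewrite exprS -!scalerA => e; apply/IH/eqP; rewrite -subr_eq0.
by apply/eqP/tors; rewrite scalerBr e subrr.
Qed.

Section Lattices.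
Variables (k : fieldType) (J : Type) (rel : term k J -> term k J -> Prop).
Local Notation A := (presented rel).

(** [M] is the reduction modulo ['X] of the [k['X]]-module [E] with operators
    [u]. *)
Record reduction (E : lmodType {poly k}) (u : J -> E -> E) (M : lmodType A)
    (f : E -> M) : Prop := Reduction {
  redD : {morph f : x y / x + y};
  redC : forall a x, f (a%:P *: x) = pconst rel a *: f x;
  red_op : forall i x, f (u i x) = pgen rel i *: f x;
  red_sur : forall y, exists x, f x = y;
  red_ker : forall x, f x = 0 <-> exists y, x = 'X *: y }.

Variables (E F : lmodType {poly k}) (u : J -> E -> E) (c : J -> F -> F).
Variables (b : {linear F -> E}) (g : {linear E -> F}) (d : {poly k}).
Hypothesis torsE : forall x : E, 'X *: x = 0 -> x = 0.
Hypothesis torsF : forall x : F, 'X *: x = 0 -> x = 0.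
Hypotheses (bg : forall x, b (g x) = d *: x) (gb : forall x, g (b x) = d *: x).
Hypothesis d_neq0 : d != 0.
Hypothesis u_lin : forall i, linear (u i).
Hypothesis bc : forall i x, b (c i x) = u i (b x).
Variables (M N : lmodType A) (f : E -> M) (h : F -> N).
Hypotheses (redf : reduction u f) (redh : reduction c h).

(* [rho i] identifies the [i]-th layers of the two filtrations. *)
Let rho i (x : M) (y : N) : Prop :=
  exists v p, [/\ f v = x, h p = y & 'X^i *: v = b p].

Let uZ i a x : u i (a *: x) = a *: u i x.
Proof.
have u0 : u i 0 = 0.
  have := u_lin i 1 0 0; rewrite !scale1r addr0 => /(congr1 (+%R (- u i 0))).
  by rewrite addNr addrA addNr add0r.
by have := u_lin i a x 0; rewrite u0 !addr0.
Qed.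

Let f0 : f 0 = 0.
Proof. by apply/(red_ker redf); exists 0; rewrite scaler0. Qed.

Let h0 : h 0 = 0.
Proof. by apply/(red_ker redh); exists 0; rewrite scaler0. Qed.

Let fX x : f ('X *: x) = 0.
Proof. by apply/(red_ker redf); exists x. Qed.

Let hX x : h ('X *: x) = 0.
Proof. by apply/(red_ker redh); exists x. Qed.

Let fN x : f (- x) = - f x.
Proof. by apply/eqP; rewrite -addr_eq0 -(redD redf) addNr f0. Qed.

Let hN x : h (- x) = - h x.
Proof. by apply/eqP; rewrite -addr_eq0 -(redD redh) addNr h0. Qed.

Let hE v v' : h v = h v' -> exists w, v = v' + 'X *: w.
Proof.
move=> e; have /(red_ker redh)[w e'] : h (v - v') = 0.
  by rewrite (redD redh) hN e subrr.
by exists w; rewrite -e' addrC subrK.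
Qed.

Let rho0 i : rho i 0 0.
Proof. by exists 0, 0; split=> //; rewrite scaler0 linear0. Qed.

Let rhoD i x x' y y' : rho i x y -> rho i x' y' -> rho i (x + x') (y + y').
Proof.
move=> [v [p [<- <- e]]] [v' [p' [<- <- e']]]; exists (v + v'), (p + p').
by split; rewrite ?(redD redf) ?(redD redh) // scalerDr linearD e e'.
Qed.

Let rhoZ i a x y : rho i x y -> rho i (a *: x) (a *: y).
Proof.
apply: presented_rel_scale => {a x y} [x x' y y'|a x y|j x y]; first exact: rhoD.
  move=> [v [p [<- <- e]]]; exists (a%:P *: v), (a%:P *: p).
  by split; rewrite ?(redC redf) ?(redC redh) // [b _]linearZ /= -e !scalerA mulrC.
move=> [v [p [<- <- e]]]; exists (u j v), (c j p).
by split; rewrite ?(red_op redf) ?(red_op redh) // bc -e uZ.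
Qed.

Let Y i (y : N) : Prop := exists x, rho i x y.

Let Y_sub i : submodule (Y i).
Proof.
split=> [|y y' [x xy] [x' xy']|a y [x xy]].
- by exists 0.
- by exists (x + x'); exact: rhoD.
- by exists (a *: x); exact: rhoZ.
Qed.

Let YS i y : Y i.+1 y -> Y i y.
Proof.
move=> [x [v [p [_ <- e]]]]; exists (f ('X *: v)), ('X *: v), p.
by rewrite scalerA -exprSr.
Qed.

Let Xs i (x : M) : Prop := if i is j.+1 then exists y, rho j x y else x = 0.

Let pullYS i x : pull (rho i) (Y i.+1) x <-> Xs i x.
Proof.
split=> [[y [_ [v' [p' [_ hp' e']]]] [v [p [<- hp e]]]]|].
  have [w pE] : exists w, p = p' + 'X *: w by apply: hE; rewrite hp.
  have {}e : 'X^i *: (v - 'X *: v') = 'X *: b w.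
    by rewrite scalerBr e scalerA -exprSr e' pE linearD linearZ /= addrC addKr.
  have fv : f (v - 'X *: v') = f v by rewrite (redD redf) fN fX subr0.
  case: i e {e'} => [|i] e; first by rewrite -fv -[_ - _]scale1r e fX.
  exists (h w), (v - 'X *: v'), w; split=> //.
  by apply: (Xn_scale_inj (n := 1) torsE); rewrite expr1 scalerA -exprS.
case: i => [->|i [y [v [p [<- hp e]]]]].
  by exists 0; [case: (Y_sub 1) | exact: rho0].
exists 0; first by case: (Y_sub i.+2).
by exists v, ('X *: p); split=> //; rewrite linearZ /= -e scalerA -exprS.
Qed.

Let pullY i : pull (rho i) (Y i) = Xs i.+1.
Proof.
apply/funext => x; apply/propext.
by split=> [[y _ xy]|[y xy]]; [exists y | exists y => //; exists x].
Qed.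

Variable L : lmodType A.
Hypothesis chainN : forall S T : N -> Prop, submodule S -> submodule T ->
  (forall x, S x -> T x) -> exists r, chain L S T r.

(** Filter [M] by the vectors with a lift [v] such that ['X^i *: v] lies in the
    image of [F], and [N] by the vectors with a lift that [b] maps into
    ['X^i *: E]: the first filtration increases, the second one decreases, and
    multiplication by ['X^i] identifies their [i]-th layers. *)
Lemma reduction_multiplicity :
  exists r, has_multiplicity M L r /\ has_multiplicity N L r.
Proof.
have step i : exists r, chain L (Xs 0) (Xs i) r /\ chain L (Y i) (Y 0) r.
  elim: i => [|i [r [chX chY]]].
    exists 0%N; split; apply: chain_nil; last exact: Y_sub.
    by split=> //= [x y -> ->|a x ->]; rewrite ?addr0 ?scaler0.
  have [r' ch'] := chainN (Y_sub i.+1) (Y_sub i) (@YS i).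
  exists (r + r')%N; split; last by rewrite addnC; exact: chain_cat chY.
  rewrite -pullY.
  apply: chain_cat chX _.
  have -> : Xs i = pull (rho i) (Y i.+1).
    by apply/funext => x; apply/propext; exact: iff_sym (pullYS i x).
  have ker y : rho i 0 y -> Y i.+1 y.
    move=> [v [p [fv <- e]]]; have [v' vE] : exists v', v = 'X *: v'.
      by apply/(red_ker redf).
    by exists (f v'), v', p; rewrite exprSr -scalerA -vE.
  exact: (pull_chain (rho0 i) (@rhoD i) (@rhoZ i) (B := Y i) _ ker _ _ (Y_sub i) ch').
(* With [d = e * 'X^m] and [e] invertible modulo ['X], both filtrations are
   exhausted after [m + 1] steps. *)
have [m [e]] := multiplicity_XsubC d 0; rewrite d_neq0 /= subr0 => re de.
have e0 : e.[0] != 0 by [].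
have [e1 e1E] : exists e1, e = e.[0]%:P + 'X * e1.
  have /factor_theorem[e1 e1E] : root (e - e.[0]%:P) 0.
    by rewrite /root hornerD hornerN hornerC subrr.
  by exists e1; rewrite mulrC -['X]subr0 -e1E addrC subrK.
have [r [chX chY]] := step m.+1; exists r; split; apply: chain_has_multiplicity.
  suff -> : (fun=> True) = Xs m.+1 by [].
  apply/funext => x; apply/propext; split=> // _.
  have [v0 <-] := red_sur redf x; pose v := (e.[0]^-1)%:P *: v0.
  exists (h (g v)), (e *: v), (g v); split=> //.
    rewrite e1E scalerDl (redD redf) -[in X in _ + X]scalerA fX addr0.
    by rewrite scalerA -polyCM mulfV // scale1r.
  by rewrite bg de scalerA mulrC.
have <- : Y m.+1 = (fun y => y = 0).
  apply/funext => y; apply/propext; split=> [|->]; last by case: (Y_sub m.+1).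
  move=> [_ [v [p [_ <- e']]]].
  have {}e' : 'X *: g v = e *: p.
    apply: (Xn_scale_inj (n := m) torsF); rewrite scalerA -exprSr -linearZ /= e' gb de.
    by rewrite scalerA mulrC.
  have -> : p = (e.[0]^-1)%:P *: ('X *: (g v - e1 *: p)).
    have ec : e - 'X * e1 = e.[0]%:P by rewrite {1}e1E addrK.
    rewrite scalerBr e' scalerA -scalerBl ec scalerA -polyCM.
    by rewrite mulVf ?scale1r.
  by rewrite (redC redh) hX scaler0.
suff -> : (fun=> True) = Y 0 by [].
apply/funext => y; apply/propext; split=> // _.
have [p <-] := red_sur redh y.
by exists (f (b p)), (b p), p; rewrite scale1r.
Qed.

End Lattices.
(** * Bit strings and half-diagrams *)

(** The position (counted from 1) of the first factor [false, true] of a bit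
    string, and [0] if there is none. *)
Fixpoint pos (s : seq bool) : nat :=
  match s with
  | [::] => 0
  | x :: s' =>
    if ~~ x && head false s' then 1 else if pos s' is p.+1 then p.+2 else 0
  end.

Fixpoint cut (s : seq bool) : seq bool :=
  match s with
  | [::] => [::]
  | x :: s' => if ~~ x && head false s' then behead s' else x :: cut s'
  end.

(** Removes the first cup. Without a factor [false, true], the string is
    [true^a false^b]; it then encodes decorated cups at its left end, and removing
    one of them removes one letter of each kind. *)
Definition reduce (s : seq bool) : seq bool :=
  if pos s is 0 then take (size s - 2) (behead s) else cut s.

Lemma reduce_cut s : (0 < pos s)%N -> reduce s = cut s.
Proof. by rewrite /reduce; case: (pos s). Qed.

Definition ins i (s : seq bool) : seq bool :=
  take i s ++ [:: false; true] ++ drop i s.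

Lemma pos0P s : pos s = 0 -> exists a b, s = nseq a true ++ nseq b false.
Proof.
elim: s => [|x s IH] /=; first by exists 0, 0.
case: ifP => // xs; case E: (pos s) => //= _; have [a [b sE]] := IH E.
case: x xs => [_|]; first by exists a.+1, b; rewrite sE.
by rewrite sE; case: a {sE} => // _; exists 0, b.+1.
Qed.

Lemma pos_nseq a b : pos (nseq a true ++ nseq b false) = 0.
Proof.
elim: a => [|a /= -> //]; elim: b => [|b /= ->] //.
by case: b.
Qed.

Lemma pos_size s : (0 < pos s)%N -> (pos s < size s)%N.
Proof.
elim: s => //= x s IH; case: ifP => [|_]; first by case: s {IH} => [|y s]; rewrite ?andbF.
by case: (pos s) IH => // p IH _; rewrite ltnS IH.
Qed.

(** A new cup is either the first cup of the resulting string, or it lies to the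
    right of the first cup, which it does not affect. *)
Lemma ins_pos i s : (i <= size s)%N ->
  (pos (ins i s) = i.+1 /\ cut (ins i s) = s) \/
  [/\ (0 < pos s)%N, (pos s < i)%N, pos (ins i s) = pos s &
      cut (ins i s) = ins (i - 2) (cut s)].
Proof.
elim: i s => [|i IH] s; first by rewrite /ins take0 drop0; left.
case: s => [|x s] //; rewrite ltnS => le_is.
have {}IH := IH _ le_is.
have -> : ins i.+1 (x :: s) = x :: ins i s by [].
have hd : (0 < i)%N -> head false (ins i s) = head false s.
  by case: i le_is {IH} => // i; case: s.
have hd0 : i = 0 -> head false (ins i s) = false by move=> ->; rewrite /ins take0.
rewrite /=; case: ifP => [/andP[-> hs]|xs].
  have i0 : (0 < i)%N by rewrite lt0n; apply/eqP => /hd0; rewrite hs.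
  right; rewrite -hd // hs; split=> //.
  by case: i i0 le_is {IH hd hd0 hs} => // i _; case: s => //= y s _; rewrite subSS subn1.
case: IH => [[-> ->]|[p0 pi -> cE]]; first by left.
have i1 : (1 < i)%N by apply: leq_trans pi.
have -> : ~~ x && head false s = false by rewrite -hd ?xs // ltnW.
right; rewrite cE; case: (pos s) p0 pi => // p _ pi; split=> //.
by rewrite subSn.
Qed.

Lemma count_ins x i s : count_mem x (ins i s) = (count_mem x s).+1.
Proof.
rewrite /ins !count_cat /= -{3}(cat_take_drop i s) count_cat addnCA.
by case: x; rewrite /= !(add0n, addn0, add1n).
Qed.

Lemma count_cut x s : (0 < pos s)%N -> count_mem x s = (count_mem x (cut s)).+1.
Proof.
elim: s => //= y s IH; case: ifP => [/andP[/negbTE -> ]|_].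
  by case: s {IH} => //= -[] // s _ _; case: x; rewrite /= !(add0n, add1n).
by case: (pos s) IH => // p IH _; rewrite IH // addnS.
Qed.

(** Half-diagrams with [j] cups on top of [a] letters [true] and [b] letters
    [false]. *)
Definition word (a b j : nat) (s : seq bool) : bool :=
  (count_mem true s == a + j)%N && (count_mem false s == b + j)%N.

Lemma word_size a b j s : word a b j s -> size s = (a + b + j.*2)%N.
Proof.
move=> /andP[/eqP ct /eqP cf]; rewrite -(count_predC (pred1 true)) ct.
rewrite (eq_count (a2 := pred1 false)) ?cf; last by case.
by rewrite addnACA addnn.
Qed.

Lemma word_ins a b j i s : word a b j s -> word a b j.+1 (ins i s).
Proof. by move=> /andP[/eqP ct /eqP cf]; rewrite /word !count_ins ct cf !addnS !eqxx. Qed.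

Lemma pos0_word a b j s : word a b j s -> pos s = 0 ->
  s = nseq (a + j) true ++ nseq (b + j) false.
Proof.
move=> /andP[/eqP ct /eqP cf] /pos0P[c [d sE]].
move: ct cf; rewrite sE !count_cat !count_nseq /= !mul0n !mul1n addn0 add0n.
by move=> -> ->.
Qed.

Lemma reduce_nseq a b :
  reduce (nseq a.+1 true ++ nseq b.+1 false) = nseq a true ++ nseq b false.
Proof.
set s := LHS; have -> : s = take (size (nseq a.+1 true ++ nseq b.+1 false) - 2)
    (nseq a true ++ nseq b.+1 false) by rewrite /s /reduce pos_nseq.
rewrite size_cat !size_nseq addSn addnS subSS subSS subn0.
rewrite -[b.+1]addn1 nseqD catA take_size_cat //.
by rewrite size_cat !size_nseq.
Qed.

Lemma word_reduce a b j s : word a b j.+1 s -> word a b j (reduce s).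
Proof.
move=> ws; case E: (pos s) => [|p].
  rewrite (pos0_word ws E) !addnS reduce_nseq /word !count_cat !count_nseq /=.
  by rewrite !mul0n !mul1n addn0 add0n !eqxx.
have p0 : (0 < pos s)%N by rewrite E.
by move: ws; rewrite /word !(count_cut _ p0) /reduce E !addnS !eqSS.
Qed.

(** * Towers *)

Fixpoint lev (l j : nat) : nat := if j is j'.+1 then (lev l j').+2 else l.

Lemma levE l j : lev l j = (l + j.*2)%N.
Proof. by elim: j => [|j /= ->]; rewrite ?addn0 // doubleS !addnS. Qed.

Section TowerOps.
Variables (l : nat) (N : nat -> Type) (U : forall j, nat -> N j -> N j).
Variables (C : forall j, N j -> N j.+1) (v : N 0).

(** The insertion of a cup at the positions [i] and [i+1] (counted from 1), or of
    a decorated cup at the positions 1 and 2 if [i = 0]. *)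
Definition cup j i (y : N j) : N j.+1 :=
  foldr (@U j.+1) (C y) (iota i ((lev l j).+1 - i)).

(** The half-diagram of a bit string: factors [false, true] are cups, and what
    remains after their removal, a string [true^a false^b], stands for decorated
    cups followed by the through lines of [v]. *)
Fixpoint diag_vec (j : nat) (s : seq bool) : N j :=
  if j is j'.+1 then cup (pos s) (diag_vec j' (reduce s)) else v.

Lemma cup_top j (y : N j) : cup (lev l j).+1 y = C y.
Proof. by rewrite /cup subnn. Qed.

Lemma cupS j i (y : N j) : (i < (lev l j).+1)%N -> cup i y = U i (cup i.+1 y).
Proof. by move=> lt_i; rewrite /cup -subSS (subSn lt_i). Qed.

End TowerOps.

Lemma cup_morph l (N N' : nat -> Type) U U' C C' j
    (f : N j -> N' j) (f' : N j.+1 -> N' j.+1) (P : N j.+1 -> Prop) i y :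
  (forall i z, (i < lev l j.+1)%N -> P z -> P (U j.+1 i z)) ->
  (forall i z, (i < lev l j.+1)%N -> P z -> f' (U j.+1 i z) = U' j.+1 i (f' z)) ->
  P (C j y) -> f' (C j y) = C' j (f y) ->
  P (cup l U C i y) /\ f' (cup l U C i y) = cup l U' C' i (f y).
Proof.
move=> PU latt_U Py fy; rewrite /cup; set r := iota _ _.
have : all (fun i => (i < lev l j.+1)%N) r.
  apply/allP => i'; rewrite mem_iota => /andP[le_ii'].
  case: (leqP i (lev l j).+1) => [h|/ltnW]; first by rewrite subnKC // => /leqW.
  by rewrite -subn_eq0 => /eqP ->; rewrite addn0 ltnNge le_ii'.
elim: r => [|i' r IHr] /=; first by rewrite fy.
by move=> /andP[lti' /IHr[Pr <-]]; split; [exact: PU | exact: latt_U].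
Qed.

Lemma diag_vec_morph l (N N' : nat -> Type) U U' C C' v v'
    (f : forall j, N j -> N' j) (P : forall j, N j -> Prop) :
  (forall j i y, (i < lev l j)%N -> P j y -> P j (U j i y)) ->
  (forall j y, P j y -> P j.+1 (C j y)) ->
  (forall j i y, (i < lev l j)%N -> P j y -> f j (U j i y) = U' j i (f j y)) ->
  (forall j y, P j y -> f j.+1 (C j y) = C' j (f j y)) ->
  P 0%N v -> f 0%N v = v' ->
  forall j s, P j (diag_vec l U C v j s) /\
    f j (diag_vec l U C v j s) = diag_vec l U' C' v' j s.
Proof.
move=> PU PC latt_U latt_C Pv fv; elim=> [|j IH] s //=.
have [Py <-] := IH (reduce s).
by apply: cup_morph; [exact: PU | exact: latt_U | exact: PC | exact: latt_C].
Qed.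

Section Tower.
Variables (R : comNzRingType) (a b : nat).
Local Notation l := (a + b)%N.
Local Notation lev := (lev l).

(** Modules over the algebras with [lev j] generators, linked by the insertion [C]
    of a cup at the end; [dl], [al] and [be] are the values of the three kinds
    of loops. *)
Record tower (N : nat -> lmodType R) (U : forall j, nat -> N j -> N j)
    (C : forall j, N j -> N j.+1) (v : N 0) (dl al be : R) : Prop := Tower {
  tU_lin : forall j i, linear (U j i);
  tC_lin : forall j, linear (C j);
  tUU : forall j i y, (0 < i < lev j)%N -> U j i (U j i y) = dl *: U j i y;
  tU00 : forall j y, (0 < lev j)%N -> U j 0 (U j 0 y) = al *: U j 0 y;
  tUadj : forall j i y, (0 < i)%N -> (i.+1 < lev j)%N ->
    U j i (U j i.+1 (U j i y)) = U j i y;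
  tUadj' : forall j i y, (0 < i)%N -> (i.+1 < lev j)%N ->
    U j i.+1 (U j i (U j i.+1 y)) = U j i.+1 y;
  tU101 : forall j y, (1 < lev j)%N -> U j 1 (U j 0 (U j 1 y)) = be *: U j 1 y;
  tUcomm : forall j i i' y, (i.+2 <= i')%N -> (i' < lev j)%N ->
    U j i (U j i' y) = U j i' (U j i y);
  tUC : forall j y, U j.+1 (lev j).+1 (C j y) = dl *: C j y;
  tCU : forall j i y, (i < lev j)%N -> U j.+1 i (C j y) = C j (U j i y);
  tbase : forall i, (i < l)%N ->
    U 0 i v = (if (i == 0)%N && (0 < a)%N then al else 0) *: v }.

Variables (N : nat -> lmodType R) (U : forall j, nat -> N j -> N j).
Variables (C : forall j, N j -> N j.+1) (v : N 0) (dl al be dli : R).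
Hypothesis tw : tower U C v dl al be.
Hypothesis dlK : dli * dl = 1.
Hypothesis base_pos : forall s, word a b 0 s -> pos s = 0.
Local Notation cup := (cup l U C).
Local Notation diag_vec := (diag_vec l U C v).

Let UD j i (y y' : N j) : U i (y + y') = U i y + U i y'.
Proof. by have := tU_lin tw i 1 y y'; rewrite !scale1r. Qed.

Let U0 j i : U i (0 : N j) = 0.
Proof. by apply: (addrI (U i (0 : N j))); rewrite -UD !addr0. Qed.

Let UZ j i c (y : N j) : U i (c *: y) = c *: U i y.
Proof. by have := tU_lin tw i c y 0; rewrite U0 !addr0. Qed.

Lemma cup_lin j i : linear (@cup j i).
Proof.
move=> c y y'; rewrite /cup (tC_lin tw).
by elim: iota => //= i' r ->; rewrite UD UZ.
Qed.

Lemma cupZ j i c (y : N j) : cup i (c *: y) = c *: cup i y.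
Proof. exact: (scalable_linear (@cup_lin j i)). Qed.

Lemma cup_U_ge j i (y : N j) : (0 < i < (lev j).+2)%N ->
  U i (cup i y) = dl *: cup i y.
Proof.
case/andP=> i0; rewrite ltnS leq_eqVlt => /orP[/eqP ->|lt_i].
  by rewrite cup_top (tUC tw).
by rewrite cupS // (tUU tw) // i0 /= ltnW.
Qed.

(** As [dl] is invertible, [cup i.+1] may be replaced by a multiple of
    [U i.+1 (cup i.+1)], which makes room for the relation
    [U i.+1 (U i (U i.+1 x)) = U i.+1 x]. *)
Lemma cup_U_next j i (y : N j) : (0 < i)%N -> (i < (lev j).+1)%N ->
  U i.+1 (cup i y) = cup i.+1 y.
Proof.
move=> i0 lt_i; rewrite cupS // -[cup i.+1 y]scale1r -dlK -scalerA -cup_U_ge //.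
by rewrite !UZ (tUadj' tw) //.
Qed.

Lemma cup_U_1 j (y : N j) : U 1 (cup 0 y) = be *: cup 1 y.
Proof.
rewrite cupS // -[cup 1 y]scale1r -dlK -scalerA -cup_U_ge //.
by rewrite !UZ (tU101 tw) // !scalerA mulrC.
Qed.

Lemma cup_U_lt j i i' (y : N j) : (i.+2 <= i')%N -> (i' < (lev j).+2)%N ->
  U i (cup i' y) = cup i' (U i y).
Proof.
move=> lt_ii' lt_i'; have [d] := ubnP ((lev j).+1 - i')%N.
elim: d i' lt_ii' lt_i' => // d IH i' lt_ii' lt_i' lt_d.
move: (lt_i'); rewrite ltnS leq_eqVlt => /orP[/eqP e|lt1].
  by rewrite e !cup_top (tCU tw) // -ltnS -e -ltnS.
rewrite !(cupS _ _ _ lt1) (tUcomm tw) // IH //; first exact: leqW.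
by rewrite -ltnS; apply: leq_trans lt_d; rewrite ltnS ltn_sub2l.
Qed.

Lemma cup_U_2 j (y : N j) : (0 < lev j)%N -> U 2 (cup 0 y) = cup 2 (U 0 y).
Proof.
by move=> lt0; rewrite cupS // -(tUcomm tw) // cup_U_next // cup_U_lt.
Qed.

Lemma cup_U_gt j i i' (y : N j) : (0 < i')%N || (2 < i)%N ->
  (i'.+2 <= i)%N -> (i < (lev j).+2)%N ->
  U i (cup i' y) = cup i' (U (i - 2) y).
Proof.
move=> i'0 lt_i'i lt_i; have [d] := ubnP (i - i')%N.
elim: d i' i'0 lt_i'i => // d IH i' i'0 lt_i'i lt_d.
have lt_i' : (i' < (lev j).+1)%N by rewrite -ltnS; apply: leq_trans lt_i; exact: ltnW.
move: (lt_i'i); rewrite leq_eqVlt => /orP[/eqP e|lt3]; last first.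
  rewrite !(cupS _ _ _ lt_i') -(tUcomm tw) // IH //.
  by rewrite -ltnS; apply: leq_trans lt_d; rewrite ltnS ltn_sub2l // ltnW.
subst i; have {}i'0 : (0 < i')%N by case: (i') i'0.
rewrite !subSS subn0 !(cupS _ _ _ lt_i') -(tUcomm tw) // cup_U_next //.
by rewrite [in RHS]cupS // -cup_U_lt // (tUadj tw).
Qed.

(** Two cups side by side can be inserted in either order. As [cup i = U i (cup i.+1)]
    and [U i] commutes with distant cups, it suffices to treat adjacent cups. For
    [x = cup i.+2 (cup i y)] one has [U i x = dl *: x], hence
    [U i (U i.+1 x) = x], which is the claim. *)
Lemma cup_cup j i i' (y : N j) : (0 < i)%N -> (i.+2 <= i')%N -> (i' < (lev j).+4)%N ->
  cup i' (cup i y) = cup i (cup (i' - 2) y).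
Proof.
move=> i0 lt_ii' lt_i'; have [d] := ubnP (i' - i)%N.
elim: d i i0 lt_ii' => // d IH i i0 lt_ii' lt_d.
move: (lt_ii'); rewrite leq_eqVlt => /orP[/eqP e|lt3]; last first.
  have lt1 : (i < (lev j).+1)%N by do 3!rewrite -ltnS; exact: leq_trans lt_i'.
  have lt1' : (i < (lev j.+1).+1)%N 
    by apply: leq_trans lt1 _; rewrite /= !ltnS; do 2!apply: leqW.
  rewrite (cupS _ _ _ lt1) (cupS _ _ _ lt1') -cup_U_lt // IH //.
  by rewrite -ltnS; apply: leq_trans lt_d; rewrite ltnS ltn_sub2l // ltnW.
subst i'; rewrite !subSS subn0; set x := cup i.+2 (cup i y).
have lt_i : (i < (lev j).+2)%N by rewrite -2!ltnS.
have xE : U i x = dl *: x by rewrite cup_U_lt // cup_U_ge ?i0 // cupZ.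
have lt1 : (i.+1 < (lev j.+1).+1)%N by [].
rewrite [RHS]cupS ?(cupS _ _ _ lt1) -/x; last exact: ltnW.
rewrite -[in RHS](scale1r x) -dlK -scalerA -xE !UZ.
have -> : U i (U i.+1 (U i x)) = U i x by apply: (tUadj tw) => //=; exact: ltnW.
by rewrite xE scalerA dlK scale1r.
Qed.

Lemma cup_cup0 j i (y : N j) : (0 < i)%N -> (i < (lev j).+2)%N ->
  cup 0 (cup i y) = cup i.+2 (cup 0 y).
Proof.
move=> i0 lt_i; rewrite [cup 0 y]cupS // -cup_U_lt //.
by rewrite [cup i.+2 _]cup_cup // !subSS subn0 -cupS.
Qed.

Inductive diag_span j : N j -> Prop :=
| diag_span0 : diag_span 0
| diag_spanS c s y : word a b j s -> diag_span y -> diag_span (c *: diag_vec j s + y).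

Lemma diag_spanD j (x y : N j) : diag_span x -> diag_span y -> diag_span (x + y).
Proof.
elim=> [|c s z ws _ IH] dy; first by rewrite add0r.
by rewrite -addrA; apply: diag_spanS => //; exact: IH.
Qed.

Lemma diag_spanZ j c (x : N j) : diag_span x -> diag_span (c *: x).
Proof.
elim=> [|c' s z ws _ IH]; first by rewrite scaler0; exact: diag_span0.
by rewrite scalerDr scalerA; exact: diag_spanS.
Qed.

Lemma diag_span_diag_vec j s : word a b j s -> diag_span (diag_vec j s).
Proof.
by move=> ws; rewrite -[diag_vec j s]addr0 -[diag_vec j s]scale1r; apply/diag_spanS/diag_span0.
Qed.

Lemma diag_span_lin j j' (f : N j -> N j') : linear f ->
  (forall s, word a b j s -> diag_span (f (diag_vec j s))) ->
  forall x, diag_span x -> diag_span (f x).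
Proof.
move=> f_lin fd; have f0 : f 0 = 0.
  by have /= := scalable_linear f_lin 0 0; rewrite !scale0r.
move=> x; elim=> [|c s y ws _ IH]; first by rewrite f0; exact: diag_span0.
by rewrite f_lin; apply: diag_spanD => //; apply/diag_spanZ/fd.
Qed.

Let diag_vecS j s : diag_vec j.+1 s = cup (pos s) (diag_vec j (reduce s)).
Proof. by []. Qed.

(** Insertion of an undecorated cup does not depend on the order: a cup that is not
    the first one slides past the first one. *)
Lemma cup_diag_vec j i s : word a b j s -> (i < (lev j).+1)%N ->
  cup i.+1 (diag_vec j s) = diag_vec j.+1 (ins i s).
Proof.
elim: j i s => [|j IH] i s ws lt_i.
  have le_i : (i <= size s)%N by rewrite (word_size ws) addn0.
  case: (ins_pos le_i) => [[p _]|[]]; last by rewrite base_pos.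
  by rewrite /= p.
have le_i : (i <= size s)%N by rewrite (word_size ws) -levE.
case: (ins_pos le_i) => [[p c]|[p0 lt_pi p c]].
  by rewrite [RHS]diag_vecS reduce_cut ?p // c.
have -> : diag_vec j.+2 (ins i s) = cup (pos s) (diag_vec j.+1 (ins (i - 2) (cut s))).
  by rewrite [LHS]diag_vecS reduce_cut ?p // c.
have rE := reduce_cut p0.
have i2 : (1 < i)%N by apply: leq_trans lt_pi.
have ws' : word a b j (cut s) by rewrite -rE word_reduce.
rewrite -IH //; last first.
  by rewrite ltnS leq_subLR add2n -ltnS.
by rewrite [diag_vec j.+1 s]diag_vecS rE cup_cup // subSn // -subSn // subSS.
Qed.

(** A decorated cup slides past all undecorated cups, and then stands in front of a
    string [true^a false^b], where it is part of a half-diagram. *)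
Lemma cup_diag_span j i (x : N j) : (i < (lev j).+2)%N -> diag_span x -> diag_span (cup i x).
Proof.
have cup1 j' i' (y : N j') : (i' < (lev j').+1)%N -> diag_span y -> diag_span (cup i'.+1 y).
  move=> lt_i'; apply: diag_span_lin (@cup_lin _ _) _ _ => s ws.
  by rewrite cup_diag_vec //; apply/diag_span_diag_vec/word_ins.
case: i => [_|i]; last exact: cup1.
have cup00 j' s : word a b j' s -> pos s = 0 -> diag_span (cup 0 (diag_vec j' s)).
  move=> ws p0; pose t := nseq (a + j').+1 true ++ nseq (b + j').+1 false.
  have -> : cup 0 (diag_vec j' s) = diag_vec j'.+1 t.
    by rewrite diag_vecS pos_nseq reduce_nseq (pos0_word ws p0).
  apply: diag_span_diag_vec; rewrite /word !count_cat !count_nseq /=.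
  by rewrite !mul0n !mul1n addn0 !addnS !eqxx.
elim: j x => [|j IH] x; apply: diag_span_lin (@cup_lin _ _) _ _ => s ws.
  exact/cup00/base_pos.
have [p0|p0] := posnP (pos s); first exact: cup00.
have lt_p : (pos s < (lev j).+2)%N.
  by apply: leq_trans (pos_size p0) _; rewrite (word_size ws) -levE.
rewrite [diag_vec j.+1 s]diag_vecS cup_cup0 //.
by apply: cup1 => //; exact/IH/diag_span_diag_vec/word_reduce.
Qed.

(** A generator applied to [cup p y] either produces a multiple of another cup
    inserted into [y], or passes to [y]. *)
Lemma U_diag_span j i (x : N j) : (i < lev j)%N -> diag_span x -> diag_span (U i x).
Proof.
elim: j i x => [|j IH] i x lt_i; apply: diag_span_lin (tU_lin tw _) _ _ => s ws.
  rewrite (tbase tw lt_i); exact/diag_spanZ/(diag_span_diag_vec ws).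
rewrite [diag_vec j.+1 s]diag_vecS; set y := diag_vec j (reduce s).
have dy : diag_span y by apply/diag_span_diag_vec/word_reduce.
have dc p : (p < (lev j).+2)%N -> diag_span (cup p y) by move=> ?; exact: cup_diag_span.
have : (pos s < (lev j).+2)%N.
  have [-> //|/pos_size/leq_trans] := posnP (pos s).
  by apply; rewrite (word_size ws) -levE.
move: (pos s) => p lt_p.
have [e|] := eqVneq i p.
  subst p; have [->|i0] := posnP i; last by rewrite cup_U_ge ?i0 //; apply/diag_spanZ/dc.
  by rewrite cupS // (tU00 tw) // -cupS //; apply/diag_spanZ/dc.
rewrite neq_ltn => /orP[]; rewrite leq_eqVlt => /orP[/eqP e|lt_ip].
- by subst p; rewrite -cupS //; apply: dc; exact: ltnW.
- rewrite cup_U_lt //; apply: cup_diag_span => //; apply: IH => //.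
  by rewrite -2!ltnS; apply: leq_trans lt_p.
- subst i; have [p0|p0] := posnP p; last by rewrite cup_U_next //; exact: dc.
  by rewrite p0 cup_U_1; apply/diag_spanZ/dc.
have [/andP[/eqP p0 /eqP i2]|] := boolP ((p == 0) && (i == 2)).
  subst i p; rewrite cup_U_2 //; apply: cup_diag_span => //; exact: IH.
rewrite negb_and => np; rewrite cup_U_gt //.
  apply: cup_diag_span => //; apply: IH => //.
  by rewrite ltn_subLR ?add2n //; exact: leq_trans lt_ip.
case: (p) np lt_ip => //= np; rewrite leq_eqVlt eq_sym.
by rewrite (negbTE np).
Qed.

End Tower.

(** * The deformed tensor space *)

Section StringOps.
Variables (R : comNzRingType) (q qi al ga : R).
Hypothesis qqi : q * qi = 1.
Implicit Types g h : seq bool -> R.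

(** [U_(i+1)] in coordinates: [R - q], acting on the factors [i] and [i.+1]. *)
Definition uF i g (s : seq bool) : R :=
  match nth false s i, nth false s i.+1 with
  | false, true => g (swap i s) - qi * g s
  | true, false => g (swap i s) - q * g s
  | _, _ => 0
  end.

(** A root vector of the quantum group of [sl_2] in coordinates; this is why it
    commutes with the operators [uF i]. *)
Fixpoint yF h (s : seq bool) : R :=
  match s with
  | [::] => 0
  | b :: s' => (if b then 0 else 1) * h (true :: s') +
               (if b then qi else q) * yF (fun l => h (b :: l)) s'
  end.

(** For [al = [m]] and [ga = q^m] this is [U_0] in coordinates; the blob relations
    hold for arbitrary [al] and [ga], with [q al - ga] in the place of [[m-1]]. *)
Definition u0F g (s : seq bool) : R :=
  if s is true :: s' then - al * g s - ga * yF (fun t => g (false :: t)) s' else 0.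

(** The insertion of [v_1 (x) v_2 - q v_2 (x) v_1] behind the first [i] factors. *)
Fixpoint wF i g (s : seq bool) : R :=
  match i, s with
  | 0, false :: true :: s' => g s'
  | 0, true :: false :: s' => - q * g s'
  | i'.+1, b :: s' => wF i' (fun t => g (b :: t)) s'
  | _, _ => 0
  end.

Lemma uF_lin i c d g h s :
  uF i (fun l => c * g l + d * h l) s = c * uF i g s + d * uF i h s.
Proof. by rewrite /uF; case: nth; case: nth; ring. Qed.

Lemma yF_lin c d g h s :
  yF (fun l => c * g l + d * h l) s = c * yF g s + d * yF h s.
Proof.
elim: s g h => [|b s IH] g h /=; first by ring.
by rewrite IH; case: b; ring.
Qed.

Lemma yF0 s : yF (fun=> 0) s = 0.
Proof. by elim: s => //= b s ->; rewrite !mulr0 addr0. Qed.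

Lemma yFZ c g s : yF (fun l => c * g l) s = c * yF g s.
Proof.
have := yF_lin c 0 g g s; rewrite mul0r addr0 => <-.
by congr yF; apply/funext => l; rewrite mul0r addr0.
Qed.

Lemma yFB c g h s : yF (fun l => g l - c * h l) s = yF g s - c * yF h s.
Proof.
have := yF_lin 1 (- c) g h s; rewrite mul1r mulNr => <-.
by congr yF; apply/funext => l; rewrite mul1r mulNr.
Qed.

Lemma u0F_lin c d g h s :
  u0F (fun l => c * g l + d * h l) s = c * u0F g s + d * u0F h s.
Proof. by case: s => [|[] s] /=; rewrite ?yF_lin; ring. Qed.

Lemma wF_lin i c d g h s :
  wF i (fun l => c * g l + d * h l) s = c * wF i g s + d * wF i h s.
Proof.
elim: i g h s => [|i IH] g h [|x s] /=; rewrite ?IH //; try ring.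
by case: x; case: s => [|[] s]; ring.
Qed.

Lemma uF_sq i g s : (i.+1 < size s)%N -> uF i (uF i g) s = - (q + qi) * uF i g s.
Proof.
move=> hs; rewrite /uF swapK nth_swapl // nth_swapr //.
by case: nth; case: nth; ring: qqi.
Qed.

Lemma uF_adj i g s : (i.+2 < size s)%N -> uF i (uF i.+1 (uF i g)) s = uF i g s.
Proof.
elim: i g s => [|i IH] g [|x [|y [|z s]]] //= hs; last first.
  exact: (IH (fun t => g (x :: t)) (y :: z :: s)).
by rewrite /uF /=; case: x; case: y; case: z => /=; ring: qqi.
Qed.

Lemma uF_adj' i g s : (i.+2 < size s)%N -> uF i.+1 (uF i (uF i.+1 g)) s = uF i.+1 g s.
Proof.
elim: i g s => [|i IH] g [|x [|y [|z s]]] //= hs; last first.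
  exact: (IH (fun t => g (x :: t)) (y :: z :: s)).
by rewrite /uF /=; case: x; case: y; case: z => /=; ring: qqi.
Qed.

Lemma uF_comm i j g s : (i.+1 < j)%N -> (j.+1 < size s)%N ->
  uF i (uF j g) s = uF j (uF i g) s.
Proof.
elim: i j g s => [|i IH] [|[|j]] g [|x [|y s]] //= ij hs; last first.
  exact: (IH j.+1 (fun t => g (x :: t)) (y :: s)).
rewrite /uF /=.
by case: x; case: y => /=; case: nth; case: nth; ring.
Qed.

Lemma yF_uF i h s : (i.+1 < size s)%N -> yF (uF i h) s = uF i (yF h) s.
Proof.
elim: i s h => [|i IH] [|x [|y s]] //= h hs; last first.
  have := IH (y :: s) (fun l => h (x :: l)) hs; rewrite /uF /= => ->.
  by case: x; case: (nth false (y :: s) i); case: (nth false s i) => /=; ring.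
by rewrite /uF /=; case: x; case: y => /=; rewrite ?yF0 ?yFB; ring: qqi.
Qed.

Lemma yF_wF i h s : yF (wF i h) s = wF i (yF h) s.
Proof.
elim: i s h => [|i IH] [|x s] //= h; last first.
  by rewrite IH wF_lin; case: x; rewrite ?mul0r ?mul1r.
case: s => [|y s]; first by case: x; rewrite /= !mulr0 addr0.
by case: x; case: y => /=; rewrite ?yF0 ?yFZ; ring: qqi.
Qed.

Lemma u0F_sq g s : u0F (u0F g) s = - al * u0F g s.
Proof.
case: s => [|[] s] /=; rewrite ?mulr0 //.
by rewrite yF0; ring.
Qed.

Lemma u0F_uF i g s : (i.+2 < size s)%N -> u0F (uF i.+1 g) s = uF i.+1 (u0F g) s.
Proof.
case: s => [|x s] //= hs; have E h : uF i.+1 h (x :: s) = uF i (fun t => h (x :: t)) s by [].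
rewrite !E; case: x E => E /=; last by rewrite /uF; case: nth; case: nth; ring.
rewrite (yF_uF _ hs).
have -> : (fun t => - al * g (true :: t) - ga * yF (fun t0 => g (false :: t0)) t) =
  (fun t => - al * g (true :: t) + - ga * yF (fun t0 => g (false :: t0)) t).
  by apply/funext => t; rewrite [- ga * _]mulNr.
by rewrite uF_lin [- ga * _]mulNr.
Qed.

Lemma uF_u0F g s : (1 < size s)%N ->
  uF 0 (u0F (uF 0 g)) s = (q * al - ga) * uF 0 g s.
Proof.
case: s => [|x [|y s]] // _; rewrite /uF /=.
by case: x; case: y => /=; rewrite ?yF0; ring: qqi.
Qed.

Lemma uF_wF i g s : (i.+1 < size s)%N -> uF i (wF i g) s = - (q + qi) * wF i g s.
Proof.
elim: i g s => [|i IH] g [|x [|y s]] //= hs; last exact: IH.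
by rewrite /uF /=; case: x; case: y => /=; ring: qqi.
Qed.

Lemma uF_wF_next i g s : (i.+2 < size s)%N -> uF i (wF i.+1 g) s = wF i g s.
Proof.
elim: i g s => [|i IH] g [|x [|y [|z s]]] //= hs; last exact: (IH _ (y :: z :: s)).
by rewrite /uF /=; case: x; case: y; case: z => /=; ring: qqi.
Qed.

Lemma uF_wF_comm i j g s : (i.+1 < j)%N -> (j.+1 < size s)%N ->
  uF i (wF j g) s = wF j (uF i g) s.
Proof.
elim: i j g s => [|i IH] [|[|j]] g [|x [|y s]] //= ij hs; last first.
  exact: (IH j.+1 (fun t => g (x :: t)) (y :: s)).
have wF0 : wF j (fun=> 0) s = 0.
  by have := wF_lin j 0 0 g g s; rewrite !mul0r addr0 => {2}<-; congr wF;
    apply/funext => l; rewrite !mul0r addr0.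
rewrite /uF /=; case: x; case: y => //=.
  by have := wF_lin j 1 (- q) (fun t => g [:: false, true & t])
    (fun t => g [:: true, false & t]) s; rewrite !mul1r !mulNr => <-; congr wF;
    apply/funext => l; rewrite mul1r mulNr.
by have := wF_lin j 1 (- qi) (fun t => g [:: true, false & t])
  (fun t => g [:: false, true & t]) s; rewrite !mul1r !mulNr => <-; congr wF;
  apply/funext => l; rewrite mul1r mulNr.
Qed.

Lemma u0F_wF i g s : u0F (wF i.+1 g) s = wF i.+1 (u0F g) s.
Proof.
case: s => [|[] s] //=; last first.
  by have := wF_lin i 0 0 g g s; rewrite !mul0r addr0 => {1}<-; congr wF;
    apply/funext => l; rewrite !mul0r addr0.
rewrite yF_wF -[- (ga * _)]mulNr -wF_lin; congr wF; apply/funext => l.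
by rewrite [- ga * _]mulNr.
Qed.

End StringOps.

Section DeformedTower.
Variables (R : comNzRingType) (q qi al ga : R).
Hypothesis qqi : q * qi = 1.
Variables (a b : nat).
Hypothesis ab0 : a = 0 \/ b = 0.
Local Notation l := (a + b)%N.
Local Notation lev := (lev l).
Implicit Types f : seq bool -> R.

Definition words j := permutations (nseq (a + j) true ++ nseq (b + j) false).

Lemma mem_words j s : (s \in words j) = word a b j s.
Proof.
rewrite mem_permutations /word; apply/idP/andP => [/permP e|[/eqP ct /eqP cf]].
  by rewrite !e !count_cat !count_nseq /= !mul0n !mul1n addn0.
apply/allP => x _ /=; rewrite !count_cat !count_nseq.
by case: x; rewrite /= ?ct ?cf !mul0n !mul1n ?addn0.
Qed.

Definition weight_tens j : lmodType R := {ffun seq_sub (words j) -> R^o}.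

Definition ext j (g : weight_tens j) (s : seq bool) : R :=
  if insub s is Some t then g t else 0.

Definition restrict j f : weight_tens j := [ffun t => f (val t)].

Definition supp j f := forall s, ~~ word a b j s -> f s = 0.

Lemma extE j (g : weight_tens j) (t : seq_sub (words j)) : ext g (val t) = g t.
Proof. by rewrite /ext valK. Qed.

Lemma ext_supp j (g : weight_tens j) : supp j (ext g).
Proof. by move=> s ws; rewrite /ext insubN // mem_words. Qed.

Lemma word_val j (t : seq_sub (words j)) : word a b j (val t).
Proof. by rewrite -mem_words (valP t). Qed.

Lemma size_val j (t : seq_sub (words j)) : size (val t) = lev j.
Proof. by rewrite (word_size (word_val t)) -levE. Qed.

Lemma ext_restrict j f : supp j f -> ext (restrict j f) = f.
Proof.
move=> sf; apply/funext => s; rewrite /ext; case: insubP => [t _ <-|ws].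
  by rewrite ffunE.
by rewrite sf // -mem_words.
Qed.

Lemma ext_lin j c (g h : weight_tens j) : ext (c *: g + h) = fun s => c * ext g s + 1 * ext h s.
Proof.
apply/funext => s; rewrite /ext; case: insubP => [t _ _|_]; last by rewrite !mulr0 addr0.
by rewrite !ffunE mul1r.
Qed.

Lemma ext_inj j (g h : weight_tens j) : (forall s, size s = lev j -> ext g s = ext h s) -> g = h.
Proof. by move=> e; apply/ffunP => t; rewrite -!extE e // size_val. Qed.

Definition opF i := if i is i'.+1 then uF q qi i' else u0F q qi al ga.

Definition tens_U j i (g : weight_tens j) : weight_tens j := restrict j (opF i (ext g)).

Definition tens_C j (g : weight_tens j) : weight_tens j.+1 := restrict j.+1 (wF q (lev j) (ext g)).

Definition unitv j s : weight_tens j := [ffun t => (val t == s)%:R].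

Definition base_vec : weight_tens 0 := unitv 0 (nseq a true ++ nseq b false).

Lemma yF_supp h s : (forall s', count_mem true s' = (count_mem true s).+1 ->
  (count_mem false s').+1 = count_mem false s -> h s' = 0) -> yF q qi h s = 0.
Proof.
elim: s h => //= x s IH h hs; rewrite IH ?mulr0 ?addr0 => [|s' ct cf].
  by case: x hs => hs; rewrite ?mul0r // hs ?mulr0.
by apply: hs; rewrite /= ?ct -?cf ?addnS.
Qed.

Lemma wF_supp i h s : (forall s', count_mem true s = (count_mem true s').+1 ->
  count_mem false s = (count_mem false s').+1 -> h s' = 0) -> wF q i h s = 0.
Proof.
elim: i h s => [|i IH] h [|x s] //=.
  by case: x; case: s => [|[] s] //= hs; rewrite hs ?mulr0.
move=> hs; apply: IH => s' ct cf; apply: hs; rewrite /= ?ct ?cf ?addnS //.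
Qed.

Lemma opF_supp j i f : supp j f -> supp j (opF i f).
Proof.
move=> sf s ws; case: i => [|i] /=.
  case: s ws => [|[] s] //= ws; rewrite sf // mulr0 sub0r yF_supp ?mulr0 ?oppr0 //.
  move=> s' ct cf; apply: sf; apply: contra ws.
  by rewrite /word /= !add0n !add1n ct -cf.
have wsw : ~~ word a b j (swap i s) by rewrite /word !count_swap.
by rewrite /uF !sf // !mulr0 subrr; case: nth; case: nth.
Qed.

Lemma wF_supp_word j i f : supp j f -> supp j.+1 (wF q i f).
Proof.
move=> sf s ws; apply: wF_supp => s' ct cf; apply: sf; apply: contra ws.
by rewrite /word ct cf !addnS !eqSS.
Qed.

Lemma ext_tens_U j i (g : weight_tens j) : ext (tens_U i g) = opF i (ext g).
Proof. exact/ext_restrict/opF_supp/ext_supp. Qed.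

Lemma ext_tens_C j (g : weight_tens j) : ext (tens_C g) = wF q (lev j) (ext g).
Proof. exact/ext_restrict/wF_supp_word/ext_supp. Qed.

Lemma tens_U_lin j i : linear (@tens_U j i).
Proof.
move=> c g h; apply: ext_inj => s _; rewrite ext_lin !ext_tens_U ext_lin.
by case: i => [|i]; rewrite /= (u0F_lin, uF_lin).
Qed.

Lemma tens_C_lin j : linear (@tens_C j).
Proof. by move=> c g h; apply: ext_inj => s _; rewrite ext_lin !ext_tens_C ext_lin wF_lin. Qed.

Lemma ext_scale j c (g : weight_tens j) s : ext (c *: g) s = c * ext g s.
Proof.
rewrite -[c *: g]addr0 ext_lin [X in _ + X](_ : _ = 0) ?addr0 // /ext.
by case: insub => [t|]; rewrite ?ffunE mulr0.
Qed.

Lemma base_pos s : word a b 0 s -> pos s = 0.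
Proof.
have [//|p0] := posnP (pos s); rewrite /word !addn0 !(count_cut _ p0).
by case: ab0 => ->; rewrite ?andbF.
Qed.

Lemma deformed_tower : tower a b (N := weight_tens) (@tens_U) (@tens_C) base_vec
  (- (q + qi)) (- al) (q * al - ga).
Proof.
split.
- exact: tens_U_lin.
- exact: tens_C_lin.
- move=> j [|i] y // lti; apply: ext_inj => s hs; rewrite ext_scale !ext_tens_U /=.
  by rewrite uF_sq // hs.
- by move=> j y _; apply: ext_inj => s _; rewrite ext_scale !ext_tens_U /= u0F_sq.
- by move=> j [|i] y // _ lti; apply: ext_inj => s hs; rewrite !ext_tens_U /= uF_adj ?hs.
- by move=> j [|i] y // _ lti; apply: ext_inj => s hs; rewrite !ext_tens_U /= uF_adj' ?hs.
- by move=> j y lt1; apply: ext_inj => s hs; rewrite ext_scale !ext_tens_U /= uF_u0F ?hs.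
- move=> j [|i] [|[|i']] y // lt_ii' lti'; apply: ext_inj => s hs; rewrite !ext_tens_U /=.
    by rewrite u0F_uF ?hs.
  by rewrite uF_comm ?hs.
- move=> j y; apply: ext_inj => s hs; rewrite ext_scale ext_tens_U !ext_tens_C /= uF_wF ?hs //.
- move=> j [|i] y lti; apply: ext_inj => s hs; rewrite !ext_tens_U !ext_tens_C ext_tens_U /=.
    by case: (lev j) lti => // n' _; rewrite u0F_wF.
  by rewrite uF_wF_comm ?hs.
move=> i lti; have sv (t : seq_sub (words 0)) : val t = nseq a true ++ nseq b false.
  by rewrite (pos0_word (word_val t) (base_pos (word_val t))) !addn0.
apply/ffunP => t.
have dv1 : ext base_vec (nseq a true ++ nseq b false) = 1.
  by rewrite -(sv t) extE ffunE sv eqxx.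
rewrite !ffunE /GRing.scale /= sv eqxx mulr1.
case: i lti => [|i] lti /=; last first.
  rewrite /uF; case: ab0 => e; rewrite e ?cats0 /=.
    by rewrite !nth_nseq !if_same.
  by move: lti; rewrite e addn0 !nth_nseq => /[dup] /ltnW -> ->.
case: ab0 => e; first by rewrite e /=; case: (b).
move: dv1; rewrite e; case: (a) => [|a'] //=.
rewrite cats0 => ->; rewrite yF_supp ?mulr0 ?subr0 ?mulr1 // => s _.
by rewrite count_nseq mul0n.
Qed.

End DeformedTower.

(** * Generation of the deformed tensor space up to torsion *)

Fixpoint inversions (s : seq bool) : nat :=
  if s is x :: s' then ((if x then 0 else count_mem true s') + inversions s')%N else 0.

Lemma inversions_swap x y : inversions (x ++ [:: false, true & y]) =
  (inversions (x ++ [:: true, false & y])).+1.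
Proof. by elim: x => [|c x /= ->] /=; rewrite ?addnS ?add1n // !count_cat. Qed.

Lemma pos_split s : (0 < pos s)%N -> exists x y, s = x ++ [:: false, true & y].
Proof.
elim: s => //= c s IH; case: ifP => [/andP[]|_].
  by case: c => //; case: s {IH} => [|[] s] // _ _; exists [::], s.
by case: (pos s) IH => // p [//|x [y ->]] _; exists (c :: x), y.
Qed.

Section Generation.
Variables (R : idomainType) (q qi al ga dli : R).
Hypothesis qqi : q * qi = 1.
Hypothesis dlK : dli * - (q + qi) = 1.
Variables (a b : nat).
Hypothesis ab0 : a = 0 \/ b = 0.
Local Notation l := (a + b)%N.
Local Notation lev := (lev l).
Local Notation E := (weight_tens R a b).
Local Notation U := (@tens_U R q qi al ga a b).
Local Notation C := (@tens_C R q a b).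
Local Notation diag_span := (@diag_span R a b E U C (base_vec R a b) _).
Local Notation cup := (@cup l E U C _).
Local Notation e := (unitv R a b).
Local Notation delta z := (fun s : seq bool => (s == z)%:R : R).
Let tw := deformed_tower al ga qqi ab0.

(** The quantum integer [[r]], in a form that needs no division. *)
Fixpoint qn (r : nat) : R := if r is r'.+1 then q ^+ r' + qi * qn r' else 0.

Hypothesis generic : forall r, (0 < r)%N -> al * q ^+ r - ga * qn r != 0.

Definition sat j (g : E j) : Prop := exists2 p, p != 0 & diag_span (p *: g).

Lemma sat0 j : sat (0 : E j).
Proof. by exists 1; [exact: oner_neq0 | rewrite scaler0; exact: diag_span0]. Qed.

Lemma satD j (g h : E j) : sat g -> sat h -> sat (g + h).
Proof.
move=> [p p0 dg] [p' p'0 dh]; exists (p * p'); first by rewrite mulf_neq0.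
rewrite scalerDr; apply: diag_spanD; last by rewrite -scalerA; exact: diag_spanZ.
by rewrite mulrC -scalerA; exact: diag_spanZ.
Qed.

Lemma satZ j c (g : E j) : sat g -> sat (c *: g).
Proof.
by move=> [p p0 dg]; exists p => //; rewrite scalerA mulrC -scalerA; exact: diag_spanZ.
Qed.

Lemma sat_cancel j c (g : E j) : c != 0 -> sat (c *: g) -> sat g.
Proof.
by move=> c0 [p p0]; rewrite scalerA => dg; exists (p * c); rewrite ?mulf_neq0.
Qed.

Lemma sat_U j i (g : E j) : (i < lev j)%N -> sat g -> sat (U i g).
Proof.
move=> lti [p p0 dg]; exists p => //; rewrite -(scalable_linear (tU_lin tw i)).
exact: (U_diag_span tw dlK (base_pos ab0)).
Qed.

Lemma sat_cup j i (g : E j) : (i < (lev j).+2)%N -> sat g -> sat (cup i g).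
Proof.
move=> lti [p p0 dg]; exists p => //; rewrite -(cupZ tw).
exact: (cup_diag_span tw dlK (base_pos ab0)).
Qed.

Lemma sat_trans j (g h k : E j) c d :
  sat (g - c *: h) -> sat (h - d *: k) -> sat (g - (c * d) *: k).
Proof.
move=> gh /(satZ c); rewrite scalerBr scalerA => hk.
by have := satD gh hk; rewrite addrA subrK.
Qed.

Lemma ext_unitv j z : word a b j z -> ext (e j z) = delta z.
Proof.
move=> wz; apply/funext => s; rewrite /ext; case: insubP => [t _ <-|]; first by rewrite ffunE.
by rewrite mem_words; case: eqP => // ->; rewrite wz.
Qed.

Lemma wF0 i s : wF q i (fun=> 0) s = 0.
Proof. by elim: i s => [|i IH] [|[] [|[] s]] //=; rewrite ?mulr0 ?IH. Qed.

Lemma wF_delta x y s : wF q (size x) (delta (x ++ y)) s =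
  (s == x ++ [:: false, true & y])%:R - q * (s == x ++ [:: true, false & y])%:R.
Proof.
elim: x s => [|c x IH] [|c' s] /=; rewrite ?mulr0 ?subr0 //.
  by case: c' s => [] [|[] s]; rewrite /= ?mulr0 ?subr0 ?sub0r ?mulNr ?oppr0.
rewrite !eqseq_cons; case: eqP => [->|ne] /=.
  rewrite -IH; by congr wF; apply/funext => t; rewrite eqseq_cons eqxx.
transitivity (wF q (size x) (fun=> 0) s); last by rewrite wF0 mulr0 subr0.
by congr wF; apply/funext => t; rewrite eqseq_cons; case: eqP.
Qed.

(** By descending induction on [i], as [U i.+1] moves an inserted cup one position to
    the left. *)
Lemma ext_cup j i (g : E j) : (i < (lev j).+1)%N -> ext (cup i.+1 g) = wF q i (ext g).
Proof.
move=> lti; have [d] := ubnP (lev j - i)%N; elim: d i lti => // d IH i lti ltd.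
move: (lti); rewrite ltnS leq_eqVlt => /orP[/eqP ->|lt1].
  by rewrite cup_top ext_tens_C.
rewrite cupS // ext_tens_U IH //=; last first.
  by rewrite -ltnS; apply: leq_trans ltd; rewrite ltnS ltn_sub2l.
apply/funext => s; have [ws|ws] := boolP (word a b j.+1 s); last first.
  have /(_ s ws) := opF_supp q qi al ga i.+1 (wF_supp_word q i.+1 (@ext_supp _ _ _ _ g)).
  by rewrite /= => ->; rewrite (wF_supp_word _ _ (@ext_supp _ _ _ _ g)).
by rewrite uF_wF_next // (word_size ws) -levE.
Qed.

Lemma word_swap2 j x y : word a b j (x ++ [:: true, false & y]) =
  word a b j (x ++ [:: false, true & y]).
Proof. by rewrite /word !count_cat. Qed.

Section Level.
Variable j : nat.
Hypothesis sat_below : forall s, word a b j s -> sat (e j s).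

(** The difference is a cup inserted into the basis vector of [x ++ y]. *)
Lemma sat_swap x y : word a b j.+1 (x ++ [:: false, true & y]) ->
  sat (e j.+1 (x ++ [:: false, true & y]) - q *: e j.+1 (x ++ [:: true, false & y])).
Proof.
move=> w; have w' : word a b j (x ++ y).
  by move: w; rewrite /word !count_cat /= !addnS !eqSS add0n.
have ltx : (size x < (lev j).+1)%N.
  by rewrite ltnS levE -(word_size w') size_cat leq_addr.
rewrite (_ : _ - _ = cup (size x).+1 (e j (x ++ y))); last first.
  apply: ext_inj => s _; rewrite ext_cup // ext_unitv // wF_delta.
  rewrite addrC -scaleNr ext_lin !ext_unitv ?word_swap2 //.
  by rewrite mul1r mulNr addrC.
by apply: sat_cup; [exact: ltx | exact: sat_below].
Qed.

Lemma sat_move x i y : word a b j.+1 (x ++ false :: nseq i true ++ y) ->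
  sat (e j.+1 (x ++ false :: nseq i true ++ y) -
       q ^+ i *: e j.+1 (x ++ nseq i true ++ false :: y)).
Proof.
elim: i x => [|i IH] x /= w; first by rewrite scale1r subrr; exact: sat0.
rewrite exprS; apply: sat_trans (sat_swap w) _.
have := IH (rcons x true); rewrite !cat_rcons; apply.
by move: w; rewrite -word_swap2.
Qed.

(** The tensor product of the basis vector of [x] with [h]. *)
Fixpoint pre (x : seq bool) (h : seq bool -> R) (s : seq bool) : R :=
  match x, s with
  | [::], _ => h s
  | c :: x', c' :: s' => if c' == c then pre x' h s' else 0
  | _ :: _, [::] => 0
  end.

Lemma yF_delta_true z s : yF q qi (delta (true :: z)) s =
  delta (false :: z) s + qi * pre [:: true] (yF q qi (delta z)) s.
Proof.
case: s => [|c s] /=; first by rewrite mulr0 addr0.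
rewrite (_ : (fun l : seq bool => _) = if c then delta z else fun=> 0); last first.
  by apply/funext => t; rewrite eqseq_cons; case: c.
by case: c => /=; rewrite ?eqseq_cons ?yF0 /=; ring.
Qed.

Lemma yF_delta_false z s : yF q qi (delta (false :: z)) s =
  q * pre [:: false] (yF q qi (delta z)) s.
Proof.
case: s => [|c s] /=; first by rewrite mulr0.
rewrite (_ : (fun l : seq bool => _) = if c then fun=> 0 else delta z); last first.
  by apply/funext => t; rewrite eqseq_cons; case: c.
by case: c => /=; rewrite ?eqseq_cons ?yF0 /=; ring.
Qed.

Lemma pre_rcons x c h s : pre (rcons x c) h s = pre x (pre [:: c] h) s.
Proof. by elim: x s => [|c' x IH] [|c'' s] //=; case: eqP. Qed.

Lemma pre_yF_true x z s : pre x (yF q qi (delta (true :: z))) s =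
  delta (x ++ false :: z) s + qi * pre (rcons x true) (yF q qi (delta z)) s.
Proof.
rewrite pre_rcons; elim: x s => [|c x IH] s; first exact: yF_delta_true.
case: s => [|c' s] /=; first by rewrite mulr0 addr0.
rewrite IH eqseq_cons; case: eqP => //= _.
by rewrite mulr0 addr0.
Qed.

Lemma yF_delta_nseq c s : yF q qi (delta (nseq c false)) s = 0.
Proof.
elim: c s => [|c IH] s /=.
  elim: s => //= x s IH; rewrite mulr0 add0r.
  by rewrite -[RHS](mulr0 (if x then qi else q)) -(yF0 q qi s).
rewrite yF_delta_false; case: s => [|x s] /=; first by rewrite mulr0.
by rewrite IH if_same mulr0.
Qed.

Lemma pre_delta_nseq x c :
  restrict a b j.+1 (pre x (yF q qi (delta (nseq c false)))) = 0.
Proof.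
apply/ffunP => t; rewrite !ffunE.
elim: x (val t) => [|y x IH] s; first exact: yF_delta_nseq.
by case: s => [|y' s] //=; rewrite IH if_same.
Qed.

(** [U_0] replaces one letter [true] by [false], and all the resulting strings agree
    up to powers of [q] modulo the cups; the powers add up to a quantum integer. *)
Lemma sat_Y x r c : word a b j.+1 (x ++ nseq r.-1 true ++ nseq c.+1 false) ->
  sat (restrict a b j.+1 (pre x (yF q qi (delta (nseq r true ++ nseq c false)))) -
       qn r *: e j.+1 (x ++ nseq r.-1 true ++ nseq c.+1 false)).
Proof.
elim: r x => [|r IH] x w.
  by rewrite scale0r subr0 pre_delta_nseq; exact: sat0.
set V := restrict _ _ _ _; set e2 := e _ _.
pose V' := restrict a b j.+1
  (pre (rcons x true) (yF q qi (delta (nseq r true ++ nseq c false)))).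
have -> : V = e j.+1 (x ++ false :: nseq r true ++ nseq c false) + qi *: V'.
  by apply/ffunP => t; rewrite !ffunE pre_yF_true.
have -> : forall u : E j.+1, u + qi *: V' - qn r.+1 *: e2 =
    (u - q ^+ r *: e2) + qi *: (V' - qn r *: e2).
  by move=> u; rewrite scalerBr scalerA /= scalerDl opprD addrACA.
apply: satD; first apply: sat_move.
  by move: w; rewrite /word !count_cat /= !count_cat /= !(addnS, addSn, addn0, add0n).
apply: satZ; case: r @V @V' @e2 IH w => [|r] V V' e2 IH w.
  by rewrite /V' pre_delta_nseq scale0r subr0; exact: sat0.
have := IH (rcons x true); rewrite !cat_rcons; exact.
Qed.

Lemma U0_false z : word a b j.+1 (false :: z) -> U 0 (e j.+1 (false :: z)) =
  - ga *: restrict a b j.+1 (pre [:: true] (yF q qi (delta z))).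
Proof.
move=> w; apply/ffunP => t; rewrite !ffunE ext_unitv //= /GRing.scale /=.
case: (val t) => [|[] s] /=; rewrite ?mulr0 // sub0r mulNr.
by congr (- (_ * yF _ _ _ _)); apply/funext => t'; rewrite eqseq_cons.
Qed.

Lemma U0_true z : word a b j.+1 (true :: z) -> U 0 (e j.+1 (true :: z)) =
  - al *: e j.+1 (true :: z).
Proof.
move=> w; apply/ffunP => t; rewrite !ffunE ext_unitv //= /GRing.scale /=.
case: (val t) => [|[] s] /=; rewrite ?mulr0 //.
rewrite (_ : (fun t => _) = fun=> 0) ?yF0 ?mulr0 ?subr0 //.
Qed.

(** Moving the first letter of [false true^r false^c] to the right gives an element of
    the saturation. Its image under [U_0] is, modulo the saturation, the multiple
    of the sorted basis vector by [al q^r - ga [r]], which is nonzero. *)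
Lemma sat_sorted : sat (e j.+1 (nseq (a + j.+1) true ++ nseq (b + j.+1) false)).
Proof.
pose r := (a + j).+1; pose c := (b + j)%N; rewrite !addnS -/r -/c.
set s0 := nseq r true ++ nseq c.+1 false.
have w0 : word a b j.+1 s0.
  by rewrite /word !count_cat !count_nseq /= !mul0n !mul1n addn0 !addnS !eqxx.
have w1 : word a b j.+1 (false :: nseq r true ++ nseq c false).
  by move: w0; rewrite /word !count_cat /= !count_cat /= !(addnS, addSn, addn0, add0n).
have h1 := sat_U (isT : 0 < lev j.+1)%N (sat_move (x := [::]) w1).
have h2 := sat_Y (x := [:: true]) (r := r) (c := c) w0.
apply: (sat_cancel (generic (isT : 0 < r)%N)).
have := satD h1 (satZ ga h2); congr sat.
have D := zmod_morphism_linear (tU_lin tw 0).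
have Z := scalable_linear (tU_lin tw 0).
rewrite D Z /= U0_false // (U0_true (z := nseq r.-1 true ++ nseq c.+1 false)) //.
have alg (P S : E j.+1) x n : - ga *: P - x *: (- al *: S) + ga *: (P - n *: S) =
    (al * x - ga * n) *: S.
  rewrite scalerBr !scalerA mulrN !scaleNr opprK scalerBl addrACA addNr add0r.
  by rewrite [x * al]mulrC.
exact: alg.
Qed.

(** Sorting reduces every basis vector to the sorted one. *)
Lemma sat_above s : word a b j.+1 s -> sat (e j.+1 s).
Proof.
have [n] := ubnP (inversions s); elim: n s => // n IH s ltn ws.
have [p0|p0] := posnP (pos s); first by rewrite (pos0_word ws p0); exact: sat_sorted.
have [x [y sE]] := pos_split p0; rewrite sE in ws ltn *.
rewrite -(subrK (q *: e j.+1 (x ++ [:: true, false & y])) (e _ _)).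
apply: satD; first exact: sat_swap.
apply/satZ/IH; last by rewrite word_swap2.
by rewrite inversions_swap in ltn.
Qed.

End Level.

Lemma sat_unitv j s : word a b j s -> sat (e j s).
Proof.
elim: j s => [|j IH] s ws; last exact: sat_above.
exists 1; first exact: oner_neq0.
rewrite scale1r (pos0_word ws (base_pos ab0 ws)) !addn0.
exact: (diag_span_diag_vec _ _ _ ws).
Qed.

End Generation.

(** * The lattice of half-diagrams and its reduction *)

Section FinfunEndo.
Variables (R : idomainType) (T : finType).
Local Notation E := {ffun T -> R^o}.
Definition basis_vec (t : T) : E := [ffun s => (s == t)%:R].

Lemma finfun_sum (x : E) : x = \sum_t x t *: basis_vec t.
Proof.
apply/ffunP => s; rewrite sum_ffunE (bigD1 s) //= !ffunE eqxx big1 ?addr0.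
  by rewrite /GRing.scale /= mulr1.
by move=> t ts; rewrite !ffunE eq_sym (negbTE ts) scaler0.
Qed.

(** Preimages of multiples of the basis vectors give a right inverse [g] up to the
    scalar [d]; by determinants [f] is injective, so [g] is a left inverse as well. *)
Lemma endo_commensurable (f : {linear E -> E}) :
  (forall t, exists2 p, p != 0 & exists c, f c = p *: basis_vec t) ->
  exists (g : {linear E -> E}) (d : R),
    [/\ d != 0, forall x, f (g x) = d *: x & forall x, g (f x) = d *: x].
Proof.
move=> h; have [|p pP] := choice
    (P := fun t (p : R) => p != 0 /\ exists c, f c = p *: basis_vec t).
  by move=> t; have [p] := h t; exists p.
have [c cP] := choice (fun t => (pP t).2).
pose d := \prod_t p t.
pose g0 (x : E) : E := \sum_t x t *: ((\prod_(s | s != t) p s) *: c t).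
have g_lin : linear g0.
  move=> a x y; rewrite /g0 scaler_sumr -big_split; apply: eq_bigr => t _ /=.
  by rewrite !ffunE scalerDl [in RHS]scalerA.
pose G := GRing.isLinear.Build _ _ _ _ _ g_lin.
pose g : {linear E -> E} := HB.pack g0 G.
have fg x : f (g x) = d *: x.
  rewrite [in RHS](finfun_sum x) linear_sum scaler_sumr; apply: eq_bigr => t _.
  by rewrite !linearZ /= cP !scalerA -mulrA [_ * p t]mulrC /d [in RHS](bigD1 t).
have d0 : d != 0 by apply/prodf_neq0 => t _; case: (pP t).
exists g, d; split=> // x; apply/eqP; rewrite -subr_eq0; apply/eqP.
set y := _ - _; have fy : f y = 0 by rewrite linearB linearZ /= fg subrr.
pose col (x : E) := \col_(i < #|T|) x (enum_val i).
pose mx (f : E -> E) := \matrix_(i < #|T|, j < #|T|) f (basis_vec (enum_val j)) (enum_val i).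
have colE (h' : {linear E -> E}) z : col (h' z) = mx h' *m col z.
  apply/matrixP => i j; rewrite !mxE [in LHS](finfun_sum z) linear_sum sum_ffunE.
  rewrite (reindex _ (onW_bij _ (@enum_val_bij T))) /=; apply: eq_bigr => s _.
  by rewrite linearZ /= !mxE ffunE mulrC.
have mxfg : mx f *m mx g = d%:M.
  apply/matrixP => i j; transitivity ((mx f *m col (g (basis_vec (enum_val j)))) i ord0).
    by rewrite !mxE; apply: eq_bigr => s _; rewrite !mxE.
  rewrite -colE fg !mxE !ffunE (inj_eq enum_val_inj) /GRing.scale /=.
  by case: eqP => _; rewrite ?mulr1 ?mulr0.
(* [f] is injective, since its matrix divides a nonzero scalar matrix. *)
have detf : \det (mx f) != 0.
  have := congr1 determinant mxfg; rewrite det_mulmx det_scalar => e.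
  by apply: contraTneq (expf_neq0 #|T| d0) => f0; rewrite -e f0 mul0r eqxx.
have : col y = 0.
  have : \adj (mx f) *m (mx f *m col y) = 0.
    rewrite -colE fy; apply/matrixP => i j; rewrite !mxE big1 // => s _.
    by rewrite !mxE ffunE mulr0.
  rewrite mulmxA mul_adj_mx mul_scalar_mx => /matrixP e; apply/matrixP => i j.
  by have := e i j; rewrite !mxE => /eqP; rewrite mulf_eq0 (negbTE detf) => /eqP.
move=> /matrixP c0; apply/ffunP => t; have := c0 (enum_rank t) ord0.
by rewrite !mxE enum_rankK => ->; rewrite ffunE.
Qed.

End FinfunEndo.

Lemma diag_span_sum (R : comNzRingType) a b (N : nat -> lmodType R) U C v j (x : N j) :
  diag_span a b U C v x -> exists p : seq_sub (words a b j) -> R,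
    x = \sum_t p t *: diag_vec (a + b) U C v j (val t).
Proof.
elim=> [|c s y ws _ [p ->]]; first by exists (fun=> 0); rewrite big1 // => t _; rewrite scale0r.
have sw : s \in words a b j by rewrite mem_words.
exists (fun t => c * (t == SeqSub sw)%:R + p t).
rewrite [in RHS](eq_bigr _ (fun t _ => scalerDl _ _ _)) big_split /=; congr (_ + _).
rewrite (bigD1 (SeqSub sw)) //= eqxx mulr1 big1 ?addr0 // => t /negbTE ->.
by rewrite mulr0 scale0r.
Qed.

(** Relations are inherited by a sublattice, as [be] is injective, and by its
    reduction, as [pi] is surjective. *)
Section Descent.
Variables (k : fieldType) (a b : nat).
Local Notation R := {poly k}.
Local Notation lev := (lev (a + b)).
Variables (E F : nat -> lmodType R) (W : nat -> lmodType k).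
Variables (U : forall j, nat -> E j -> E j) (C : forall j, E j -> E j.+1) (v : E 0).
Variables (latt_U : forall j, nat -> F j -> F j) (latt_C : forall j, F j -> F j.+1) (fv : F 0).
Variables (half_U : forall j, nat -> W j -> W j) (half_C : forall j, W j -> W j.+1) (wv : W 0).
Variables (be : forall j, F j -> E j) (pi : forall j, F j -> W j).
Variables dl al bt : R.
Hypothesis tw : tower a b U C v dl al bt.
Hypotheses (beZ : forall j c (p : F j), be (c *: p) = c *: be p)
  (be_inj : forall j, injective (@be j))
  (be_U : forall j i (p : F j), (i < lev j)%N -> be (latt_U i p) = U i (be p))
  (be_C : forall j (p : F j), be (latt_C p) = C (be p))
  (be_v : be fv = v).
Hypotheses (piZ : forall j c (p : F j), pi (c *: p) = c.[0] *: pi p)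
  (pi_sur : forall j (y : W j), exists p, y = pi p)
  (pi_U : forall j i (p : F j), (i < lev j)%N -> half_U i (pi p) = pi (latt_U i p))
  (pi_C : forall j (p : F j), half_C (pi p) = pi (latt_C p))
  (pi_v : wv = pi fv).
Hypotheses (half_U_lin : forall j i, linear (@half_U j i)) (half_C_lin : forall j, linear (@half_C j)).

Lemma tower_descent : tower a b half_U half_C wv dl.[0] al.[0] bt.[0].
Proof.
split=> //.
- move=> j i y /andP[i0 lti]; have [p ->] := pi_sur y; rewrite !pi_U // -piZ.
  by congr pi; apply: be_inj; rewrite beZ !be_U // (tUU tw) // i0.
- move=> j y lt0; have [p ->] := pi_sur y; rewrite !pi_U // -piZ.
  by congr pi; apply: be_inj; rewrite beZ !be_U // (tU00 tw).
- move=> j i y i0 lt1; have lti := ltnW lt1; have [p ->] := pi_sur y.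
  by rewrite !pi_U //; congr pi; apply: be_inj; rewrite !be_U // (tUadj tw).
- move=> j i y i0 lt1; have lti := ltnW lt1; have [p ->] := pi_sur y.
  by rewrite !pi_U //; congr pi; apply: be_inj; rewrite !be_U // (tUadj' tw).
- move=> j y lt1; have lt0 := ltnW lt1; have [p ->] := pi_sur y.
  by rewrite !pi_U // -piZ; congr pi; apply: be_inj; rewrite beZ !be_U // (tU101 tw).
- move=> j i i' y ii' lti'.
  have lti : (i < lev j)%N by apply: ltn_trans lti'; exact: ltnW.
  have [p ->] := pi_sur y; rewrite !pi_U //; congr pi.
  by apply: be_inj; rewrite !be_U // (tUcomm tw).
- move=> j y; have [p ->] := pi_sur y; rewrite pi_C pi_U // -piZ; congr pi.
  by apply: be_inj; rewrite beZ be_U // be_C (tUC tw).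
- move=> j i y lti.
  have lti2 : (i < lev j.+1)%N by apply: leq_trans lti _; do 2!apply: leqW.
  have [p ->] := pi_sur y; rewrite pi_C !pi_U // pi_C; congr pi.
  by apply: be_inj; rewrite be_C !be_U // be_C (tCU tw).
move=> i lti; have := tbase tw lti; set e := if _ then _ else _ => eE.
transitivity (e.[0] *: wv); last by rewrite /e; case: ifP; rewrite ?horner0.
by rewrite pi_v pi_U // -piZ; congr pi; apply: be_inj; rewrite beZ be_U // be_v.
Qed.

End Descent.

Section TowerRep.
Variables (k : fieldType) (q : k) (m : int) (a b : nat).
Local Notation lev := (lev (a + b)).
Variables (N : nat -> lmodType k) (U : forall j, nat -> N j -> N j).
Variables (C : forall j, N j -> N j.+1) (v : N 0).
Hypothesis tw : tower a b U C v (- qint q 2) (- qint q m) (qint q (m - 1)).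

Definition tower_op j (i : 'I_(lev j)) : {linear N j -> N j} :=
  HB.pack (@U j i) (GRing.isLinear.Build k (N j) (N j) *:%R (@U j i)
    (@tU_lin _ _ _ _ _ _ _ _ _ _ tw j i)).

Lemma tower_rel j s t : @blob_rel k q m (lev j) s t -> forall w : N j,
  teval (@tower_op j) s w = teval (@tower_op j) t w.
Proof.
case=> {s t} [i i' i0 i'0 ii'|i i0|i i0|i i' i0 i'1|i i' ii'] w /=.
- have := ltn_ord i; have := ltn_ord i'; case/orP: ii' => /eqP ->.
    by move=> h _; rewrite (tUadj tw).
  by move=> _ h; rewrite (tUadj' tw).
- by rewrite (tUU tw) // i0 ltn_ord.
- by have := ltn_ord i; rewrite i0 => h; rewrite (tU00 tw).
- by have := ltn_ord i'; rewrite i0 i'1 => h; rewrite (tU101 tw).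
case/orP: ii' => h; first by rewrite (tUcomm tw) // ltn_ord.
by rewrite [RHS](tUcomm tw) // ltn_ord.
Qed.

Definition tower_rep j : representation (@blob_rel k q m (lev j)) :=
  Representation (@tower_rel j).

End TowerRep.

Section HalfDiagrams.
Variables (k : fieldType) (q : k) (m : int).
Hypotheses (q_neq0 : q != 0) (q4 : q ^+ 4 != 1) (qm : qint q m != 0).
Variables (a b : nat).
Hypothesis ab0 : a = 0 \/ b = 0.
Local Notation R := {poly k}.
Local Notation l := (a + b)%N.
Local Notation lev := (lev l).
Local Notation E := (weight_tens R a b).
Local Notation T j := (seq_sub (words a b j)).
Local Notation Q := (q%:P).
Local Notation Qi := (q^-1%:P).

(** For [GA = q^m] the coefficient [AL q^r - GA [r]] would be [[m-r]], which may be
    zero; the term ['X] prevents this. *)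
Local Notation AL := ((qint q m)%:P).
Local Notation GA := ((q ^ m)%:P - 'X).
Local Notation U := (@tens_U R Q Qi AL GA a b).
Local Notation C := (@tens_C R Q a b).
Local Notation v := (base_vec R a b).

Let qq : Q * Qi = 1. Proof. by rewrite -polyCM mulfV. Qed.

Lemma q_plus_inv : q + q^-1 != 0.
Proof.
apply: contra q4; rewrite addr_eq0 => /eqP e.
have q2 : q ^+ 2 = -1 by rewrite expr2 {2}e mulrN mulfV.
by rewrite (exprM q 2 2) q2 sqrrN expr1n.
Qed.

Lemma qint2 : qint q 2 = q + q^-1.
Proof.
apply: (mulIf (q_neq_inv q_neq0 q4)); rewrite /qint divfK ?q_neq_inv //.
by rewrite (_ : 2%R = 2%:Z) // -invr_expz -exprnP expr2; field.
Qed.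

Lemma qint_pred : q * qint q m - q ^ m = qint q (m - 1).
Proof.
rewrite /qint opprB [1 - m]addrC !expfzDr // expr1z exprN1.
have h := q_neq_inv q_neq0 q4.
by apply: (mulIf h); rewrite mulrBl mulrA !divfK //; field.
Qed.

Let dlK : (- (q + q^-1)^-1)%:P * - (Q + Qi) = 1.
Proof. by rewrite -polyCD -polyCN -polyCM mulrNN mulVf ?q_plus_inv. Qed.

Let generic r : (0 < r)%N -> AL * Q ^+ r - GA * qn Q Qi r != 0.
Proof.
move=> r0; have [c qnE] : exists c, qn Q Qi r = c%:P.
  elim: r {r0} => [|r [c /= ->]]; first by exists 0.
  by exists (q ^+ r + q^-1 * c); rewrite polyCD polyCM polyC_exp.
have -> : AL * Q ^+ r - GA * qn Q Qi r =
    (qint q m * q ^+ r - q ^ m * c)%:P + c%:P * 'X.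
  by rewrite qnE polyCB !polyCM polyC_exp; ring.
apply/eqP => e; have := congr1 (fun p : R => p`_1) e.
rewrite coefD coefC coefMX coefC coef0 add0r /= => c0.
move: e; rewrite c0 mulr0 subr0 mul0r addr0 => /eqP.
by rewrite polyC_eq0 mulf_eq0 (negbTE qm) expf_eq0 (negbTE q_neq0) andbF.
Qed.

Let tw := deformed_tower AL GA qq ab0.
Local Notation span := (@diag_span R a b E U C v _).
Local Notation diag_vec := (@diag_vec l E U C v).

Definition beta j (p : E j) : E j := \sum_t p t *: diag_vec j (val t).

Lemma beta_lin j : linear (@beta j).
Proof.
move=> c x y; rewrite /beta scaler_sumr -big_split; apply: eq_bigr => t _ /=.
by rewrite !ffunE scalerDl [in RHS]scalerA.
Qed.
HB.instance Definition _ j :=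
  GRing.isLinear.Build R (E j) (E j) *:%R (@beta j) (@beta_lin j).

Lemma span_beta j (x : E j) : span x <-> exists p, beta p = x.
Proof.
split=> [/diag_span_sum[p ->]|[p <-]].
  by exists [ffun t => p t]; apply: eq_bigr => t _; rewrite ffunE.
rewrite /beta; elim/big_ind: _ => [|y z|t _]; [exact: diag_span0 | exact: diag_spanD |].
exact/diag_spanZ/diag_span_diag_vec/word_val.
Qed.

Lemma beta_commensurable j : exists (g : {linear E j -> E j}) (d : R),
  [/\ d != 0, forall x, beta (g x) = d *: x & forall x, g (beta x) = d *: x].
Proof.
apply: (@endo_commensurable R (T j) (@beta j)) => t.
have [p p0 /span_beta[c cE]] := sat_unitv qq dlK ab0 generic (word_val t).
by exists p => //; exists c; apply: etrans cE _; congr (_ *: _).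
Qed.

Lemma beta_inj j : injective (@beta j).
Proof.
have [g [d [d0 _ gb]]] := beta_commensurable j.
move=> x y /(congr1 g); rewrite !gb => e; apply/ffunP => t.
by apply: (mulfI d0); have := congr1 (fun z : E j => z t) e; rewrite /= !ffunE.
Qed.

(** Coordinates with respect to the half-diagrams; the value [0] outside their span
    is a default. *)
Definition hcoord j (x : E j) : E j :=
  if pselect (exists p, beta p = x) is left h then projT1 (cid h) else 0.

Lemma hcoordK j (x : E j) : span x -> beta (hcoord x) = x.
Proof.
by move=> /span_beta h; rewrite /hcoord; case: pselect => // h'; case: cid.
Qed.

Lemma betaK j (p : E j) : hcoord (beta p) = p.
Proof. by apply: beta_inj; apply: hcoordK; apply/span_beta; exists p. Qed.

(** For [i] out of range [U i] need not preserve the span; the value [0] makes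
    [latt_U j i] linear for all [i]. *)
Definition latt_U j i (p : E j) : E j := if (i < lev j)%N then hcoord (U i (beta p)) else 0.
Definition latt_C j (p : E j) : E j.+1 := hcoord (C (beta p)).

Let span_b j (p : E j) : span (beta p).
Proof. by apply/span_beta; exists p. Qed.

Lemma beta_latt_U j i (p : E j) : (i < lev j)%N -> beta (latt_U i p) = U i (beta p).
Proof. by move=> lti; rewrite /latt_U lti; apply/hcoordK/(U_diag_span tw dlK (base_pos ab0)). Qed.

Let span_C j (x : E j) : span x -> span (C x).
Proof.
move=> sx; rewrite -(cup_top l U C x); apply: (cup_diag_span tw dlK (base_pos ab0)) => //.
Qed.

Lemma beta_latt_C j (p : E j) : beta (latt_C p) = C (beta p).
Proof. exact/hcoordK/span_C. Qed.

Definition half_space j : vectType k := {ffun T j -> k^o}.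

Definition ev0 j (p : E j) : half_space j := [ffun t => (p t).[0]].
Definition clift j (y : half_space j) : E j := [ffun t => (y t)%:P].
Definition half_U j i (y : half_space j) : half_space j := ev0 (latt_U i (clift y)).
Definition half_C j (y : half_space j) : half_space j.+1 := ev0 (latt_C (clift y)).

Lemma ev0_lin j c (p p' : E j) : ev0 (c *: p + p') = c.[0] *: ev0 p + ev0 p'.
Proof. by apply/ffunP => t; rewrite !ffunE hornerD hornerM. Qed.

Lemma ev0D j (p p' : E j) : ev0 (p + p') = ev0 p + ev0 p'.
Proof. by rewrite -[p]scale1r ev0_lin hornerC !scale1r. Qed.

Lemma ev0Z j c (p : E j) : ev0 (c *: p) = c.[0] *: ev0 p.
Proof. by apply/ffunP => t; rewrite !ffunE hornerM. Qed.

Lemma cliftK j (y : half_space j) : ev0 (clift y) = y.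
Proof. by apply/ffunP => t; rewrite !ffunE hornerC. Qed.

Lemma ev0_eq0 j (p : E j) : ev0 p = 0 <-> exists p', p = 'X *: p'.
Proof.
split=> [/ffunP e|[p' ->]]; last by rewrite ev0Z hornerX scale0r.
have /choice[p' p'E] t : exists p', p t = 'X * p'.
  have /factor_theorem[p' ->] : root (p t) 0 by rewrite /root; have := e t; rewrite !ffunE => ->.
  by exists p'; rewrite subr0 mulrC.
by exists [ffun t => p' t]; apply/ffunP => t; rewrite !ffunE p'E.
Qed.

Lemma ev0_clift j (p : E j) : exists p', p = 'X *: p' + clift (ev0 p).
Proof.
have [p' e] : exists p', p - clift (ev0 p) = 'X *: p'.
  apply/ev0_eq0; rewrite -[p]scale1r -scaleN1r addrC ev0_lin !scale1r cliftK.
  by rewrite hornerN hornerC scaleN1r addNr.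
by exists p'; rewrite -e subrK.
Qed.

Lemma latt_U_lin j i : linear (@latt_U j i).
Proof.
move=> c x y; have [lti|lti] := boolP (i < lev j)%N; last first.
  by rewrite /latt_U (negbTE lti) scaler0 addr0.
by apply: beta_inj; rewrite beta_latt_U // !beta_lin (tU_lin tw) !beta_latt_U.
Qed.

Lemma latt_C_lin j : linear (@latt_C j).
Proof.
by move=> c x y; apply: beta_inj; rewrite beta_latt_C !beta_lin (tC_lin tw) !beta_latt_C.
Qed.

Lemma half_UE j i (p : E j) : half_U i (ev0 p) = ev0 (latt_U i p).
Proof.
have [p' {2}->] := ev0_clift p.
by rewrite latt_U_lin ev0_lin hornerX scale0r add0r.
Qed.

Lemma half_CE j (p : E j) : half_C (ev0 p) = ev0 (latt_C p).
Proof.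
have [p' {2}->] := ev0_clift p.
by rewrite latt_C_lin ev0_lin hornerX scale0r add0r.
Qed.

Lemma ev0_clift_lin j c (x y : half_space j) :
  c *: x + y = ev0 (c%:P *: clift x + clift y).
Proof. by rewrite ev0_lin hornerC !cliftK. Qed.

Lemma half_U_lin j i : linear (@half_U j i).
Proof. by move=> c x y; rewrite ev0_clift_lin half_UE latt_U_lin ev0_lin hornerC. Qed.

Lemma half_C_lin j : linear (@half_C j).
Proof. by move=> c x y; rewrite ev0_clift_lin half_CE latt_C_lin ev0_lin hornerC. Qed.

(** The relations hold in the tensor space, hence in the lattice of half-diagrams, on
    which [beta] is injective, hence modulo ['X]. *)
Lemma half_diagram_tower : tower a b (N := half_space) (@half_U) (@half_C) (ev0 (hcoord v))
  (- qint q 2) (- qint q m) (qint q (m - 1)).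
Proof.
have betaZ j : scalable (@beta j) := scalable_linear (@beta_lin j).
have vK : beta (hcoord v) = v.
  apply/hcoordK/(diag_span_diag_vec (j := 0) U C v (s := nseq a true ++ nseq b false)).
  by rewrite /word !count_cat !count_nseq /= !mul0n !mul1n !addn0 !eqxx.
have sur j (y : half_space j) : exists p, y = ev0 p by exists (clift y); rewrite cliftK.
have := tower_descent tw betaZ beta_inj beta_latt_U beta_latt_C vK ev0Z sur
  (fun j i p _ => half_UE i p) half_CE (erefl _) half_U_lin half_C_lin.
have -> : (- (Q + Qi)).[0] = - qint q 2 by rewrite hornerN hornerD !hornerC qint2.
have -> : (- AL).[0] = - qint q m by rewrite hornerN hornerC.
suff -> : (Q * AL - GA).[0] = qint q (m - 1) by [].
by rewrite -qint_pred hornerD hornerM !hornerN hornerD hornerN hornerX !hornerC subr0.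
Qed.

End HalfDiagrams.

Section Reductions.
Variables (k : fieldType) (q : k) (m : int).
Hypotheses (q_neq0 : q != 0) (q4 : q ^+ 4 != 1) (qm : qint q m != 0).
Variables (a b : nat).
Hypothesis ab0 : a = 0 \/ b = 0.
Local Notation R := {poly k}.
Local Notation l := (a + b)%N.
Local Notation lev := (lev l).
Local Notation E := (weight_tens R a b).
Local Notation T j := (seq_sub (words a b j)).
Local Notation Q := (q%:P).
Local Notation Qi := (q^-1%:P).
Local Notation AL := ((qint q m)%:P).
Local Notation GA := ((q ^ m)%:P - 'X).
Local Notation U := (@tens_U R Q Qi AL GA a b).
Local Notation lam := (b%:Z - a%:Z).
Variable j : nat.
Local Notation n := (lev j).
Local Notation M := (Mmod m q_neq0 q4 n lam).

Lemma horner_uF i (g : seq bool -> R) s :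
  (uF Q Qi i g s).[0] = uf q i (fun s => (g s).[0]) s.
Proof.
rewrite /uF /uf /rf; case: nth; case: nth;
  rewrite ?(hornerD, hornerN, hornerM, hornerC); ring.
Qed.

Lemma horner_yF (g : seq bool -> R) s :
  (yF Q Qi g s).[0] = yf q (fun s => (g s).[0]) s.
Proof.
elim: s g => [|x s IH] g /=; first by rewrite horner0.
by rewrite hornerD !hornerM IH; case: x; rewrite ?hornerC ?mul0r ?mul1r.
Qed.

Lemma horner_u0F (g : seq bool -> R) s :
  (u0F Q Qi AL GA g s).[0] = u0f q m (fun s => (g s).[0]) s.
Proof.
case: s => [|[] s] /=; rewrite ?horner0 //.
rewrite hornerD !hornerN !hornerM hornerN hornerD hornerN hornerX !hornerC horner_yF subr0.
by rewrite /qint /lambda1 /lambda2; ring.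
Qed.

Definition evV (g : E j) : tens k n := [ffun s : n.-tuple bool => (ext g s).[0]].

Lemma hat_evV g : hat (evV g) = fun s => (ext g s).[0].
Proof.
apply: (@hat_ind k n) => s; first by rewrite hatE ffunE.
move=> hs; rewrite hat_out // ext_supp ?horner0 //.
by apply: contra hs => /word_size ->; rewrite levE.
Qed.

Lemma evV_tens_U (i : 'I_n) g : evV (U i g) = Uop q m i (evV g).
Proof.
apply: (@hat_inj k n); rewrite hat_U ?(q_neq_inv q_neq0 q4) // !hat_evV ext_tens_U.
apply/funext => s; case: i => [[|i] lti] /=; last by rewrite horner_uF.
by rewrite horner_u0F.
Qed.

Lemma word_weight (s : n.-tuple bool) : (weight s == lam) = word a b j s.
Proof.
have e : (count_mem true s + count_mem false s = l + j.*2)%N.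
  transitivity (size s); last by rewrite size_tuple levE.
  rewrite -(count_predC (pred1 true)); congr addn.
  by apply: eq_count; case.
by rewrite /weight /word; apply/eqP/andP => [wE|[/eqP wt /eqP wf]]; [split |]; lia.
Qed.

Fact evV_wspace g : evV g \in wspace k n lam.
Proof.
apply/wspaceP => s; rewrite word_weight ffunE => ws.
by rewrite ext_supp // horner0.
Qed.

Definition evM (g : E j) : M := @WeightMod _ _ _ q_neq0 q4 n lam (evV g) (evV_wspace g).

Lemma evV_lin c g h : evV (c *: g + h) = c.[0] *: evV g + evV h.
Proof.
by apply/ffunP => s; rewrite !ffunE ext_lin mul1r hornerD hornerM.
Qed.

(** At ['X = 0] the deformed operators are the given ones. *)
Lemma evM_reduction : reduction (fun i : 'I_n => U i) evM.
Proof.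
split.
- move=> x y; apply: val_inj; rewrite /= -[x]scale1r evV_lin hornerC !scale1r //.
- move=> c x; apply: val_inj => /=.
  rewrite -[c%:P *: x]addr0 evV_lin hornerC (_ : evV 0 = 0) ?addr0; last first.
    by apply/ffunP => s; rewrite !ffunE /ext; case: insub => [t|]; rewrite ?ffunE horner0.
  by rewrite [RHS]repmod_scaleE.
- move=> i x; apply: val_inj => /=; rewrite evV_tens_U.
  by rewrite [RHS]repmod_scaleE.
- move=> y; exists (clift [ffun t => hat (weight_val y : tens k n) (val t)]).
  apply: val_inj => /=; apply/ffunP => s; rewrite ffunE.
  have /wspaceP/(_ s) := valP y; rewrite word_weight.
  have [ws _|ws /(_ isT) ->] := boolP (word a b j s); last by rewrite ext_supp ?horner0.
  have sw : val s \in words a b j by rewrite mem_words.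
  by rewrite -[val s]/(val (SeqSub sw)) extE !ffunE hornerC -hatE.
move=> x; rewrite -ev0_eq0; split=> [/(congr1 val)/ffunP e|/ffunP e].
  apply/ffunP => t; rewrite !ffunE.
  have st : size (val t) == n by rewrite size_val.
  by have := e (Tuple st); rewrite !ffunE /= extE.
apply: val_inj; apply/ffunP => s; rewrite !ffunE /ext; case: insub => [t|]; rewrite ?horner0 //.
by have := e t; rewrite !ffunE.
Qed.

Lemma half_diagram_reduction :
  reduction (fun i : 'I_n => @latt_U k q m a b j i)
    (@ev0 k a b j : _ -> repmod (tower_rep (half_diagram_tower q_neq0 q4 qm ab0) j)).
Proof.
split.
- exact: ev0D.
- by move=> c x; rewrite [RHS]repmod_scaleE /= ev0Z hornerC.
- move=> i x; rewrite [RHS]repmod_scaleE /=.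
  by rewrite -(half_UE q_neq0 q4 qm ab0).
- by move=> y; exists (clift y); exact: cliftK.
- exact: ev0_eq0.
Qed.

Lemma weight_tens_torsion (x : E j) : 'X *: x = 0 -> x = 0.
Proof.
move=> /ffunP e; apply/ffunP => t; have := e t; rewrite !ffunE => /eqP.
by rewrite mulf_eq0 polyX_eq0 => /eqP.
Qed.

(** Both modules are reductions of lattices between which [beta] is an isomorphism up
    to torsion. *)
Lemma tensor_half_diagram_multiplicity (L : lmodType (blob q m n)) :
  exists c, has_multiplicity M L c /\
    has_multiplicity (repmod (tower_rep (half_diagram_tower q_neq0 q4 qm ab0) j)) L c.
Proof.
have [g [d [d0 bg gb]]] := beta_commensurable q_neq0 q4 qm ab0 j.
apply: (reduction_multiplicity (u := fun i : 'I_n => @U j i)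
  (c := fun i : 'I_n => @latt_U k q m a b j i) (b := @beta k q m a b j) (g := g) (d := d)
  _ _ bg gb d0 _ _ evM_reduction half_diagram_reduction).
- exact: weight_tens_torsion.
- exact: weight_tens_torsion.
- by move=> i; exact: tens_U_lin.
- by move=> i x; rewrite -beta_latt_U.
- by move=> S T; exact: chain_exists.
Qed.

End Reductions.

(** * Globalisation *)

Section Globalisation.
Variables (k : fieldType) (q : k) (m : int).
Hypothesis q2 : qint q 2 != 0.
Local Notation b_ := (blob q m).

Lemma pconstMr X (rel : term k X -> term k X -> Prop) c d :
  pconst rel (c * d) = pconst rel c * pconst rel d.
Proof. exact: pconstM. Qed.

Lemma pconst_comm X (rel : term k X -> term k X -> Prop) c x :
  pconst rel c * x = x * pconst rel c.
Proof. exact: pconstC. Qed.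

Lemma pconst1 X (rel : term k X -> term k X -> Prop) : pconst rel 1 = 1.
Proof. by []. Qed.

(** Maps that behave like the insertion of a cup at the end. *)
Record cup_map p (N : lmodType (b_ p)) (X : lmodType (b_ p.+2)) (c : N -> X) : Prop :=
  CupMap {
    cmD : {morph c : x y / x + y};
    cmC : forall a y, c (bconst q m p a *: y) = bconst q m p.+2 a *: c y;
    cm_top : forall y, bgen q m (@ord_max p.+1) *: c y = bconst q m p.+2 (- qint q 2) *: c y;
    cmU : forall (i : 'I_p) y,
      bgen q m (widen_ord (leq_addl 2 p) i) *: c y = c (bgen q m i *: y) }.

Definition cup_universal p (N : lmodType (b_ p)) (N' : lmodType (b_ p.+2)) (C : N -> N') :=
  [/\ cup_map C,
      forall P : N' -> Prop, submodule P -> (forall y, P (C y)) -> forall x, P x &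
      forall (X : lmodType (b_ p.+2)) (c : N -> X), cup_map c ->
        exists h : {linear N' -> X}, forall y, h (C y) = c y].

Lemma bgen_sqr n (i : 'I_n) : (0 < i)%N ->
  bgen q m i * bgen q m i = bconst q m n (- qint q 2) * bgen q m i.
Proof.
move=> i0; rewrite /bgen /bconst /pgen /pconst -!pclassM; apply/pclassP/pc_rel.
exact: br_sqr.
Qed.

Lemma bgen_comm n (i j : 'I_n) : (i.+2 <= j)%N || (j.+2 <= i)%N ->
  bgen q m i * bgen q m j = bgen q m j * bgen q m i.
Proof.
by move=> ij; rewrite /bgen /pgen -!pclassM; apply/pclassP/pc_rel/br_comm.
Qed.

Section Step.
Variables (p : nat) (N : lmodType (b_ p)).
Local Notation e := (idem q m p).

Lemma idem_top : bgen q m (@ord_max p.+1) * e = bconst q m p.+2 (- qint q 2) * e.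
Proof.
rewrite /idem mulrA -[_ * bconst _ _ _ _]pconst_comm -mulrA bgen_sqr // !mulrA.
by congr (_ * _); exact: pconst_comm.
Qed.

Lemma idem_idem : e * e = e.
Proof.
rewrite {1}/idem -mulrA idem_top mulrA -pconstMr mulrNN mulVf //.
by rewrite pconst1 mul1r.
Qed.

Lemma idem_comm (i : 'I_p) : e * bgen q m (widen_ord (leq_addl 2 p) i) =
  bgen q m (widen_ord (leq_addl 2 p) i) * e.
Proof.
rewrite /idem -mulrA bgen_comm; first by rewrite mulrA pconst_comm mulrA.
by rewrite /= !ltnS ltn_ord orbT.
Qed.

Lemma idem_in : (e : (b_ p.+2)^o) \in lideal e.
Proof. by apply/lidealP; exists 1; rewrite mul1r. Qed.

Definition ideme : lideal_mod e := LIdeal idem_in.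

Definition Gcup (y : N) : Gfun N := tclass (@corner_bal_scale k q m p N) [:: (ideme, y)].

Let tclassD s t : tclass (@corner_bal_scale k q m p N) (s ++ t) =
  tclass (@corner_bal_scale k q m p N) s + tclass (@corner_bal_scale k q m p N) t :> Gfun N.
Proof. exact: tclass_cat. Qed.

Let tclassZ x s : x *: (tclass (@corner_bal_scale k q m p N) s : Gfun N) =
  tclass (@corner_bal_scale k q m p N) (tmap x s).
Proof. by rewrite [RHS]tclass_map. Qed.

Let corner_e (t : term k 'I_p) : corner q m t * e = corner q m t.
Proof.
elim: t => [a|i|s IHs t IHt|s IHs t IHt] /=; last by rewrite -mulrA IHt.
- by rewrite -mulrA idem_idem.
- by rewrite -mulrA idem_idem.
- by rewrite mulrDl IHs IHt.
Qed.

Let e_corner (t : term k 'I_p) : e * corner q m t = corner q m t.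
Proof.
elim: t => [a|i|s IHs t IHt|s IHs t IHt] /=; last by rewrite mulrA IHs.
- by rewrite mulrA -[e * _]pconst_comm -mulrA idem_idem.
- by rewrite [LHS]mulrA [e * (_ * _)]mulrA idem_idem.
- by rewrite mulrDr IHs IHt.
Qed.

Lemma Gcup_corner (t : term k 'I_p) y :
  Gcup ((pclass _ t : b_ p) *: y) = corner q m t *: Gcup y.
Proof.
rewrite tclassZ; apply/tclassP/tc_sym/tc_bal; exists t; split=> //=.
exact: etrans (corner_e t) (esym (e_corner t)).
Qed.

Let e_Gcup y : e *: Gcup y = Gcup y.
Proof.
rewrite tclassZ; congr tclass; congr [:: (_, _)]; apply: val_inj.
exact: idem_idem.
Qed.

Lemma Gcup_map : cup_map Gcup.
Proof.
split.
- by move=> y y'; rewrite -tclassD; apply/tclassP/tc_addr.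
- by move=> a y; rewrite Gcup_corner /= -scalerA e_Gcup.
- move=> y; rewrite !tclassZ; congr tclass; congr [:: (_, _)]; apply: val_inj.
  exact: idem_top.
- move=> i y; rewrite Gcup_corner /= idem_comm.
  by rewrite -scalerA e_Gcup -scalerA e_Gcup.
Qed.

Lemma Gcup_gen (P : Gfun N -> Prop) : submodule P -> (forall y, P (Gcup y)) -> forall x, P x.
Proof.
move=> [P0 PD PZ] PC; elim/tclass_ind; elim=> [|[x y] s IH]; first exact: P0.
rewrite -cat1s tclassD; apply: (PD _ _ _ IH).
have /lidealP[z zE] := valP x.
rewrite (_ : tclass _ _ = z *: Gcup y); first exact/PZ/PC.
rewrite tclassZ; congr tclass; congr [:: (_, _)]; apply: val_inj.
by rewrite zE.
Qed.

Section Universal.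
Variables (X : lmodType (b_ p.+2)) (c : N -> X).
Hypothesis cm : cup_map c.

Let e_c y : e *: c y = c y.
Proof.
rewrite /idem -scalerA (cm_top cm) scalerA -pconstMr mulrNN mulVf //.
by rewrite scale1r.
Qed.

Let corner_c (t : term k 'I_p) y : corner q m t *: c y = c ((pclass _ t : b_ p) *: y).
Proof.
elim: t y => [a|i|s IHs t IHt|s IHs t IHt] y /=.
- by rewrite -scalerA e_c -(cmC cm).
- by rewrite -scalerA e_c -scalerA (cmU cm) e_c.
- by rewrite scalerDl IHs IHt pclassD scalerDl (cmD cm).
- by rewrite -scalerA IHt IHs pclassM scalerA.
Qed.

Let fsum (s : seq (lideal_mod e * N)) : X :=
  \sum_(u <- s) (lideal_val u.1 : b_ p.+2) *: c u.2.

Let c0 : c 0 = 0.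
Proof. by apply: (addrI (c 0)); rewrite -(cmD cm) !addr0. Qed.

Let fsum_cong s t : tcong (@corner_bal k q m p N) s t -> fsum s = fsum t.
Proof.
rewrite /fsum; elim=> {s t}.
- by move=> u w [t [e1 e2]]; rewrite !big_seq1 e1 e2 -corner_c scalerA.
- by move=> x x' y; rewrite !big_cons !big_nil !addr0 /= scalerDl.
- by move=> x y y'; rewrite !big_cons !big_nil !addr0 /= (cmD cm) scalerDr.
- by move=> y; rewrite big_seq1 big_nil /= scale0r.
- by move=> s t; rewrite !big_cat /= addrC.
- by move=> s s' t t' _ e1 _ e2; rewrite !big_cat /= e1 e2.
- by [].
- by move=> s t _ ->.
- by move=> s t u _ -> _ ->.
Qed.

Let h (x : Gfun N) : X := fsum (trepr x).

Let hE s : h (tclass (@corner_bal_scale k q m p N) s) = fsum s.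
Proof. exact/fsum_cong/trepr_class. Qed.

Let h_lin : linear h.
Proof.
move=> a; elim/tclass_ind => s; elim/tclass_ind => t.
rewrite tclassZ -tclassD !hE /fsum big_cat /= big_map scaler_sumr; congr (_ + _).
by apply: eq_bigr => u _ /=; rewrite scalerA.
Qed.

Lemma Gcup_lift : exists f : {linear Gfun N -> X}, forall y, f (Gcup y) = c y.
Proof.
pose L := GRing.isLinear.Build _ _ _ _ h h_lin.
pose f : {linear Gfun N -> X} := HB.pack h L.
by exists f => y; rewrite /= hE /fsum big_seq1 e_c.
Qed.

End Universal.

(** [b e (x) N] is generated by the elements [e (x) y], and [x (x) y |-> x c(y)] is
    well defined for a cup map [c] because the corner [e b e] acts on [c(y)] as the
    smaller algebra acts on [y]. *)
Lemma Gfun_universal : cup_universal Gcup.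
Proof. by split; [exact: Gcup_map | exact: Gcup_gen | exact: Gcup_lift]. Qed.

End Step.
End Globalisation.

Section Delta20.
Variables (k : fieldType) (q : k) (m : int).
Hypothesis q2 : qint q 2 != 0.
Local Notation b_ := (blob q m).
Local Notation u1 := (bgen q m (Ordinal (isT : (1 < 2)%N))).
Local Notation N := (onedim_plus q m 0).

Lemma Delta20_in (y : k) : (bconst q m 2 y * u1 : (b_ 2)^o) \in lideal u1.
Proof. by apply/lidealP; exists (bconst q m 2 y). Qed.

Definition cup20 (y : N) : Delta2_0 q m := LIdeal (Delta20_in y).

Let constZ a (y : N) : bconst q m 0 a *: y = (a * (y : k)) :> k.
Proof. exact: (@repmod_scaleE k _ _ (onedim_rep 0 (@hc_zero k q m)) (TConst a) y). Qed.

Lemma cup20_map : cup_map cup20.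
Proof.
split=> [y y'|a y|y|[] //].
- by apply: val_inj; rewrite /= -mulrDl; congr (_ * _); exact: pconstD.
- apply: val_inj; change (bconst q m 2 (bconst q m 0 a *: y : k) * u1 =
    bconst q m 2 a * (bconst q m 2 y * u1)).
  by rewrite constZ mulrA; congr (_ * _); exact: pconstMr.
apply: val_inj; change (bgen q m (@ord_max 1) * (bconst q m 2 y * u1) =
  bconst q m 2 (- qint q 2) * (bconst q m 2 y * u1)).
have -> : @ord_max 1 = Ordinal (isT : (1 < 2)%N) by apply: val_inj.
rewrite mulrA -[_ * bconst _ _ _ _]pconst_comm -mulrA bgen_sqr // !mulrA.
by congr (_ * _); exact: pconst_comm.
Qed.

(** The left ideal [b_2 U_1] plays the role of [G N] for the trivial module [N = k] of
    [b_0 = k]. As [U_1 c(1) = - [2] c(1)], the map [x |-> - [2]^-1 x c(1)] sends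
    [z U_1] to [z c(1)]. *)
Lemma cup20_universal : cup_universal cup20.
Proof.
split; first exact: cup20_map.
  move=> P [_ _ PZ] PC x; have /lidealP[z zE] := valP x.
  rewrite (_ : x = z *: cup20 1); first exact/PZ/PC.
  by apply: val_inj; rewrite /= zE; congr (_ * _); rewrite /bconst pconst1 mul1r.
move=> X c cm.
pose h0 (x : Delta2_0 q m) : X :=
  bconst q m 2 (- (qint q 2)^-1) *: ((lideal_val x : b_ 2) *: c (1 : k)).
have h_lin : linear h0.
  move=> a x y; rewrite /h0 /= scalerDl scalerDr; congr (_ + _).
  have swap_const (z : b_ 2) d : bconst q m 2 d * (a * z) = a * (bconst q m 2 d * z).
    by rewrite mulrA [bconst _ _ _ _ * a]pconst_comm -mulrA.
  by rewrite -[a *: lideal_val x]/(a * lideal_val x) !scalerA swap_const.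
pose L := GRing.isLinear.Build _ _ _ _ h0 h_lin.
pose h : {linear Delta2_0 q m -> X} := HB.pack h0 L.
exists h => y; rewrite /= /h0 /=.
have -> : c y = bconst q m 2 y *: c (1 : k).
  by rewrite -(cmC cm); congr c; rewrite constZ mulr1.
have top := cm_top cm (1 : k).
have -> : u1 = bgen q m (@ord_max 1) by congr bgen; apply: val_inj.
rewrite -scalerA top !scalerA; congr (_ *: _).
by rewrite -!pconstMr mulrAC mulrNN mulVf // mul1r.
Qed.

End Delta20.

(** * Standard modules *)

Section Standard.
Variables (k : fieldType) (q : k) (m : int).
Local Notation b_ := (blob q m).

(** The recursion of [Delta] on the number of cups, free of case distinctions on
    [lam]; [sgn] tells which of the two one-dimensional modules is at the bottom. *)
Fixpoint std (sgn : bool) (l j : nat) : lmodType (b_ (lev l j)) :=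
  if j is j'.+1 then Delta_step (std sgn l j')
  else if sgn then onedim_minus q m l else onedim_plus q m l.

Lemma Delta_std (a b j : nat) : a = 0 \/ b = 0 ->
  Delta q m (lev (a + b) j) (b%:Z - a%:Z) = std (0 < a)%N (a + b) j.
Proof.
move=> ab0; elim: j => [|j IH].
  have -> : forall n lam, Delta q m n lam = if lam == n%:Z then onedim_plus q m n
      else if lam == - n%:Z then onedim_minus q m n
      else match n return lmodType (b_ n) with
           | 0 => onedim_plus q m 0
           | 1 => onedim_plus q m 1
           | p.+2 => Delta_step (Delta q m p lam)
           end by case.
  rewrite [lev _ _]/= [std _ _ _]/=; case: ifP => [/eqP h|/eqP h1].
    by have -> : (0 < a)%N = false by case: ab0 => e; lia.
  by case: ifP => [/eqP h|/eqP h2]; [have -> : (0 < a)%N by lia | case: ab0; lia].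
rewrite /= -IH; case: ifP => [/eqP|_]; first by have := levE (a + b) j; case: ab0; lia.
by case: ifP => // /eqP; have := levE (a + b) j; case: ab0; lia.
Qed.

Hypothesis q2 : qint q 2 != 0.

Lemma std_cup sgn l j : (l = 0 -> sgn = false) ->
  exists C : std sgn l j -> std sgn l j.+1, cup_universal C.
Proof.
case: j => [|j] h; last by exists (@Gcup _ _ _ _ (std sgn l j.+1)); exact: Gfun_universal.
case: l h => [/(_ erefl) ->|l _].
  by exists (@cup20 k q m); exact: cup20_universal.
by exists (@Gcup _ _ _ _ (std sgn l.+1 0)); exact: Gfun_universal.
Qed.

End Standard.

(** Restriction of scalars to the ground field. *)
Section Restriction.
Variables (k : fieldType) (X : Type) (rel : term k X -> term k X -> Prop).
Variable M : lmodType (presented rel).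
Definition kmod : Type := M.
HB.instance Definition _ := GRing.Zmodule.on kmod.
Definition kmod_scale (c : k) (y : kmod) : kmod := pconst rel c *: (y : M).
Fact kmod_scaleA c d y : kmod_scale c (kmod_scale d y) = kmod_scale (c * d) y.
Proof. by rewrite /kmod_scale scalerA pconstMr. Qed.
Fact kmod_scale1 : left_id 1 kmod_scale.
Proof. by move=> y; rewrite /kmod_scale pconst1 scale1r. Qed.
Fact kmod_scaleDr : right_distributive kmod_scale +%R.
Proof. by move=> c x y; rewrite /kmod_scale scalerDr. Qed.
Fact kmod_scaleDl y : {morph kmod_scale^~ y : c d / c + d}.
Proof. by move=> c d; rewrite /kmod_scale -scalerDl; congr (_ *: _); exact: pconstD. Qed.
HB.instance Definition _ := GRing.Zmodule_isLmodule.Build k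
  kmod kmod_scaleA kmod_scale1 kmod_scaleDr kmod_scaleDl.
End Restriction.

Lemma has_multiplicity_iso (A : pzRingType) (M N L : lmodType A) (f : {linear M -> N}) c :
  bijective f -> has_multiplicity N L c -> has_multiplicity M L c.
Proof.
move=> [g fK gK] [r [F [[subF F0 Fr maxF] cF]]].
pose rho x y := f x = y.
have r0 : rho 0 0 by exact: linear0.
have rD x x' y y' : rho x y -> rho x' y' -> rho (x + x') (y + y').
  by rewrite /rho linearD => -> ->.
have rZ a x y : rho x y -> rho (a *: x) (a *: y) by rewrite /rho linearZ => <-.
have sur y : True -> exists x, rho x y by exists (g y); exact: gK.
have ker y : rho 0 y -> y = 0 by rewrite /rho linear0.
have FS i j : (i <= j <= r)%N -> forall y, F i y -> F j y.
  case/andP => le_ij le_jr y Fy; elim: j le_ij le_jr => [|j IH].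
    by rewrite leqn0 => /eqP <-.
  rewrite leq_eqVlt => /orP[/eqP <- //|lt_ij] lt_jr.
  by have [h _ _] := maxF _ lt_jr; apply/h/IH => //; exact: ltnW.
have F1 i y : (i <= r)%N -> y = 0 -> F i y by move=> ler ->; case: (subF i ler).
exists r, (fun i => pull rho (F i)); split; last first.
  rewrite -cF; apply: eq_card => i; rewrite !inE; apply: asbool_equiv_eq.
  have lei := ltnW (ltn_ord i); apply: iff_sym.
  apply: (pull_iso L r0 rD rZ (B' := fun y => y = 0) (B := fun=> True)) => //.
  - exact: subF.
  - exact: subF.
  - by move=> y; exact: F1.
  - by apply: FS; rewrite leqnSn ltn_ord.
split.
- by move=> i lei; apply: pull_submodule => //; exact: subF.
- move=> x; split=> [[y /F0 ->]|->]; last by exists 0 => //; exact/F0.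
  by rewrite /rho => fx; rewrite -(fK x) fx -(linear0 f) fK.
- by move=> x; exists (f x).
move=> i lti; have lei := ltnW lti.
apply: (pull_maximal r0 rD rZ (B' := fun y => y = 0) (B := fun=> True)) => //.
- exact: subF.
- exact: subF.
- by move=> y; exact: F1.
- exact: maxF.
Qed.

Lemma onedim_base (k : fieldType) (q : k) (m : int) n (d : k) (hd : d * d = - qint q m * d) :
  exists v : repmod (onedim_rep n hd), [/\
  forall i : 'I_n, bgen q m i *: v = bconst q m n (if i == 0%N :> nat then d else 0) *: v,
  forall x : repmod (onedim_rep n hd), exists c, x = bconst q m n c *: v &
  forall c, bconst q m n c *: v = 0 -> c = 0].
Proof.
have sc (t : term k 'I_n) (x : repmod (onedim_rep n hd)) :
  (pclass _ t : blob q m n) *: x = teval (rep_op (onedim_rep n hd)) t x.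
  exact: repmod_scaleE.
exists (1 : k); split=> [i|x|c].
- by rewrite /bgen /bconst /pgen /pconst !sc.
- by exists (x : k); rewrite /bconst /pconst sc /= /GRing.scale /= mulr1.
- by rewrite /bconst /pconst sc /= /GRing.scale /= mulr1.
Qed.

Section StandardTower.
Variables (k : fieldType) (q : k) (m : int).
Hypothesis q2 : qint q 2 != 0.
Variables (a b : nat).
Hypothesis ab0 : a = 0 \/ b = 0.
Local Notation l := (a + b)%N.
Local Notation lev := (lev l).
Local Notation D j := (std q m (0 < a)%N l j).

Let sgn0 : l = 0 -> (0 < a)%N = false.
Proof. by case: (a). Qed.

Definition stdN (j : nat) : lmodType k := kmod (D j).
Definition stdC j : stdN j -> stdN j.+1 := projT1 (cid (@std_cup k q m q2 (0 < a)%N l j sgn0)).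

Lemma stdCP j : cup_universal (@stdC j : D j -> D j.+1).
Proof. exact: (projT2 (cid (@std_cup k q m q2 (0 < a)%N l j sgn0))). Qed.

Definition stdU j i (y : stdN j) : stdN j :=
  if insub i is Some i' then bgen q m (i' : 'I_(lev j)) *: (y : D j) else 0.

Lemma stdUE j i (lti : (i < lev j)%N) (y : stdN j) :
  stdU i y = bgen q m (Ordinal lti) *: (y : D j).
Proof. by rewrite /stdU insubT. Qed.

Lemma stdZ j c (y : stdN j) : c *: y = bconst q m (lev j) c *: (y : D j).
Proof. by []. Qed.

Lemma std_base : exists v : D 0, [/\
  forall i : 'I_l, bgen q m i *: v =
    bconst q m l (if (i == 0%N :> nat) && (0 < a)%N then - qint q m else 0) *: v,
  forall x : D 0, exists c, x = bconst q m l c *: v &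
  forall c, bconst q m l c *: v = 0 -> c = 0].
Proof.
rewrite /=; case: ifP => _.
  have [v [vU vx v0]] := onedim_base l (hc_m q m).
  by exists v; split=> // i; rewrite andbT; exact: vU.
have [v [vU vx v0]] := onedim_base l (hc_zero q m).
by exists v; split=> // i; rewrite andbF; have := vU i; rewrite if_same.
Qed.

Definition stdv : stdN 0 := projT1 (cid std_base).

Lemma stdvP : [/\
  forall i : 'I_l, bgen q m i *: (stdv : D 0) =
    bconst q m l (if (i == 0%N :> nat) && (0 < a)%N then - qint q m else 0) *: stdv,
  forall x : D 0, exists c, x = bconst q m l c *: stdv &
  forall c, bconst q m l c *: (stdv : D 0) = 0 -> c = 0].
Proof. exact: (projT2 (cid std_base)). Qed.

Lemma bgen_rel n (s t : term k 'I_n) (N : lmodType (blob q m n)) (y : N) :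
  blob_rel q m s t -> (pclass (@blob_rel k q m n) s : blob q m n) *: y =
    (pclass (@blob_rel k q m n) t : blob q m n) *: y.
Proof. by move=> st; congr (_ *: _); apply/pclassP/pc_rel. Qed.

Lemma std_tower : tower a b (N := stdN) (@stdU) (@stdC) stdv
  (- qint q 2) (- qint q m) (qint q (m - 1)).
Proof.
split.
- move=> j i c x y; rewrite /stdU; case: insubP => [i' _ _|_]; last by rewrite scaler0 addr0.
  rewrite scalerDr; congr (_ + _).
  change (bgen q m i' *: (bconst q m (lev j) c *: (x : D j)) =
    bconst q m (lev j) c *: (bgen q m i' *: (x : D j))).
  by rewrite !scalerA; congr (_ *: _); apply: esym; exact: pconst_comm.
- move=> j c x y; have [cm _ _] := stdCP j.
  by rewrite (cmD cm) [in LHS]stdZ (cmC cm).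
- move=> j i y /andP[i0 lti]; rewrite !stdUE stdZ !scalerA -bgen_sqr //.
- move=> j y lti; rewrite !stdUE stdZ.
  have := bgen_rel (y : D j) (br_sqr0 q m (i := Ordinal lti) erefl).
  by rewrite !pclassM -!scalerA.
- move=> j i y i0 lt1; rewrite !(stdUE lt1) !(stdUE (ltnW lt1)).
  have := bgen_rel (y : D j) (br_adj q m (i := Ordinal (ltnW lt1)) (j := Ordinal lt1) i0 isT _).
  by rewrite !pclassM -!scalerA; apply; rewrite eqxx.
- move=> j i y i0 lt1; rewrite !(stdUE lt1) !(stdUE (ltnW lt1)).
  have := bgen_rel (y : D j) (br_adj q m (i := Ordinal lt1) (j := Ordinal (ltnW lt1)) isT i0 _).
  by rewrite !pclassM -!scalerA; apply; rewrite eqxx orbT.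
- move=> j y lt1; rewrite !(stdUE lt1) !(stdUE (ltnW lt1)) stdZ.
  have := bgen_rel (y : D j) (br_101 q m (i := Ordinal (ltnW lt1)) (j := Ordinal lt1) erefl erefl).
  by rewrite !pclassM -!scalerA.
- move=> j i i' y ii' lti'.
  have lti : (i < lev j)%N by apply: ltn_trans lti'; exact: ltnW.
  by rewrite !(stdUE lti) !(stdUE lti') !scalerA bgen_comm //= ii'.
- move=> j y; have [cm _ _] := stdCP j.
  rewrite (@stdUE j.+1 _ (ltnSn _)).
  have -> : Ordinal (ltnSn (lev j).+1) = ord_max by apply: val_inj.
  exact: cm_top cm y.
- move=> j i y lti; have [cm _ _] := stdCP j.
  rewrite (stdUE lti) (@stdUE j.+1 _ (leqW (leqW lti))).
  have -> : Ordinal (leqW (leqW lti)) = widen_ord (leq_addl 2 (lev j)) (Ordinal lti).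
    exact: val_inj.
  exact: cmU cm _ y.
move=> i lti; have [vU _ _] := stdvP.
by rewrite (@stdUE 0 _ lti) stdZ [LHS]vU.
Qed.

End StandardTower.

Section StandardHom.
Variables (k : fieldType) (q : k) (m : int).
Hypothesis q2 : qint q 2 != 0.
Variables (a b : nat).
Hypothesis ab0 : a = 0 \/ b = 0.
Local Notation l := (a + b)%N.
Local Notation lev := (lev l).
Local Notation D j := (std q m (0 < a)%N l j).
Local Notation diag_vecD := (diag_vec l (@stdU k q m a b) (@stdC k q m q2 a b) (stdv q m a b)).

Let dlK : - (qint q 2)^-1 * - qint q 2 = 1.
Proof. by rewrite mulrNN mulVf. Qed.

Let tw := std_tower m q2 a b.

Section Hom.
Variables (W : nat -> lmodType k) (half_U : forall j, nat -> W j -> W j).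
Variables (half_C : forall j, W j -> W j.+1) (wv : W 0).
Hypothesis twW : tower a b half_U half_C wv (- qint q 2) (- qint q m) (qint q (m - 1)).
Local Notation Wm j := (repmod (tower_rep twW j)).

Let X_gen j (i : 'I_(lev j)) (w : Wm j) : bgen q m i *: w = @half_U j i w.
Proof. exact: repmod_scaleE. Qed.

Let X_const j c (w : Wm j) : bconst q m (lev j) c *: w = c *: (w : W j).
Proof. exact: repmod_scaleE. Qed.

Let wCZ j c (x : W j) : half_C (c *: x) = c *: half_C x.
Proof. exact: (scalable_linear (@tC_lin _ _ _ _ _ _ _ _ _ _ twW j)). Qed.

Let wCD j (x y : W j) : half_C (x + y) = half_C x + half_C y.
Proof. by have := tC_lin twW 1 x y; rewrite !scale1r. Qed.

(** The base vectors of both towers are common eigenvectors of the generators with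
    the same eigenvalues. *)
Lemma std_hom0 (v : D 0) :
  (forall i : 'I_l, bgen q m i *: v =
    bconst q m l (if (i == 0%N :> nat) && (0 < a)%N then - qint q m else 0) *: v) ->
  (forall x : D 0, exists c, x = bconst q m l c *: v) ->
  (forall c, bconst q m l c *: v = 0 -> c = 0) ->
  exists h : {linear D 0 -> Wm 0}, h v = wv.
Proof.
move=> vU vx v0.
pose rho (x : D 0) (w : Wm 0) :=
  exists2 c, x = bconst q m l c *: v & w = bconst q m l c *: (wv : Wm 0).
have rD x x' w w' : rho x w -> rho x' w' -> rho (x + x') (w + w').
  move=> [c -> ->] [c' -> ->]; exists (c + c'); rewrite -scalerDl; congr (_ *: _);
  by apply: esym; exact: pconstD.
have rC c x w : rho x w -> rho (pconst _ c *: x) (pconst _ c *: w).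
  by move=> [d -> ->]; exists (c * d); rewrite scalerA; congr (_ *: _);
  apply: esym; exact: pconstMr.
have rU i x w : rho x w -> rho (pgen _ i *: x) (pgen _ i *: w).
  move=> [d -> ->]; set e := if (i == 0%N :> nat) && (0 < a)%N then - qint q m else 0.
  exists (d * e); rewrite scalerA -[_ * pconst _ d]pconst_comm -scalerA;
    rewrite /bconst pconstMr -[in RHS]scalerA; congr (_ *: _); first exact: vU.
  by rewrite [LHS]X_gen [RHS]X_const; exact: (tbase twW).
have rS := presented_rel_scale rD rC rU.
have r_inj x w w' : rho x w -> rho x w' -> w = w'.
  move=> [c xc ->] [d xd ->]; congr (bconst _ _ _ _ *: _); apply/eqP.
  rewrite -subr_eq0; apply/eqP/v0; rewrite /bconst.
  have cE : pconst (@blob_rel k q m l) c = pconst _ (c - d) + pconst _ d.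
    by rewrite -[in LHS](subrK d c); exact: pconstD.
  have -> : pconst (@blob_rel k q m l) (c - d) = pconst _ c - pconst _ d.
    by rewrite cE addrK.
  by rewrite scalerBl -[_ c *: v]xc -[_ d *: v]xd subrr.
have [h0 h0P] : {h0 : D 0 -> Wm 0 & forall x, rho x (h0 x)}.
  apply: choice => x; have [c xc] := vx x.
  by exists (bconst q m l c *: (wv : Wm 0)); exists c.
have h_lin : linear h0.
  by move=> c x y; apply: r_inj (h0P _) _; apply: rD => //; exact: rS.
pose L := GRing.isLinear.Build _ _ _ _ h0 h_lin.
pose h : {linear D 0 -> Wm 0} := HB.pack h0 L.
exists h; apply: r_inj (h0P _) _; exists 1; rewrite /bconst pconst1 ?scale1r //.
Qed.

(** Each insertion of a cup extends the homomorphism by the universal property. *)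
Lemma std_hom j : exists h : {linear D j -> Wm j},
  forall s, h (diag_vecD j s) = diag_vec l half_U half_C wv j s.
Proof.
elim: j => [|j [h hE]].
  have [vU vx v0] := stdvP q m a b.
  by have [h hv] := std_hom0 vU vx v0; exists h.
have [_ _ univ] := stdCP m q2 a b j.
have cm : @cup_map k q m (lev j) (D j) (Wm j.+1) (fun y => half_C (h y)).
  split.
  - by move=> x y; rewrite linearD; exact: wCD.
  - by move=> c y; rewrite linearZ /= [RHS]X_const -wCZ; congr half_C; exact: X_const.
  - by move=> y; rewrite [LHS]X_gen [RHS]X_const; exact: (tUC twW).
  move=> i y; have -> : h (bgen q m i *: y) = half_U i (h y) by rewrite linearZ; exact: X_gen.
  by rewrite [LHS]X_gen; apply: (tCU twW); exact: (ltn_ord i).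
have [h' h'C] := univ _ _ cm; exists h' => s.
have [] := @cup_morph l (stdN q m a b) W (@stdU k q m a b) half_U
  (@stdC k q m q2 a b) half_C j h h' (fun=> True) (pos s) (diag_vecD j (reduce s)) _ _ I (h'C _).
- by [].
- by move=> i z lti _; rewrite (stdUE lti) linearZ /= [LHS]X_gen.
by move=> _; rewrite hE.
Qed.

End Hom.

Lemma std_span j (x : stdN q m a b j) :
  diag_span a b (@stdU k q m a b) (@stdC k q m q2 a b) (stdv q m a b) x.
Proof.
have lvl0 (y : stdN q m a b 0) :
    diag_span a b (@stdU k q m a b) (@stdC k q m q2 a b) (stdv q m a b) y.
  have [_ vx _] := stdvP q m a b.
  have [c ->] := vx y; apply: (diag_spanZ c).
  apply: (diag_span_diag_vec _ _ _ (s := nseq a true ++ nseq b false)).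
  by rewrite /word !count_cat !count_nseq /= !mul0n !mul1n !addn0 !eqxx.
elim: j x => [|j IH] //.
have [_ gen _] := stdCP m q2 a b j; apply: gen => [|y].
  split=> [|x y|]; [exact: diag_span0 | exact: diag_spanD |].
  apply: presented_scale_closed => [x y|c x|i x dx]; [exact: diag_spanD | exact: diag_spanZ |].
  have -> : pgen _ i *: (x : D j.+1) = stdU i (x : stdN q m a b j.+1).
    by rewrite (@stdUE k q m a b j.+1 i (ltn_ord i)); congr (bgen _ _ _ *: _); apply: val_inj.
  exact: (U_diag_span tw dlK (base_pos ab0)).
rewrite -(cup_top l (@stdU k q m a b)); apply: (cup_diag_span tw dlK (base_pos ab0)) => //.
Qed.

End StandardHom.

Section Comparison.
Variables (k : fieldType) (q : k) (m : int).
Hypotheses (q_neq0 : q != 0) (q4 : q ^+ 4 != 1) (qm : qint q m != 0).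
Variables (a b : nat).
Hypothesis ab0 : a = 0 \/ b = 0.
Local Notation l := (a + b)%N.
Local Notation lev := (lev l).
Local Notation D j := (std q m (0 < a)%N l j).
Local Notation T j := (seq_sub (words a b j)).
Local Notation Q := (q%:P).
Local Notation Qi := (q^-1%:P).
Local Notation U := (@tens_U {poly k} Q Qi (qint q m)%:P ((q ^ m)%:P - 'X) a b).
Local Notation C := (@tens_C {poly k} Q a b).
Let twW := half_diagram_tower q_neq0 q4 qm ab0.
Local Notation diag_vecW :=
  (diag_vec l (@half_U k q m a b) (@half_C k q m a b)
    (ev0 (@hcoord k q m a b 0 (base_vec {poly k} a b)))).

Let q2 : qint q 2 != 0.
Proof. by rewrite qint2 // q_plus_inv. Qed.

Lemma diag_vec_half_diagram j (t : T j) : diag_vecW j (val t) = basis_vec k t :> {ffun T j -> k^o}.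
Proof.
pose span j (x : weight_tens {poly k} a b j) := diag_span a b U C (base_vec {poly k} a b) x.
have span_b j' (p : weight_tens {poly k} a b j') : span j' (@beta k q m a b j' p).
  by apply/span_beta; exists p.
have betaE j' x : span j' x -> exists p, x = @beta k q m a b j' p.
  by move=> /span_beta[p <-]; exists p.
have [||||||_ <-] := @diag_vec_morph l (weight_tens {poly k} a b)
  (half_space k a b) (@U) (@half_U k q m a b)
  (@C) (@half_C k q m a b) (base_vec _ a b) (ev0 (hcoord q m (base_vec _ a b)))
  (fun j x => ev0 (hcoord q m x)) span _ _ _ _ _ _ j (val t).
- move=> j' i x lti /betaE[p ->]; rewrite -(beta_latt_U m q_neq0 q4 ab0) //; exact: span_b.
- move=> j' x /betaE[p ->]; rewrite -(beta_latt_C m q_neq0 q4 ab0); exact: span_b.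
- move=> j' i x lti /betaE[p ->]; rewrite -(beta_latt_U m q_neq0 q4 ab0) //.
  by rewrite !(betaK q_neq0 q4 qm ab0) (half_UE q_neq0 q4 qm ab0).
- move=> j' x /betaE[p ->]; rewrite -(beta_latt_C m q_neq0 q4 ab0) //.
  by rewrite !(betaK q_neq0 q4 qm ab0) (half_CE q_neq0 q4 qm ab0).
- apply: (diag_span_diag_vec (j := 0) _ _ _ (s := nseq a true ++ nseq b false)).
  by rewrite /word !count_cat !count_nseq /= !mul0n !mul1n !addn0 !eqxx.
- by [].
have -> : diag_vec l (@U) (@C) (base_vec _ a b) j (val t) = @beta k q m a b j (basis_vec {poly k} t).
  rewrite /beta (bigD1 t) //= ffunE eqxx scale1r big1 ?addr0 // => s /negbTE st.
  by rewrite ffunE st scale0r.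
rewrite (betaK q_neq0 q4 qm ab0); apply/ffunP => s; rewrite !ffunE.
by case: eqP; rewrite hornerC.
Qed.

(** The half-diagrams span the standard module, and their images form a basis. *)
Lemma std_half_diagram j : exists h : {linear D j -> repmod (tower_rep twW j)}, bijective h.
Proof.
have [h hE] := std_hom q2 twW j.
pose hk (x : stdN q m a b j) : half_space k a b j := h x.
have hk_lin : linear hk.
  move=> c x y; rewrite /hk linearD; congr (_ + _).
  rewrite (_ : h (c *: x) = bconst q m (lev j) c *: h x); last exact: linearZ.
  exact: (@repmod_scaleE k _ _ (tower_rep twW j) (TConst c) (h x)).
pose dD := diag_vec l (@stdU k q m a b) (@stdC k q m q2 a b) (stdv q m a b) j.
pose g (y : half_space k a b j) : stdN q m a b j := \sum_t (y t : k) *: dD (val t).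
have hg y : hk (g y) = y.
  pose F : {linear stdN q m a b j -> half_space k a b j} :=
    HB.pack hk (GRing.isLinear.Build _ _ _ _ hk hk_lin).
  have Fg : F (g y) = \sum_t (y t : k) *: F (dD (val t)).
    by rewrite linear_sum; apply: eq_bigr => t _; rewrite linearZ.
  rewrite [LHS]Fg [RHS](finfun_sum (R := k) (T := T j)); apply: eq_bigr => t _.
  by congr (_ *: _); rewrite -diag_vec_half_diagram -hE.
exists h; exists g => [x|y]; last exact: hg.
have [p xE] := diag_span_sum (std_span q2 ab0 (x : stdN q m a b j)).
have -> : (x : stdN q m a b j) = g [ffun t => p t].
  by rewrite xE; apply: eq_bigr => t _; rewrite ffunE.
by congr g; exact: hg.
Qed.

End Comparison.

Theorem theorem3 (k : closedFieldType) (q : k) (m : int)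
    (q_neq0 : q != 0) (q4_neq1 : q ^+ 4 != 1)
    (lambda12 : lambda1 q m != lambda2 q m)
    (lambda1_q2 : lambda1 q m != q ^+ 2 * lambda2 q m)
    (n : nat) (n_ge1 : (1 <= n)%N)
    (lam mu : int) (lam_in : lam \in Lambda n) (mu_in : mu \in Lambda n)
    (L : lmodType (blob q m n)) (L_mu : is_Lmod mu L) :
  exists c : nat,
    has_multiplicity (Delta q m n lam) L c /\
    has_multiplicity (Mmod m q_neq0 q4_neq1 n lam) L c.
Proof.
have qm : qint q m != 0.
  by apply: contra lambda12; rewrite /qint mulrBl subr_eq0.
have [a [b [j [ab0 nE lamE]]]] : exists (a b j : nat), [/\ a = 0 \/ b = 0,
    n = lev (a + b) j & lam = b%:Z - a%:Z].
  have /mapP[i] := lam_in; rewrite mem_iota => /andP[_ lt_i] lamE.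
  have [le2|lt2] := leqP (i + i) n.
    by exists 0, (n - (i + i))%N, i; split; [left | rewrite levE; lia | lia].
  by exists (i + i - n)%N, 0, (n - i)%N; split; [right | rewrite levE; lia | lia].
subst n lam.
have [c [cM cW]] := tensor_half_diagram_multiplicity q_neq0 q4_neq1 qm ab0 L.
exists c; split=> //; rewrite (Delta_std q m j ab0).
have [h hbij] := std_half_diagram q_neq0 q4_neq1 qm ab0 j.
exact: has_multiplicity_iso hbij cW.
Qed.
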